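(* Let $f=\sum_{i=1}^9 p_i^6$ be a rank $9$ ternary sextic, in affine notation (i.e. $p_1,\dots,p_9$ are vectors in $\mathbb{C}^3$). Then $$\det A_f=\lambda\, N(p_1,\dots,p_9)^2$$ for a nonzero scalar $\lambda\in\mathbb{C}^*$ (as an identity of polynomials in the coordinates of $p_1,\dots,p_9$, with $\lambda$ a constant).
   Context: Work over $\mathbb{C}$. A vector $p\in\mathbb{C}^3$ represents a point of $\mathbb{P}^2=\mathbb{P}(\mathbb{C}^3)$, and $p^6\in\mathrm{Sym}^6\mathbb{C}^3$ is its sixth power. The rank of a sextic $f\in\mathrm{Sym}^6\mathbb{C}^3$ is the minimal number of sixth powers of which it is a linear combination. The map $A_f$: let $T$ be the tangent bundle of $\mathbb{P}^2$ and $E=\mathrm{Sym}^2T$, a rank $3$ bundle with $\dim H^0(E)=27$ and $E\cong E^\vee\otimes\mathcal{O}(6)$. For $f\in \mathrm{Sym}^6\mathbb{C}^3=H^0(\mathbb{P}^2,\mathcal{O}(6))^\vee$, let $A_f:H^0(E)\to H^0(E^\vee\otimes\mathcal{O}(6))^\vee$ be the map, linear in $f$, given by contraction: $A_f(s)(t)=f(\langle s,t\rangle)$, where $\langle s,t\rangle\in H^0(\mathcal{O}(6))$ is the natural pairing of $s\in H^0(E)$ with $t\in H^0(E^\vee\otimes\mathcal{O}(6))$. Its determinant is taken in fixed bases. Equivalently, $A_f$ is induced by the map $P_f:\mathrm{End}(\mathrm{Sym}^2\mathbb{C}^3)\to\mathrm{End}(\mathrm{Sym}^2\mathbb{C}^3)$,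 linear in $f$, with $P_{v^6}(M^2)(w^2)=(M(v)\wedge v\wedge w)^2v^2$ for $M\in\mathrm{End}(\mathbb{C}^3)$, $v,w\in\mathbb{C}^3$ (where $M^2(u^2)=(M(u))^2$), via the quotient $\mathrm{End}(\mathrm{Sym}^2\mathbb{C}^3)\to H^0(E)$ and the inclusion $H^0(E^\vee\otimes\mathcal{O}(6))^\vee\to\mathrm{End}(\mathrm{Sym}^2\mathbb{C}^3)$. The polynomial $N$: let $C(p_1,\dots,p_{10})$ be the determinant of the $10\times 10$ matrix whose $i$-th row is the evaluation at $p_i$ of the monomial basis of cubic forms in three variables; it has degree $3$ in each $p_i$ and vanishes iff $p_1,\dots,p_{10}$ lie on a cubic. Let $J$ be the $3\times 28$ Jacobian matrix (matrix of first partial derivatives) of the monomial basis of sextic forms in three variables, $J(p)$ its evaluation at $p$, and $T(p_1,\dots,p_9)$ the $27\times 28$ matrix obtained by stacking $J(p_1),\dots,J(p_9)$. Let $R(p_1,\dots,p_9;p_{10})$ be the determinant of the $28\times 28$ matrix obtained by adding to $T(p_1,\dots,p_9)$ a last row, the evaluation at $p_{10}$ of the monomial basis of sextic forms. Then there is a factorization $R(p_1,\dots,p_9;p_{10})=C(p_1,\dots,p_{10})^2\,N(p_1,\dots,p_9)$, which defines $N$, a nonzero multihomogeneous polynomial of degree $9$ in the coordinates of each of $p_1,\dots,p_9$. *)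

(* Defs.v *)
From HB Require Import structures.
From mathcomp Require Import all_boot all_order all_algebra.
From mathcomp Require Import mpoly complex reals.

Set Implicit Arguments.
Unset Strict Implicit.
Unset Printing Implicit Defensive.

Import GRing.Theory.
Local Open Scope ring_scope.

(* Homogeneous polynomials of degree d in three variables play two roles.
   [Sym K d] is the symmetric power Sym^d V of V = K^3, the variables being the
   standard basis of V; [Form K d] is H^0(P^2, O(d)), the variables being the
   coordinate functions on V. *)
Notation Sym K d := (dhomog 3 K d).
Notation Form K d := (dhomog 3 K d).

Section Forms.
Variable K : fieldType.
Implicit Types (u v w : 'rV[K]_3).

Definition evalf (v : 'rV[K]_3) (g : {mpoly K[3]}) : K := g.@[fun i => v 0 i].

Definition lin (v : 'rV[K]_3) : {mpoly K[3]} := \sum_(i < 3) v 0 i *: 'X_i.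

Lemma lin_homog v : lin v \is 1.-homog.
Proof. by apply: rpred_sum => i _; rewrite rpredZ // dhomogX /= mdeg1. Qed.

Lemma lin_is_linear : linear lin.
Proof.
move=> c u v; rewrite /lin scaler_sumr -big_split /=; apply: eq_bigr => i _.
by rewrite !mxE scalerDl scalerA.
Qed.

HB.instance Definition _ :=
  GRing.isLinear.Build K 'rV[K]_3 {mpoly K[3]} _ lin lin_is_linear.

Definition sprod (u w : 'rV[K]_3) : Sym K 2 :=
  DHomog (dhomogM (lin_homog u) (lin_homog w)).

Definition pow6 (v : 'rV[K]_3) : Sym K 6 := DHomog (dhomogMn 6 (lin_homog v)).

(* The identification Sym^6 V = H^0(O(6))^vee: f acts on g as g(d/dX) f / 6!,
   normalised so that v^6 acts as evaluation at v (pow6_act below). *)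
Definition sextic_act (f : Sym K 6) (g : Form K 6) : K :=
  (6`!)%:R^-1 * \sum_(m <- msupp g) (g : {mpoly K[3]})@_m *
    ((f : {mpoly K[3]})^`M[m])@_0.

Lemma mderiv_linX v k i :
  (lin v ^+ k)^`M(i) = (k%:R * v 0 i) *: lin v ^+ k.-1.
Proof.
have dl : (lin v)^`M(i) = (v 0 i)%:MP.
  rewrite /lin raddf_sum (bigD1 i) //= big1 ?addr0 => [|l li].
    rewrite mderivZ mderivX mnm1E eqxx scale1r.
    have -> : (U_(i) - U_(i))%MM = 0%MM by apply/mnmP => l; rewrite mnmBE mnm0E subnn.
    by rewrite mpolyX0 -mul_mpolyC mulr1.
  by rewrite mderivZ mderivX mnm1E (negbTE li) scale0r scaler0.
elim: k => [|k IH]; first by rewrite expr0 -mpolyC1 mderivC mul0r scale0r.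
rewrite exprS mderivM IH dl mul_mpolyC -scalerAr.
case: k {IH} => [|k]; first by rewrite !mul0r scale0r addr0 mul1r.
rewrite -exprS /= -scalerDl; congr (_ *: _).
by rewrite [in RHS]mulrSr mulrDl mul1r addrC.
Qed.

Lemma mderivm_linX v k (m : 'X_{1..3}) :
  (lin v ^+ k)^`M[m] =
  ((k ^_ (mdeg m))%:R * \prod_(i < 3) v 0 i ^+ m i) *: lin v ^+ (k - mdeg m).
Proof.
move dm: (mdeg m) => d; elim: d => [|d IH] in m dm *.
  move/eqP: dm; rewrite mdeg_eq0 => /eqP ->.
  rewrite mderivm0m subn0 ffactn0 big1 ?mulr1 ?scale1r // => i _.
  by rewrite mnm0E expr0.
have [i mi] : exists i, (0 < m i)%N.
  apply/existsP; apply: contra_eqT dm; rewrite negb_exists => /forallP m0.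
  rewrite mdegE big1 // => i _; apply/eqP; rewrite -leqn0 leqNgt; exact: m0.
have [m' em] : exists m', m = (m' + U_(i))%MM.
  exists (m - U_(i))%MM; rewrite submK //; apply/mnm_lepP => j.
  by rewrite mnm1E; case: eqP => [<-|].
move: dm; rewrite em mdegD mdeg1 addn1 => -[dm'].
rewrite mderivmDm IH // mderivmZ mderivmU1m mderiv_linX scalerA; congr (_ *: _).
  rewrite ffactnSr natrM -!mulrA; congr (_ * _).
  rewrite mulrCA; congr (_ * _).
  rewrite (bigD1 i) //= [in RHS](bigD1 i) //= mnmDE mnm1E eqxx addn1 exprSr.
  rewrite mulrAC; congr (_ * _); apply: eq_bigr => j ji.
  by rewrite mnmDE mnm1E eq_sym (negbTE ji) addn0.
by rewrite -subnS.
Qed.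

Lemma pow6_act v (g : Form K 6) :
  (6`!)%:R != 0 :> K -> sextic_act (pow6 v) g = evalf v g.
Proof.
move=> nz; rewrite /sextic_act /evalf mevalE mulr_sumr !big_seq.
apply: eq_bigr => m mg; have dm : mdeg m = 6%N.
  by have /dhomogP := dhomog_is_dhomog g; apply.
rewrite mulrCA; congr (_ * _); rewrite [val (pow6 v)]/= mderivm_linX dm subnn.
by rewrite expr0 mcoeffZ mcoeff1 eqxx mulr1 ffactnn mulrA mulVf // mul1r.
Qed.

(* By the Euler sequence twisted by O(2), a section of E = Sym^2 T lifts to a
   quadratic map V -> Sym^2 V, v |-> phi (v^2), and two lifts phi agree iff they
   agree modulo v V in every fibre Sym^2 (V / v).  Hence H^0(E) is the quotient
   of End(Sym^2 V) by the phi such that [zero_section phi]. *)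
Definition zero_section (phi : 'Hom(Sym K 2, Sym K 2)) : Prop :=
  forall v, exists u, phi (sprod v v) = sprod v u.

(* Dually, Sym^2 T^vee (6) is the subbundle of Sym^2 V^vee (4) of the quadratic
   forms whose contraction with v is zero; an element q of
   Sym^2 V^vee (x) H^0(O(4)) is encoded as a map Sym^2 V -> H^0(O(4)). *)
Definition dual_section (q : 'Hom(Sym K 2, Form K 4)) : Prop :=
  forall v u, evalf v (q (sprod v u)) = 0.

Definition unitv (a : 'I_3) : 'rV[K]_3 := delta_mx 0 a.

Lemma pairing_homog (phi : 'Hom(Sym K 2, Sym K 2)) (q : 'Hom(Sym K 2, Form K 4)) :
  \sum_(a < 3) \sum_(b < 3)
    'X_a * 'X_b * (q (phi (sprod (unitv a) (unitv b))) : {mpoly K[3]})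
  \is 6.-homog.
Proof.
apply: rpred_sum => a _; apply: rpred_sum => b _.
have hX i : ('X_i : {mpoly K[3]}) \is 1.-homog by rewrite dhomogX /= mdeg1.
exact: (dhomogM (dhomogM (hX a) (hX b)) (dhomog_is_dhomog _)).
Qed.

(* The sextic v |-> q_v (phi (v^2)), see pairingE. *)
Definition pairing phi q : Form K 6 := DHomog (pairing_homog phi q).

Lemma sprod_expand v :
  sprod v v =
  \sum_(a < 3) \sum_(b < 3) (v 0 a * v 0 b) *: sprod (unitv a) (unitv b).
Proof.
apply: val_inj; rewrite [LHS]/= {1 2}(row_sum_delta v) linear_sum mulr_suml.
rewrite [RHS](linear_sum (@mpoly_of_dhomog 3 K 2)); apply: eq_bigr => a _.
rewrite [RHS](linear_sum (@mpoly_of_dhomog 3 K 2)) mulr_sumr.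
by apply: eq_bigr => b _; rewrite !linearZ /= -scalerAl -scalerAr scalerA.
Qed.

Lemma pairingE phi q v : evalf v (pairing phi q) = evalf v (q (phi (sprod v v))).
Proof.
rewrite sprod_expand 2!linear_sum (linear_sum (@mpoly_of_dhomog 3 K 4)).
rewrite /evalf /= !raddf_sum; apply: eq_bigr => a _.
rewrite 2!linear_sum (linear_sum (@mpoly_of_dhomog 3 K 4)) !raddf_sum.
apply: eq_bigr => b _; rewrite !linearZ /= mevalZ !mevalM.
by rewrite !mevalXU.
Qed.

Lemma pairing_zero phi q v :
  zero_section phi -> dual_section q -> evalf v (pairing phi q) = 0.
Proof. by move=> /(_ v)[u e] hq; rewrite pairingE e. Qed.

Definition contraction_map (f : Sym K 6)
    (phi : 'Hom(Sym K 2, Sym K 2)) (q : 'Hom(Sym K 2, Form K 4)) : K :=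
  sextic_act f (pairing phi q).

(* The s_i represent a basis of U / W. *)
Definition basis_mod (L : lmodType K) (U W : L -> Prop) n (s : 'I_n -> L) :=
  (forall i, U (s i)) /\
  forall x, U x -> exists! c : 'rV[K]_n, W (x - \sum_(i < n) c 0 i *: s i).

Definition is_basis_H0E (s : 'I_27 -> 'Hom(Sym K 2, Sym K 2)) : Prop :=
  basis_mod (fun _ => True) zero_section s.

Definition is_basis_H0Edual6 (t : 'I_27 -> 'Hom(Sym K 2, Form K 4)) : Prop :=
  basis_mod dual_section (fun q => q = 0) t.

(* Matrix of A_f in the basis s of the source and the dual basis of t in the
   target (image of s_j in column j). *)
Definition A_mx s t (f : Sym K 6) : 'M[K]_27 :=
  \matrix_(i, j) contraction_map f (s j) (t i).

(* A family of points is the matrix of its rows. *)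
Definition sum_pow6 m (p : 'M[K]_(m, 3)) : Sym K 6 :=
  \sum_(i < m) pow6 (row i p).

Definition monom d (k : nat) : 'X_{1..3} :=
  nth 0%MM [seq s2m t | t : d.-tuple 'I_3 <- enum (basis 3 d)] k.

Definition evalrow d m (v : 'rV[K]_3) : 'rV[K]_m :=
  \row_(k < m) evalf v 'X_[monom d k].

Definition C_det (p : 'M[K]_(10, 3)) : K :=
  \det (\matrix_(i < 10) evalrow 3 10 (row i p)).

Definition jacobian (v : 'rV[K]_3) : 'M[K]_(3, 28) :=
  \matrix_(j < 3, k < 28) evalf v ('X_[monom 6 k])^`M(j).

(* mxvec lists entries in row-major order, so this stacks the Jacobians. *)
Definition T_mx (p : 'M[K]_(9, 3)) : 'M[K]_(9 * 3, 28) :=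
  \matrix_(r, k)
    mxvec (\matrix_(i < 9, j < 3) jacobian (row i p) j k) 0 r.

Definition R_det (p : 'M[K]_(9, 3)) (v : 'rV[K]_3) : K :=
  \det (col_mx (T_mx p) (evalrow 6 28 v) : 'M[K]_(9 * 3 + 1)).

(* Value of a polynomial in the 27 coordinates of nine points. *)
Definition eval9 (N : {mpoly K[9 * 3]}) (p : 'M[K]_(9, 3)) : K :=
  N.@[fun r => mxvec p 0 r].

Definition defines_N (N : {mpoly K[9 * 3]}) : Prop :=
  forall (p : 'M[K]_(9, 3)) (v : 'rV[K]_3),
    R_det p v = C_det (col_mx p v : 'M[K]_(9 + 1, 3)) ^+ 2 * eval9 N p.

End Forms.

(* Main.v *)
From HB Require Import structures.
From mathcomp Require Import all_boot fingroup perm.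
Require Import Defs.
From mathcomp Require Import all_boot all_order all_algebra separable.
From mathcomp Require Import mpoly complex reals.
From mathcomp Require Import ring zify.

(** Both sides are polynomials in the coordinates of the nine points, and
    det A_f is, up to a constant on suitable families of points, the square of
    a determinant D that has the same zeros as N on a general line.

    A section of Sym^2 T is a function F(v; xi, eta), quadratic in v and a
    symmetric bilinear form on the covectors xi, eta killing v.  If u, w
    complete p to a basis, then p x u and p x w is a frame of such covectors,
    and F at p is given by its three values on the frame.  Nine points thus
    give a 27 x 27 matrix X of values ([frame_mx]), with determinant D.  Writing
    the fibrewise pairing in these frames turns the matrix of A_f into
    X^T Q X, where Q depends only on the volumes [p, u, w]; hence det A_f is a
    constant times D^2 as long as the volumes stay fixed
    ([det_canonical_square]).

    If D = 0, some section s vanishes at the nine points.  Its discriminant,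
    the determinant of the quadratic form on the rank two fibres, is a sextic
    singular at those points, and so is G^2 where G is the cubic
    v |-> C(p_1, ..., p_9, v).  Unless the two are proportional, a combination
    of them lies in the kernel of the matrix whose determinant is R, at a last
    point where G does not vanish, so N = 0 ([N_vanish]).

    Let p_9 run along a line a + t b, with b in its frame, so that all volumes
    are constant in t.  Then D and N have degree at most 9 in t.  If D has nine
    distinct roots and the discriminant is not proportional to G^2 at any of
    them, then D divides N and N = kappa D, so that N^2 and det A_f are
    proportional on this line.  These conditions on the line are open by a
    resultant argument, so a single good line gives the proportionality on
    every line ([N_cross_last]).  Both N^2 and det A_f are symmetric in the
    points, so any of the points may be moved; changing them one after the
    other proves that N^2 and det A_f are proportional
    ([N_proportional]).  Neither is identically zero, hence the theorem.

    The good line is explicit: p_1, ..., p_8 are the coordinate points, the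
    points (1 : +-1 : +-1) and (1 : 2 : 3).  The sections vanishing at these
    eight points form a space of dimension 3, and D vanishes exactly where the
    moving point meets one of the nine lines that join a coordinate point to
    one of the other five points.  All cubics through the eight points meet again at (6 : 3 : 2), so
    that G vanishes there; at each of the nine roots the discriminant does not
    vanish at this point, and thus it is not proportional to G^2. *)

Set Implicit Arguments.
Unset Strict Implicit.
Unset Printing Implicit Defensive.

Import Order.TTheory GRing.Theory Num.Theory.
Local Open Scope ring_scope.

(** * Sections of the symmetric square of the tangent bundle *)

Section Sections.
Variable A : comNzRingType.
Implicit Types (v u w x y : nat -> A) (s : 'I_27 -> A).

(** Vectors are indexed by [nat], so that formulas in coordinates compute; only the
    entries 0, 1, 2 matter, except that [cross] repeats its last entry. *)
Definition cross v u : nat -> A := fun i =>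
  match i with
  | 0 => v 1%N * u 2%N - v 2%N * u 1%N
  | 1 => v 2%N * u 0%N - v 0%N * u 2%N
  | _ => v 0%N * u 1%N - v 1%N * u 0%N
  end.

Definition vol v u w : A :=
  v 0%N * cross u w 0%N + v 1%N * cross u w 1%N + v 2%N * cross u w 2%N.

Definition qmons : seq (nat * nat) :=
  [:: (0, 0); (0, 1); (1, 1); (0, 2); (1, 2); (2, 2)]%N.

(** The monomials v_k v_l xi_m eta_n without the factor v_2 xi_2: the other ones are
    redundant on the covectors killing v, where v_2 xi_2 = - v_0 xi_0 - v_1 xi_1. *)
Definition sec_mons : seq ((nat * nat) * (nat * nat)) :=
  [seq (a, b) | a <- take 3 qmons, b <- qmons]
  ++ [seq (a, b) | a <- drop 3 qmons, b <- take 3 qmons].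

Definition sec_mon (j : 'I_27) := nth ((0, 0), (0, 0))%N sec_mons j.

Definition mon_val (j : 'I_27) v x y : A :=
  let: ((k, l), (m, n)) := sec_mon j in
  v k * v l * (x m * y n + x n * y m).

Definition sec_val s v x y : A := \sum_(j < 27) s j * mon_val j v x y.

(** The covectors v x u and v x w span the plane of covectors killing v, so their
    cross product is a multiple of v; the factor is the volume. *)
Lemma crossK v u w i : (i < 3)%N ->
  cross (cross v u) (cross v w) i = vol v u w * v i.
Proof. by case: i => [|[|[|//]]] _; rewrite /vol /cross; ring. Qed.

Definition std (a : nat) : nat -> A := fun i => (i == a)%:R.

(** The value at v of the adjugate of the 3 x 3 Gram matrix P of the section. Up to
    a square it is the determinant of P on the plane of covectors killing v, see
    [disc_frame]. *)
Definition disc_val s v : A :=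
  let P a b := sec_val s v (std a) (std b) in
    v 0%N ^+ 2 * (P 1%N 1%N * P 2%N 2%N - P 1%N 2%N ^+ 2)
  + v 1%N ^+ 2 * (P 0%N 0%N * P 2%N 2%N - P 0%N 2%N ^+ 2)
  + v 2%N ^+ 2 * (P 0%N 0%N * P 1%N 1%N - P 0%N 1%N ^+ 2)
  + v 0%N * v 1%N * (P 0%N 2%N * P 1%N 2%N - P 0%N 1%N * P 2%N 2%N) *+ 2
  + v 0%N * v 2%N * (P 0%N 1%N * P 1%N 2%N - P 0%N 2%N * P 1%N 1%N) *+ 2
  + v 1%N * v 2%N * (P 0%N 1%N * P 0%N 2%N - P 1%N 2%N * P 0%N 0%N) *+ 2.

Lemma sec_monP j : let: ((k, l), (m, n)) := sec_mon j in
  [&& k < 3, l < 3, m < 3 & n < 3]%N.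
Proof.
have /allP H : all (fun q : (nat * nat) * (nat * nat) =>
   let: ((k, l), (m, n)) := q in [&& k < 3, l < 3, m < 3 & n < 3]%N) sec_mons by [].
by apply: H; apply: mem_nth; rewrite /= ltn_ord.
Qed.

Lemma mon_valC j v x y : mon_val j v x y = mon_val j v y x.
Proof. by rewrite /mon_val; case: (sec_mon j) => [[k l] [m n]]; ring. Qed.

Lemma sec_valC s v x y : sec_val s v x y = sec_val s v y x.
Proof. by apply: eq_bigr => j _; rewrite mon_valC. Qed.

Lemma sec_val_std s v x y :
  sec_val s v x y = \sum_(a < 3) \sum_(b < 3) sec_val s v (std a) (std b) * x a * y b.
Proof.
transitivity (\sum_(a < 3) \sum_(b < 3) \sum_(j < 27)
     s j * (mon_val j v (std a) (std b) * x a * y b)); last first.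
  apply: eq_bigr => a _; apply: eq_bigr => b _.
  by rewrite /sec_val !mulr_suml; apply: eq_bigr => j _; ring.
under eq_bigr do rewrite exchange_big /=.
rewrite exchange_big /=; apply: eq_bigr => j _.
under eq_bigr do rewrite -mulr_sumr.
rewrite -mulr_sumr; congr (_ * _); move: (sec_monP j); rewrite /mon_val.
case: (sec_mon j) => [[k l] [m n]] /and4P[_ _ m3 n3].
rewrite !big_ord_recr !big_ord0 /= !add0r /std.
case: m m3 => [|[|[|//]]] _; case: n n3 => [|[|[|//]]] _ /=; ring.
Qed.

(** Cauchy-Binet: a 2 x 2 Gram determinant is the adjugate of the form evaluated at
    the cross product. *)
Lemma gram_det s v x y :
  sec_val s v x x * sec_val s v y y - sec_val s v x y ^+ 2 =
  let P a b := sec_val s v (std a) (std b) in let z := cross x y in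
    z 0%N ^+ 2 * (P 1%N 1%N * P 2%N 2%N - P 1%N 2%N ^+ 2)
  + z 1%N ^+ 2 * (P 0%N 0%N * P 2%N 2%N - P 0%N 2%N ^+ 2)
  + z 2%N ^+ 2 * (P 0%N 0%N * P 1%N 1%N - P 0%N 1%N ^+ 2)
  + z 0%N * z 1%N * (P 0%N 2%N * P 1%N 2%N - P 0%N 1%N * P 2%N 2%N) *+ 2
  + z 0%N * z 2%N * (P 0%N 1%N * P 1%N 2%N - P 0%N 2%N * P 1%N 1%N) *+ 2
  + z 1%N * z 2%N * (P 0%N 1%N * P 0%N 2%N - P 1%N 2%N * P 0%N 0%N) *+ 2.
Proof.
rewrite (sec_val_std s v x x) (sec_val_std s v y y) (sec_val_std s v x y).
rewrite !big_ord_recr !big_ord0 /= !add0r.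
rewrite (sec_valC s v (std 1%N) (std 0%N)) (sec_valC s v (std 2%N) (std 0%N))
        (sec_valC s v (std 2%N) (std 1%N)).
move: (sec_val s v (std 0%N) (std 0%N)) (sec_val s v (std 0%N) (std 1%N))
  (sec_val s v (std 0%N) (std 2%N))
  (sec_val s v (std 1%N) (std 1%N)) (sec_val s v (std 1%N) (std 2%N)) (sec_val s v (std 2%N)
    (std 2%N)).
by move=> P00 P01 P02 P11 P12 P22; ring.
Qed.

(** Divided by vol^2, the determinant of a section in a moving frame no longer
    depends on the frame: it is the value of a sextic. *)
Lemma disc_frame s v u w (x := cross v u) (y := cross v w) :
  vol v u w ^+ 2 * disc_val s v = sec_val s v x x * sec_val s v y y - sec_val s v x y ^+ 2.
Proof.
rewrite gram_det; cbv zeta; rewrite /x /y !crossK // /disc_val.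
by ring.
Qed.

(** The pairing Sym^2 T (x) (Sym^2 T^vee)(6) -> O(6) on monomials, where (Sym^2
    T^vee)(6) is identified with Sym^2 T by means of v x -. *)
Definition mon_pairing (l k : 'I_27) v : A :=
  let: ((a, b), (m, n)) := sec_mon l in
  v a * v b * mon_val k v (cross v (std m)) (cross v (std n)).

Lemma cross_frame v u w m i : (m < 3)%N -> (i < 3)%N ->
  vol v u w * cross v (std m) i =
  cross v u m * cross v w i - cross v w m * cross v u i.
Proof.
by case: m i => [|[|[|//]]] [|[|[|//]]] _ _; rewrite /vol /cross /std /=; ring.
Qed.

(** The pairing of two binary quadratic forms is the polarization of their
    determinant in any frame; this is what makes the contraction matrix a Gram
    matrix. *)
Lemma mon_pairing_frame l k v u w (x := cross v u) (y := cross v w) :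
  vol v u w ^+ 2 * mon_pairing l k v *+ 2 =
  mon_val l v x x * mon_val k v y y - mon_val l v x y * mon_val k v x y *+ 2
  + mon_val l v y y * mon_val k v x x.
Proof.
move: (sec_monP l) (sec_monP k); rewrite /mon_pairing /mon_val.
case: (sec_mon l) => [[a b] [m n]]; case: (sec_mon k) => [[a' b'] [m' n']].
move=> /and4P[_ _ m3 n3] /and4P[_ _ m3' n3'].
transitivity ((v a * v b) * (v a' * v b') *
  ((vol v u w * cross v (std m) m') * (vol v u w * cross v (std n) n') +
   (vol v u w * cross v (std m) n') * (vol v u w * cross v (std n) m')) *+ 2).
  by ring.
by rewrite !cross_frame // -/x -/y; ring.
Qed.

End Sections.

Section Morph.
Variables (A B : comNzRingType) (f : {rmorphism A -> B}).
Implicit Types (v u w x y : nat -> A) (s : 'I_27 -> A).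

Lemma rmorph_cross v u i : f (cross v u i) = cross (f \o v) (f \o u) i.
Proof. by case: i => [|[|i]]; rewrite /= rmorphB !rmorphM. Qed.

Lemma rmorph_vol v u w : f (vol v u w) = vol (f \o v) (f \o u) (f \o w).
Proof. by rewrite /vol !rmorphD !rmorphM !rmorph_cross. Qed.

Lemma rmorph_mon_val j v x y : f (mon_val j v x y) = mon_val j (f \o v) (f \o x) (f \o y).
Proof.
by rewrite /mon_val; case: (sec_mon j) => [[k l] [m n]]; rewrite !(rmorphM, rmorphD).
Qed.

Lemma eq_mon_val j v v' x x' y y' : v =1 v' -> x =1 x' -> y =1 y' ->
  mon_val j v x y = mon_val j v' x' y' :> A.
Proof.
move=> e1 e2 e3; rewrite /mon_val; case: (sec_mon j) => [[k l] [m n]].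
by rewrite !e1 !e2 !e3.
Qed.

Lemma rmorph_sec_val s v x y : f (sec_val s v x y) = sec_val (f \o s) (f \o v) (f \o x)
  (f \o y).
Proof. by rewrite rmorph_sum; apply: eq_bigr => j _; rewrite rmorphM rmorph_mon_val. Qed.

Lemma rmorph_disc_val s v : f (disc_val s v) = disc_val (f \o s) (f \o v).
Proof.
have e a b : f (sec_val s v (std A a) (std A b)) = sec_val (f \o s) (f \o v) (std B a)
    (std B b).
  rewrite rmorph_sec_val; apply: eq_bigr => j _; congr (_ * _).
  by rewrite /mon_val; case: (sec_mon j) => [[? ?] [? ?]]; rewrite /std /= !rmorph_nat.
by rewrite /disc_val !(rmorphD, rmorphN, rmorphM, rmorphMn, rmorphXn) /= !e.
Qed.

Lemma eq_sec_val s s' v v' x x' y y' : s =1 s' -> v =1 v' -> x =1 x' -> y =1 y' ->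
  sec_val s v x y = sec_val s' v' x' y'.
Proof. by move=> e1 e2 e3 e4; apply: eq_bigr => j _; rewrite e1 (eq_mon_val j e2 e3 e4). Qed.

Lemma eq_disc_val s s' v v' : s =1 s' -> v =1 v' -> disc_val s v = disc_val s' v'.
Proof.
move=> e1 e2; have e a b := eq_sec_val e1 e2 (frefl (std A a)) (frefl (std A b)).
by rewrite /disc_val !e !e2.
Qed.

Lemma eq_cross v v' u u' : v =1 v' -> u =1 u' -> cross v u =1 cross v' u'.
Proof. by move=> e1 e2 [|[|i]]; rewrite /cross !e1 !e2. Qed.

End Morph.

(** * Ternary forms in the kernels of the determinants C and R *)

Section Monomials.
Variables d n : nat.
Hypothesis dn : n = 'C(d + 2, d).

Lemma monom_mem k : (k < n)%N -> mdeg (monom d k) = d.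
Proof.
move=> kn; apply/eqP; rewrite basis_cover; apply: mem_nth.
by rewrite size_basis -dn.
Qed.

Lemma monom_inj k l : (k < n)%N -> (l < n)%N ->
  (monom d k == monom d l) = (k == l).
Proof. by move=> kn ln; rewrite nth_uniq ?size_basis -?dn ?uniq_basis. Qed.

Lemma monom_surj (m : 'X_{1..3}) : mdeg m = d ->
  exists2 k, (k < n)%N & m = monom d k.
Proof.
move/eqP; rewrite basis_cover => mb.
pose b := [seq s2m t | t : d.-tuple 'I_3 <- enum (basis 3 d)].
exists (index m b); last by rewrite /monom nth_index.
by rewrite dn -(size_basis 2 d) index_mem.
Qed.

Variable K : fieldType.
Implicit Types g : {mpoly K[3]}.

Definition form_of (c : 'I_n -> K) : {mpoly K[3]} := \sum_(k < n) c k *: 'X_[monom d k].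

Lemma form_of_homog c : form_of c \is d.-homog.
Proof.
by apply: rpred_sum => k _; rewrite rpredZ // dhomogX /= monom_mem.
Qed.

Lemma form_ofK c k : (form_of c)@_(monom d (k : 'I_n)) = c k.
Proof.
rewrite /form_of raddf_sum (bigD1 k) //= big1 ?addr0.
  by rewrite mcoeffZ mcoeffX eqxx mulr1.
move=> l lk; rewrite mcoeffZ mcoeffX monom_inj //.
by rewrite (inj_eq val_inj) (negbTE lk) mulr0.
Qed.

Lemma homog_form_of g : g \is d.-homog ->
  g = form_of (fun k => g@_(monom d k)).
Proof.
move=> hg; apply/mpolyP => m; have [dm|dm] := eqVneq (mdeg m) d.
  have [k kn ->] := monom_surj dm.
  by rewrite (form_ofK _ (Ordinal kn)).
by rewrite !(dhomog_nemf_coeff _ dm) // form_of_homog.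
Qed.

End Monomials.

Section Determinants.
Variable K : fieldType.
Let dn3 : 10%N = 'C(3 + 2, 3) := erefl.
Let dn6 : 28%N = 'C(6 + 2, 6) := erefl.
Implicit Types g : {mpoly K[3]}.

(** A right kernel vector is a coefficient vector here, hence the columns. *)
Lemma det_eq0P n (M : 'M[K]_n) :
  \det M = 0 <-> exists2 c : 'cV[K]_n, c != 0 & M *m c = 0.
Proof.
rewrite -det_tr; split=> [/eqP/det0P[v v0 e]|[c c0 e]].
  exists v^T; first by rewrite -(inj_eq trmx_inj) trmxK trmx0.
  by apply: trmx_inj; rewrite trmx_mul trmxK e trmx0.
apply/eqP/det0P; exists c^T; first by rewrite -(inj_eq trmx_inj) trmxK trmx0.
by rewrite -trmx_mul e trmx0.
Qed.

Lemma eval_form d n (c : 'I_n -> K) v :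
  evalf v (form_of d c) = \sum_(k < n) evalf v 'X_[monom d k] * c k.
Proof.
rewrite /form_of /evalf raddf_sum; apply: eq_bigr => k _.
by rewrite /= mevalZ mulrC.
Qed.

Lemma eval_form_deriv d n (c : 'I_n -> K) v j :
  evalf v (form_of d c)^`M(j) =
  \sum_(k < n) evalf v ('X_[monom d k])^`M(j) * c k.
Proof.
rewrite /form_of linear_sum /evalf raddf_sum; apply: eq_bigr => k _.
by rewrite /= mderivZ mevalZ mulrC.
Qed.

Lemma C_det_eq0 (p : 'M[K]_(10, 3)) : C_det p = 0 <->
  exists g, [/\ g != 0, g \is 3.-homog & forall i, evalf (row i p) g = 0].
Proof.
rewrite /C_det det_eq0P; split=> [[c c0 e]|[g [g0 hg e]]].
  exists (form_of 3 (fun k => c k 0)); split; first 1 last.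
  - exact: (form_of_homog dn3).
  - move=> i; rewrite eval_form; move/matrixP: e => /(_ i 0).
    rewrite !mxE => e'; rewrite -[RHS]e'.
    by apply: eq_bigr => k _; rewrite !mxE.
  apply: contraNneq c0 => e0; apply/eqP/colP => k; rewrite mxE.
  by rewrite -(form_ofK dn3 (fun k => c k 0)) e0 mcoeff0.
exists (\col_k g@_(monom 3 k)).
  apply: contraNneq g0 => /colP e0; rewrite (homog_form_of dn3 hg).
  apply/eqP; apply: big1 => k _; move: (e0 k); rewrite !mxE => ->.
  by rewrite scale0r.
apply/colP => i; rewrite [RHS]mxE -[RHS](e i) (homog_form_of dn3 hg) eval_form mxE.
by apply: eq_bigr => k _; rewrite !mxE -(homog_form_of dn3).
Qed.

Lemma R_det_eq0 (p : 'M[K]_(9, 3)) v : R_det p v = 0 <->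
  exists g, [/\ g != 0, g \is 6.-homog,
    (forall i j, evalf (row i p) g^`M(j) = 0) & evalf v g = 0].
Proof.
have ev (c : 'I_28 -> K) :
    [/\ (forall i j, evalf (row i p) (form_of 6 c)^`M(j) = 0)
       & evalf v (form_of 6 c) = 0] <->
    (col_mx (T_mx p) (evalrow 6 28 v) : 'M_(9 * 3 + 1)) *m (\col_k c k) = 0.
  have e1 i j : (T_mx p *m \col_k c k) (mxvec_index i j) 0 =
      evalf (row i p) (form_of 6 c)^`M(j).
    rewrite eval_form_deriv mxE; apply: eq_bigr => k _.
    by rewrite [T_mx _ _ _]mxE mxvecE !mxE.
  have e2 : (evalrow 6 28 v *m \col_k c k) 0 0 = evalf v (form_of 6 c).
    by rewrite eval_form mxE; apply: eq_bigr => k _; rewrite !mxE.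
  rewrite mul_col_mx -(@col_mx0 _ (9 * 3) 1); split=> [[h1 h2]|e].
    congr col_mx; apply/colP => r; rewrite [RHS]mxE.
      by case/mxvec_indexP: r => i j; rewrite e1 h1.
    by rewrite (ord1 r) e2.
  have [h1 h2] := eq_col_mx e; split=> [i j|].
    by rewrite -e1 h1 mxE.
  by rewrite -e2 h2 mxE.
rewrite /R_det det_eq0P; split=> [[c c0 e]|[g [g0 hg e1 e2]]].
  have ec : c = \col_k c k 0 by apply/colP => k; rewrite mxE.
  move: e; rewrite {1}ec => /ev[e1 e2].
  exists (form_of 6 (fun k => c k 0)); split=> //; last exact: (form_of_homog dn6).
  apply: contraNneq c0 => e0; apply/eqP/colP => k; rewrite mxE.
  by rewrite -(form_ofK dn6 (fun k => c k 0)) e0 mcoeff0.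
exists (\col_k g@_(monom 6 k)).
  apply: contraNneq g0 => /colP e0; rewrite (homog_form_of dn6 hg).
  apply/eqP; apply: big1 => k _; move: (e0 k); rewrite !mxE => ->.
  by rewrite scale0r.
by apply/ev; rewrite -(homog_form_of dn6).
Qed.

End Determinants.

(** * A section vanishing at nine points forces N = 0 *)

Definition crd (A : nmodType) (v : 'rV[A]_3) : nat -> A := fun i => v 0 (inord i).

Section Frames.
Variable A : comNzRingType.
Implicit Types (p u w : 'I_9 -> nat -> A).

Definition frame_entry u w (x : nat -> A) (a : 'I_3) (i : 'I_9) (j : 'I_27) : A :=
  mon_val j x (cross x (if a == 2%N :> nat then w i else u i))
          (cross x (if a == 0%N :> nat then u i else w i)).

(** The rows 3 i, 3 i + 1, 3 i + 2 hold the values of the monomials on (x, x), (x,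
    y), (y, y) for the frame x = p_i x u_i, y = p_i x w_i at p_i. *)
Definition frame_mx p u w : 'M[A]_(9 * 3, 27) :=
  \matrix_(r < 9 * 3, j < 27)
    mxvec (\matrix_(i < 9, a < 3) frame_entry u w (p i) a i j) 0 r.

Lemma frame_mxE p u w i a j :
  frame_mx p u w (mxvec_index i a) j = frame_entry u w (p i) a i j.
Proof. by rewrite mxE mxvecE mxE. Qed.

Lemma frame_mx_mulE p u w (s : 'cV[A]_27) i (a : 'I_3) :
  (frame_mx p u w *m s) (mxvec_index i a) 0 =
    sec_val (s^~ 0) (p i) (cross (p i) (if a == 2%N :> nat then w i else u i))
          (cross (p i) (if a == 0%N :> nat then u i else w i)).
Proof. by rewrite mxE; apply: eq_bigr => j _; rewrite frame_mxE mulrC. Qed.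

Lemma frame_mx_kerP p u w (s : 'cV[A]_27) : frame_mx p u w *m s = 0 <->
  forall i, let x := cross (p i) (u i) in let y := cross (p i) (w i) in
   [/\ sec_val (s^~ 0) (p i) x x = 0, sec_val (s^~ 0) (p i) x y = 0
     & sec_val (s^~ 0) (p i) y y = 0].
Proof.
split=> [/colP h i|h].
  split.
  - by move: (h (mxvec_index i (inord 0))); rewrite frame_mx_mulE mxE inordK.
  - by move: (h (mxvec_index i (inord 1))); rewrite frame_mx_mulE mxE inordK.
  - by move: (h (mxvec_index i (inord 2))); rewrite frame_mx_mulE mxE inordK.
apply/colP => r; rewrite [RHS]mxE; case/mxvec_indexP: r => i a; rewrite frame_mx_mulE.
by have [h0 h1 h2] := h i; case: a => [[|[|[|//]]] ?].
Qed.

End Frames.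

Section Singular.
Variable K : fieldType.
Implicit Types (s : 'I_27 -> K) (p u w : nat -> K) (v : 'rV[K]_3).

Definition disc_form s : {mpoly K[3]} :=
  disc_val (fun j => (s j)%:MP) (fun i => 'X_(inord i)).

Lemma evalf_disc_form s v : evalf v (disc_form s) = disc_val s (crd v).
Proof.
rewrite /evalf /disc_form rmorph_disc_val; apply: eq_disc_val => i /=.
  by rewrite mevalC.
by rewrite mevalXU.
Qed.

Lemma disc_form_homog s : disc_form s \is 6.-homog.
Proof.
pose X i : {mpoly K[3]} := 'X_(inord i).
have hX i : X i \is 1.-homog by rewrite /X dhomogX /= mdeg1.
have hc (c : K) d (g : {mpoly K[3]}) : g \is d.-homog -> c%:MP * g \is d.-homog.
  by move=> hg; rewrite mul_mpolyC rpredZ.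
pose P a b : {mpoly K[3]} := sec_val (fun j => (s j)%:MP) X (std _ a) (std _ b).
have hP a b : P a b \is 2.-homog.
  apply: rpred_sum => j _; apply: (hc); rewrite /mon_val.
  case: (sec_mon j) => [[k l] [m n]]; rewrite mulrC /std.
  rewrite -!natrM -natrD -mpolyC_nat; apply: (hc).
  exact: (dhomogM (hX _) (hX _)).
have hQ a b c d : P a b * P c d \is 4.-homog by exact: (dhomogM (hP _ _)).
have hXX a b a1 b1 c1 d1 a2 b2 c2 d2 :
    X a * X b * (P a1 b1 * P c1 d1 - P a2 b2 * P c2 d2) \is 6.-homog.
  by apply: (dhomogM (dhomogM (hX a) (hX b))); apply: rpredB; apply: hQ.
rewrite /disc_form /disc_val !expr2.
apply: rpredD; last by apply: rpredMn; apply: hXX.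
apply: rpredD; last by apply: rpredMn; apply: hXX.
apply: rpredD; last by apply: rpredMn; apply: hXX.
apply: rpredD; last by apply: hXX.
by apply: rpredD; apply: hXX.
Qed.

(** A determinant a c - b^2 vanishes to second order where a, b and c all vanish. *)
Lemma double_zero n (e : 'I_n -> K) (V H a b c : {mpoly K[n]}) :
  V ^+ 2 * H = a * c - b ^+ 2 -> V.@[e] != 0 ->
  a.@[e] = 0 -> b.@[e] = 0 -> c.@[e] = 0 -> forall i, (H^`M(i)).@[e] = 0.
Proof.
move=> id V0 a0 b0 c0 i.
have /eqP := congr1 (meval e) id.
rewrite !expr2 mevalB !mevalM a0 b0 !mul0r subr0 !mulf_eq0.
rewrite (negbTE V0) => /eqP H0.
have /eqP := congr1 (fun g => (g^`M(i)).@[e]) id.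
rewrite mderivB !expr2 !mderivM mevalB !mevalD !mevalM mevalD !mevalM H0 a0 b0 c0.
by rewrite !(mulr0, mul0r, addr0, subr0, oppr0, add0r) !mulf_eq0 (negbTE V0) => /eqP.
Qed.

(** In a frame at v the three entries of the form vanish, so its determinant
    vanishes twice, and the frame only contributes a nonzero factor. *)
Lemma disc_singular s v u w (x := cross (crd v) u) (y := cross (crd v) w) :
  vol (crd v) u w != 0 ->
  sec_val s (crd v) x x = 0 -> sec_val s (crd v) x y = 0 -> sec_val s (crd v) y y = 0 ->
  forall i, evalf v (disc_form s)^`M(i) = 0.
Proof.
move=> c0 exx exy eyy; rewrite /evalf.
pose X k : {mpoly K[3]} := 'X_(inord k).
pose cst (q : nat -> K) k : {mpoly K[3]} := (q k)%:MP.
have evX : meval (v 0) \o X =1 crd v by move=> k /=; rewrite mevalXU.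
have evc q : meval (v 0) \o cst q =1 q by move=> k /=; rewrite mevalC.
have evx q : meval (v 0) \o cross X (cst q) =1 cross (crd v) q.
  by move=> k; rewrite /= rmorph_cross; apply: eq_cross.
have evS q r : (sec_val (fun j => (s j)%:MP) X (cross X (cst q)) (cross X (cst r))).@[v 0] =
    sec_val s (crd v) (cross (crd v) q) (cross (crd v) r).
  rewrite rmorph_sec_val; apply: eq_sec_val => //.
  by move=> j /=; rewrite mevalC.
apply: (double_zero (disc_frame (fun j => (s j)%:MP) X (cst u) (cst w)));
  rewrite ?evS //.
rewrite rmorph_vol /vol evX.
by rewrite !(eq_cross (evc u) (evc w)) !evX.
Qed.

End Singular.

Section KeyLemma.
Variable K : fieldType.
Variables (N : {mpoly K[9 * 3]}) (hN : defines_N N).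
Implicit Types (p : 'M[K]_(9, 3)) (v : 'rV[K]_3).

Definition pts (A : nmodType) (p : 'M[A]_(9, 3)) i := crd (row i p).

(** Expansion of the determinant along its last row. *)
Lemma C_det_form p : exists2 G : {mpoly K[3]}, G \is 3.-homog &
  forall v, evalf v G = C_det (col_mx p v : 'M_(9 + 1, 3)).
Proof.
pose M v := \matrix_(i < 10) evalrow 3 10 (row i (col_mx p v : 'M_(9 + 1, 3))).
pose c v (k : 'I_10) := cofactor (M v) (rshift 9 (0 : 'I_1)) k.
have cE v k : c v k = c 0 k.
  (* The cofactors along the last row do not involve the last point. *)
  rewrite /c /cofactor; congr (_ * \det _); apply/matrixP => i j.
  rewrite !mxE; congr evalf; apply/rowP => l; rewrite !mxE.
  case: split_ordP => [//|a ha].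
  move: (neq_lift (rshift 9 (0 : 'I_1)) i).
  by move/eqP: ha; rewrite -!val_eqE /= (ord1 a) eq_sym => ->.
exists (form_of 3 (c 0)); first exact: (@form_of_homog 3 10).
move=> v; rewrite eval_form /C_det (expand_det_row _ (rshift 9 (0 : 'I_1))).
apply: eq_bigr => k _; rewrite -(cE v) /M mxE; congr (_ * _).
rewrite mxE; congr evalf; apply/rowP => l.
by rewrite !mxE (unsplitK (inr (0 : 'I_1))).
Qed.

(** The sextic H = disc s and the square of the cubic G are both singular at the
    nine points; the combination of them that vanishes at v is nonzero when it does
    not vanish at v'. It is a kernel vector for R(p; v), and C(p, v) is not zero, so
    N(p) = 0. *)
Lemma N_vanish p u w (s : 'cV[K]_27) v v' :
  (forall i, vol (pts p i) (u i) (w i) != 0) ->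
  frame_mx (pts p) u w *m s = 0 ->
  C_det (col_mx p v : 'M_(9 + 1, 3)) != 0 ->
  disc_val (s^~ 0) (crd v') * C_det (col_mx p v : 'M_(9 + 1, 3)) ^+ 2 !=
  disc_val (s^~ 0) (crd v) * C_det (col_mx p v' : 'M_(9 + 1, 3)) ^+ 2 ->
  eval9 N p = 0.
Proof.
move=> fr /frame_mx_kerP Xs Cv ne.
have [G hG evG] := C_det_form p.
have G0 i : evalf (row i p) G = 0.
  rewrite evG /C_det.
  apply: (@determinant_alternate _ _ _ (lshift 1 i) (rshift 9 (0 : 'I_1))).
    by rewrite -val_eqE /= neq_ltn ltn_ord.
  move=> k; rewrite !mxE; congr evalf; apply/rowP => l; rewrite !mxE.
  by rewrite (unsplitK (inl i)) (unsplitK (inr _)) !mxE.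
pose H := disc_form (s^~ 0).
(* The factor of H makes g vanish at v as well. *)
pose g := (evalf v G ^+ 2) *: H - evalf v H *: G ^+ 2.
have evg z : evalf z g = evalf v G ^+ 2 * evalf z H - evalf v H * evalf z G ^+ 2.
  by rewrite /evalf mevalB !mevalZ rmorphXn.
suff: R_det p v = 0.
  by rewrite hN => /eqP; rewrite mulf_eq0 expf_eq0 (negbTE Cv) /= => /eqP.
apply/R_det_eq0; exists g; split.
- apply: contraNneq ne => g0; move: (evg v'); rewrite g0 /evalf meval0.
  move/esym/eqP; rewrite subr_eq0 -!/(evalf _ _) !evG !evalf_disc_form => /eqP e.
  by rewrite mulrC e.
- rewrite rpredB // rpredZ //; first exact: disc_form_homog.
  by rewrite expr2 (dhomogM hG hG).
- move=> i j; have [h0 h1 h2] := Xs i.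
  have dG : evalf (row i p) (G * G)^`M(j) = 0.
    by rewrite mderivM /evalf mevalD !mevalM -/(evalf (row i p) G) G0 mulr0 mul0r addr0.
  rewrite /g expr2 mderivB !mderivZ /evalf mevalB !mevalZ -!/(evalf _ _).
  by rewrite [X in _ * X - _](disc_singular (fr i) h0 h1 h2) dG !mulr0 subr0.
- by rewrite evg; ring.
Qed.

End KeyLemma.

(** * The contraction matrix in monomial bases, and its determinant as a square *)

Lemma sum_mxvec (V : nmodType) m n (F : 'I_(m * n) -> V) :
  \sum_r F r = \sum_i \sum_a F (mxvec_index i a).
Proof.
by rewrite (reindex _ (curry_mxvec_bij _ _)) pair_bigA; apply: eq_bigr => -[i a].
Qed.

Section Canonical.
Variable A : comNzRingType.

Definition canonical_mx (p : 'I_9 -> nat -> A) : 'M[A]_27 :=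
  \matrix_(k, l) \sum_(i < 9) mon_pairing l k (p i).

Lemma mon_val_cross_std k (v u w : nat -> A) :
  mon_val k v (cross v u) (cross v w) =
  \sum_(a < 3) \sum_(b < 3)
     u a * w b * mon_val k v (cross v (std A a)) (cross v (std A b)).
Proof.
rewrite !big_ord_recr !big_ord0 /= !add0r; move: (sec_monP k); rewrite /mon_val.
case: (sec_mon k) => [[a b] [m n]] /and4P[_ _ m3 n3]; rewrite /std.
by case: m m3 => [|[|[|//]]] _; case: n n3 => [|[|[|//]]] _ /=; ring.
Qed.

End Canonical.

Section Bases.
Variable K : numFieldType.
Implicit Types (u v w : 'rV[K]_3) (g : Sym K 2).

Let nz2 : 2%:R != 0 :> K. Proof. by rewrite pnatr_eq0. Qed.

(** A coefficient of g as a symmetric tensor: the linear functional on Sym^2 V that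
    extends v^2 |-> v_a v_b. *)
Definition hess (a b : 'I_3) (g : Sym K 2) : K := 2%:R^-1 * (g^`M(a)^`M(b))@_0.

Lemma hess_is_linear a b : scalar (hess a b).
Proof.
move=> c g h; rewrite /hess linearD linearZ /= !mderivD !mderivZ mcoeffD mcoeffZ.
by rewrite mulrDr mulrCA.
Qed.
HB.instance Definition _ a b :=
  GRing.isLinear.Build K (Sym K 2) K _ (hess a b) (hess_is_linear a b).

Lemma mderiv_lin v a : (lin v)^`M(a) = (v 0 a)%:MP.
Proof. by rewrite -[lin v]expr1 mderiv_linX mul1r expr0 -mul_mpolyC mulr1. Qed.

Lemma hess_sprod u w a b :
  hess a b (sprod u w) *+ 2 = u 0 a * w 0 b + u 0 b * w 0 a.
Proof.
rewrite /hess /= mderivM !mderiv_lin mderivD !mderivM !mderivC !mderiv_lin.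
rewrite mul0r add0r mulr0 addr0 -!mpolyCM -mpolyCD mcoeffC eqxx mulr1.
by field.
Qed.

Definition mon_section_fun (l : 'I_27) (g : Sym K 2) : Sym K 2 :=
  let: ((a, b), (m, n)) := sec_mon l in
  hess (inord a) (inord b) g *: sprod (unitv K (inord m)) (unitv K (inord n)).

Lemma mon_section_is_linear l : linear (mon_section_fun l).
Proof.
move=> c g h; rewrite /mon_section_fun; case: (sec_mon l) => [[a b] [m n]].
by rewrite linearP scalerDl scalerA.
Qed.
HB.instance Definition _ l := GRing.isLinear.Build K (Sym K 2) (Sym K 2) _
  (mon_section_fun l) (mon_section_is_linear l).

(** A lift to End(Sym^2 V) of the section of Sym^2 T given by a monomial. *)
Definition mon_section l : 'Hom(Sym K 2, Sym K 2) := linfun (mon_section_fun l).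

Lemma mon_section_sprod l v : mon_section l (sprod v v) =
  let: ((a, b), (m, n)) := sec_mon l in
  (crd v a * crd v b) *: sprod (unitv K (inord m)) (unitv K (inord n)).
Proof.
rewrite lfunE /= /mon_section_fun; case: (sec_mon l) => [[a b] [m n]]; congr (_ *: _).
apply: (mulIf nz2).
by rewrite mulr_natr hess_sprod /crd; ring.
Qed.

Definition genX (i : nat) : {mpoly K[3]} := 'X_(inord i).

Lemma mon_val_homog k a b : 
  mon_val k genX (cross genX (std _ a)) (cross genX (std _ b)) \is [in K[3], 4.-homog].
Proof.
have hX i : genX i \is 1.-homog by rewrite /genX dhomogX /= mdeg1.
have hM (g h : {mpoly K[3]}) : g \is 2.-homog -> h \is 2.-homog -> g * h \is 4.-homog.
  by move=> hg hh; exact: (dhomogM hg hh).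
have hc (i j : nat) (g : {mpoly K[3]}) : g \is 1.-homog -> g * (i == j)%:R \is 1.-homog.
  by move=> hg; rewrite -mpolyC_nat mulrC mul_mpolyC rpredZ.
have hx c i : cross genX (std _ c) i \is 1.-homog.
  by case: i => [|[|i]]; rewrite /cross /std; apply: rpredB; apply: (hc).
rewrite /mon_val; case: (sec_mon k) => [[? ?] [? ?]]; apply: (hM); first exact: dhomogM (hX _)
  (hX _).
by apply: rpredD; exact: dhomogM (hx _ _) (hx _ _).
Qed.

Definition mon_dual_fun (k : 'I_27) (g : Sym K 2) : Form K 4 :=
  \sum_(a < 3) \sum_(b < 3) hess a b g *: DHomog (mon_val_homog k a b).

Lemma mon_dual_is_linear k : linear (mon_dual_fun k).
Proof.
move=> c g h; rewrite /mon_dual_fun scaler_sumr -big_split; apply: eq_bigr => a _ /=.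
rewrite scaler_sumr -big_split; apply: eq_bigr => b _ /=.
by rewrite linearP scalerDl scalerA.
Qed.
HB.instance Definition _ k := GRing.isLinear.Build K (Sym K 2) (Form K 4) _
  (mon_dual_fun k) (mon_dual_is_linear k).

(** The section of Sym^2 T^vee (6) obtained from a monomial section of Sym^2 T
    through the isomorphism T = T^vee (3), that is u |-> v x u. *)
Definition mon_dual k : 'Hom(Sym K 2, Form K 4) := linfun (mon_dual_fun k).

Lemma evalf_form_sum n d (F : 'I_n -> Form K d) v :
  evalf v (\sum_i F i : Form K d) = \sum_i evalf v (F i).
Proof. by rewrite (linear_sum (@mpoly_of_dhomog 3 K d)) /evalf raddf_sum. Qed.

Lemma evalf_formZ d c (F : Form K d) v : evalf v (c *: F : Form K d) = c * evalf v F.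
Proof. by rewrite /evalf /= -mevalZ. Qed.

Lemma mon_dual_sprod k u w v : evalf v (mon_dual k (sprod u w)) =
  mon_val k (crd v) (cross (crd v) (crd u)) (cross (crd v) (crd w)).
Proof.
have evB a b : (mon_val k genX (cross genX (std _ a)) (cross genX (std _ b))).@[v 0] =
    mon_val k (crd v) (cross (crd v) (std _ a)) (cross (crd v) (std _ b)).
  have evX : meval (v 0) \o genX =1 crd v by move=> i; rewrite /= mevalXU.
  have evx c : meval (v 0) \o cross genX (std _ c) =1 cross (crd v) (std _ c).
    move=> i; rewrite /= rmorph_cross; apply: eq_cross => // j.
    by rewrite /std /= rmorph_nat.
  by rewrite rmorph_mon_val; apply: eq_mon_val.
rewrite lfunE /= /mon_dual_fun evalf_form_sum.
under eq_bigr => a _ do rewrite evalf_form_sum.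
have e a b : evalf v (hess a b (sprod u w) *: DHomog (mon_val_homog k a b) : Form K 4) *+ 2
    = (u 0 a * w 0 b + u 0 b * w 0 a) *
      mon_val k (crd v) (cross (crd v) (std _ a)) (cross (crd v) (std _ b)).
  by rewrite evalf_formZ [evalf _ _]evB -hess_sprod mulrnAl.
apply: (mulIf nz2); rewrite !mulr_natr -sumrMnl.
under eq_bigr => a _ do rewrite -sumrMnl.
under eq_bigr => a _ do under eq_bigr => b _ do rewrite e mulrDl.
under eq_bigr => a _ do rewrite big_split /=.
rewrite big_split /= mulr2n; congr (_ + _).
  rewrite mon_val_cross_std; apply: eq_bigr => a _; apply: eq_bigr => b _.
  by rewrite /crd !inord_val.
rewrite exchange_big mon_val_cross_std; apply: eq_bigr => a _; apply: eq_bigr => b _.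
by rewrite /crd !inord_val mon_valC.
Qed.

Lemma mon_dual_is_dual k : dual_section (mon_dual k).
Proof.
move=> v u; rewrite mon_dual_sprod /mon_val; case: (sec_mon k) => [[a b] [m n]].
have x0 i : cross (crd v) (crd v) i = 0 by case: i => [|[|i]]; rewrite /cross; ring.
by rewrite !x0; ring.
Qed.

Lemma mon_dual_mon_section k l v : evalf v (mon_dual k (mon_section l (sprod v v))) =
  mon_pairing l k (crd v).
Proof.
rewrite mon_section_sprod /mon_pairing; move: (sec_monP l); case: (sec_mon l) => [[a b] [m n]]
  /and4P[_ _ m3 n3].
rewrite linearZ evalf_formZ mon_dual_sprod.
have eu c i : (c < 3)%N -> (i < 3)%N -> crd (unitv K (inord c)) i = std K c i.
  move=> c3 i3; rewrite /crd /unitv mxE eqxx /std -val_eqE /= !inordK //.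
have ex c : (c < 3)%N -> cross (crd v) (crd (unitv K (inord c))) =1 cross (crd v) (std K c).
  by move=> c3 [|[|i]]; rewrite /cross !eu.
by rewrite (eq_mon_val _ (frefl _) (ex _ m3) (ex _ n3)).
Qed.

Definition contraction_at (p : 'M[K]_(9, 3)) (f : 'Hom(Sym K 2, Sym K 2))
  (q : 'Hom(Sym K 2, Form K 4)) : K :=
  \sum_(i < 9) evalf (row i p) (q (f (sprod (row i p) (row i p)))).

Lemma contraction_sum_pow6 p f q : contraction_map (sum_pow6 p) f q = contraction_at p f q.
Proof.
have nz : (6`!)%:R != 0 :> K by rewrite pnatr_eq0.
rewrite /contraction_map /contraction_at; under [RHS]eq_bigr => i _ do rewrite -pairingE
  -(pow6_act _ _ nz).
rewrite /sextic_act -mulr_sumr; congr (_ * _); rewrite exchange_big /=.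
apply: eq_bigr => m _; rewrite -mulr_sumr; congr (_ * _).
by rewrite (linear_sum (@mpoly_of_dhomog 3 K 6)) !raddf_sum.
Qed.

(** The given bases and the monomials are related by linear changes of coordinates,
    which multiply the determinant by a constant. That the constant is nonzero will
    follow from one set of points with nonzero canonical determinant, without
    showing that the monomials are bases. *)
Lemma det_canonical (s : 'I_27 -> 'Hom(Sym K 2, Sym K 2)) (hs : is_basis_H0E s)
  (t : 'I_27 -> 'Hom(Sym K 2, Form K 4)) (ht : is_basis_H0Edual6 t) :
  exists c : K, forall p, \det (canonical_mx (pts p)) = c * \det (A_mx s t (sum_pow6 p)).
Proof.
have Es l : exists c : 'rV_27, zero_section (mon_section l - \sum_(i < 27) c 0 i *: s i).
  by have [c [hc _]] := hs.2 (mon_section l) I; exists c.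
have Et k : exists d : 'rV_27, mon_dual k - \sum_(i < 27) d 0 i *: t i = 0.
  by have [d [hd _]] := ht.2 (mon_dual k) (mon_dual_is_dual k); exists d.
have [c hc] := fin_all_exists Es; have [d hd] := fin_all_exists Et.
pose Cm := \matrix_(l, i) c l 0 i; pose Dm := \matrix_(k, j) d k 0 j.
exists (\det Dm * \det Cm) => p.
have -> : canonical_mx (pts p) = Dm *m A_mx s t (sum_pow6 p) *m Cm^T; last first.
  by rewrite !det_mulmx det_tr; ring.
apply/matrixP => k l; rewrite !mxE.
(* Both factors are replaced by their expansions: the error made on the section is a
   zero section, which pairs to zero with a dual section. *)
transitivity (contraction_at p (mon_section l) (mon_dual k)).
  by apply: eq_bigr => i _; rewrite -mon_dual_mon_section.
transitivity (contraction_at p (\sum_(i < 27) c l 0 i *: s i) (\sum_(j < 27) d k 0 j *: t j)).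
  apply: eq_bigr => i _; move/eqP: (hd k); rewrite subr_eq0 => /eqP e; rewrite -e.
  have := pairing_zero (row i p) (hc l) (mon_dual_is_dual k).
  rewrite pairingE add_lfunE opp_lfunE linearB /=.
  by rewrite /evalf /= mevalB => /eqP; rewrite subr_eq0 => /eqP.
transitivity (\sum_(j < 27) \sum_(i < 27) d k 0 i * contraction_at p (s j) (t i) * c l 0 j);
    last first.
  apply: eq_bigr => j _; rewrite !mxE mulr_suml; apply: eq_bigr => i _.
  by rewrite !mxE contraction_sum_pow6.
transitivity (\sum_(i < 9) \sum_(j < 27) \sum_(a < 27)
   d k 0 a * c l 0 j * evalf (row i p) (t a (s j (sprod (row i p) (row i p))))).
  apply: eq_bigr => i _; rewrite [RHS]exchange_big !sum_lfunE evalf_form_sum.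
  apply: eq_bigr => a _; rewrite scale_lfunE evalf_formZ linear_sum evalf_form_sum.
  rewrite mulr_sumr; apply: eq_bigr => j _.
  by rewrite scale_lfunE linearZ evalf_formZ; ring.
rewrite exchange_big; apply: eq_bigr => j _; rewrite exchange_big.
apply: eq_bigr => a _; rewrite /contraction_at mulr_sumr mulr_suml; apply: eq_bigr => i _.
by ring.
Qed.

End Bases.

Section Square.
Variable K : numFieldType.
Implicit Types (p u w : 'I_9 -> nat -> K).

(** The Gram matrix, point by point, of the pairing of binary quadratic forms (a, b,
    c) . (a', b', c') = a c' - 2 b b' + c a' in the coordinates used by [frame_mx]. *)
Definition gram_form (cc : 'I_9 -> K) (M : 'M[K]_(9, 3)) : 'M[K]_(9, 3) :=
  \matrix_(i, a) (cc i * (if a == 1%N :> nat then - M i a *+ 2 else M i (rev_ord a))).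

Lemma gram_form_is_linear cc : linear (gram_form cc).
Proof.
move=> c M L; apply/matrixP => i a; rewrite !mxE; case: ifP => _; ring.
Qed.
HB.instance Definition _ cc := GRing.isLinear.Build K 'M[K]_(9, 3) 'M[K]_(9, 3) _
  (gram_form cc) (gram_form_is_linear cc).

Lemma lin_mx_cancel m n (f g : {linear 'M[K]_(m, n) -> 'M[K]_(m, n)}) :
  cancel f g -> lin_mx f *m lin_mx g = 1%:M.
Proof.
move=> fg; apply/row_matrixP => r; rewrite row_mul rowE row1.
by rewrite -[delta_mx 0 r]vec_mxK !mul_vec_lin /= fg.
Qed.

Lemma lin_mx_tr_col m n q (f : {linear 'M[K]_(m, n) -> 'M[K]_(m, n)})
    (M : 'I_q -> 'M[K]_(m, n)) r j :
  ((lin_mx f)^T *m (\matrix_(r, j) mxvec (M j) 0 r)) r j = mxvec (f (M j)) 0 r.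
Proof.
rewrite -mul_vec_lin !mxE; apply: eq_bigr => k _.
by rewrite !mxE mulrC.
Qed.

(** The canonical matrix is X^T Q X with Q the invertible block matrix of
    [gram_form], which depends on the frames only through the volumes. *)
Lemma det_canonical_square (cc : 'I_9 -> K) : (forall i, cc i != 0) ->
  exists2 k : K, k != 0 & forall p u w,
    (forall i, vol (p i) (u i) (w i) = cc i) ->
    \det (canonical_mx p) = k * \det (frame_mx p u w : 'M_27) ^+ 2.
Proof.
move=> cc0; pose c2 i := (cc i ^+ 2 *+ 2)^-1.
have c20 i : cc i ^+ 2 *+ 2 != 0 by rewrite mulrn_eq0 expf_eq0 negb_or /= cc0.
pose Q : 'M[K]_(9 * 3) := (lin_mx (gram_form c2))^T.
exists (\det Q).
  suff : Q^T \in unitmx by rewrite unitmx_tr unitmxE unitfE.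
  (* The inverse of the Gram form is, up to the volumes, the Gram form itself with
     its middle coordinate halved twice. *)
  pose dd (M : 'M[K]_(9, 3)) : 'M[K]_(9, 3) := \matrix_(i, a)
    (M i a * (if a == 1%N :> nat then 2%:R^-1 else 1)).
  have dd_lin : linear dd.
    by move=> c M L; apply/matrixP => i a; rewrite !mxE mulrDl mulrA.
  pose ddL := GRing.isLinear.Build K 'M[K]_(9, 3) 'M[K]_(9, 3) _ dd dd_lin.
  pose f : {linear _ -> _} := HB.pack dd ddL.
  pose c3 i := cc i ^+ 2 *+ 2.
  have K1 : cancel (gram_form c2) (f \o gram_form c3 \o f).
    move=> M; apply/matrixP => i a; rewrite /= !mxE.
    have [a1|a1] := eqVneq (a : nat) 1%N.
      by rewrite /c2 /c3; field; rewrite cc0.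
    have r1 : ((rev_ord a : nat) == 1%N) = false.
      by case: a a1 => [[|[|[|//]]] ?].
    rewrite r1 rev_ordK /c2 /c3 ?r1 ?(negbTE a1).
    by field; rewrite cc0.
  by have [] := mulmx1_unit (lin_mx_cancel K1); rewrite trmxK.
move=> p u w vE.
have -> : canonical_mx p = (frame_mx p u w)^T *m (Q *m frame_mx p u w).
  apply/matrixP => k l; rewrite 2!mxE sum_mxvec; apply: eq_bigr => i _.
  have QX a : (Q *m frame_mx p u w) (mxvec_index i a) l =
    gram_form c2 (\matrix_(i, a) frame_entry u w (p i) a i l) i a.
    by rewrite (lin_mx_tr_col _ (fun l => \matrix_(i, a) frame_entry u w (p i) a i l)) mxvecE.
  under eq_bigr => a _ do rewrite mxE frame_mxE QX !mxE.
  rewrite !big_ord_recr big_ord0 /= add0r /frame_entry /=.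
  have := mon_pairing_frame l k (p i) (u i) (w i); rewrite vE => e.
  apply: (mulIf (c20 i)); rewrite mulrC mulrnAl e /c2.
  by field; rewrite cc0.
rewrite (det_mulmx (frame_mx p u w : 'M_27)^T) (det_mulmx Q) det_tr; ring.
Qed.

End Square.

(** * The determinants over an arbitrary ring *)

Section Generic.
Variable A : comNzRingType.

Definition monev (x : nat -> A) (m : 'X_{1..3}) : A := \prod_(l < 3) x l ^+ m l.

(** C_gen, R_gen, D_gen, adj_col and witness repeat the construction over a
    commutative ring, to be used for points with polynomial coordinates and then
    specialized. *)
Definition C_gen (q : 'M[A]_(10, 3)) : A :=
  \det (\matrix_(i < 10, k < 10) monev (crd (row i q)) (monom 3 k)).

Definition R_gen (p : 'M[A]_(9, 3)) (v : 'rV[A]_3) : A :=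
  \det (col_mx
    (\matrix_(r < 9 * 3, k < 28) mxvec (\matrix_(i < 9, j < 3)
       ((monom 6 k j)%:R * monev (crd (row i p)) (monom 6 k - U_(j)))) 0 r)
    (\row_(k < 28) monev (crd v) (monom 6 k)) : 'M[A]_(9 * 3 + 1)).

Definition D_gen (p u w : 'M[A]_(9, 3)) : A := \det (frame_mx (pts p) (pts u) (pts w) :
  'M_27).

(** Index of the value on (y, y) at the ninth point. At each root of D in the
    example the other 26 rows are independent, which makes this column of the
    adjugate a nonzero kernel vector. *)
Definition adj_row : 'I_(9 * 3) := mxvec_index (ord_max : 'I_9) (ord_max : 'I_3).

Definition adj_col (p u w : 'M[A]_(9, 3)) : 'cV[A]_27 :=
  col adj_row (\adj (frame_mx (pts p) (pts u) (pts w) : 'M_27)).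

(** Nonzero when the two conditions of [N_vanish] hold for the section [adj_col]. *)
Definition witness (p u w : 'M[A]_(9, 3)) (v o : 'rV[A]_3) : A :=
  let G z := C_gen (col_mx p z : 'M_(9 + 1, 3)) in
  let h z := disc_val ((adj_col p u w)^~ 0) (crd z) in
  G v * (h o * G v ^+ 2 - h v * G o ^+ 2).

End Generic.

Section GenericMorph.
Variables (A B : comNzRingType) (f : {rmorphism A -> B}).

Lemma crd_map (v : 'rV[A]_3) : f \o crd v =1 crd (map_mx f v).
Proof. by move=> i; rewrite /crd /= mxE. Qed.

Lemma pts_map (p : 'M[A]_(9, 3)) i : f \o pts p i =1 pts (map_mx f p) i.
Proof. by move=> j; rewrite /pts -map_row crd_map. Qed.

Lemma monev_map x m : f (monev x m) = monev (f \o x) m.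
Proof. by rewrite /monev rmorph_prod; apply: eq_bigr => l _; rewrite rmorphXn. Qed.

Lemma eq_monev (x y : nat -> A) m : x =1 y -> monev x m = monev y m.
Proof. by move=> e; apply: eq_bigr => l _; rewrite e. Qed.

End GenericMorph.

Section GenericMorph2.
Variables (A B : comNzRingType) (f : {rmorphism A -> B}).

Lemma C_gen_map (q : 'M[A]_(10, 3)) : f (C_gen q) = C_gen (map_mx f q).
Proof.
rewrite /C_gen -det_map_mx; congr (\det _); apply/matrixP => i k.
by rewrite !mxE monev_map -map_row; apply: eq_monev; apply: crd_map.
Qed.

Lemma R_gen_map (p : 'M[A]_(9, 3)) v : f (R_gen p v) = R_gen (map_mx f p) (map_mx f v).
Proof.
rewrite /R_gen -det_map_mx map_col_mx; congr (\det (col_mx _ _)); apply/matrixP => r k.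
  case/mxvec_indexP: r => i j; rewrite !mxE !mxvecE !mxE rmorphM rmorph_nat.
  by rewrite monev_map -map_row; congr (_ * _); apply: eq_monev; apply: crd_map.
by rewrite !mxE monev_map; apply: eq_monev; apply: crd_map.
Qed.

Lemma frame_mx_map (p u w : 'M[A]_(9, 3)) :
  map_mx f (frame_mx (pts p) (pts u) (pts w)) =
  frame_mx (pts (map_mx f p)) (pts (map_mx f u)) (pts (map_mx f w)).
Proof.
apply/matrixP => r j; case/mxvec_indexP: r => i a; rewrite mxE !frame_mxE.
rewrite /frame_entry rmorph_mon_val; apply: eq_mon_val; first exact: pts_map.
  by move=> k /=; rewrite rmorph_cross; case: ifP => _; apply: eq_cross; apply: pts_map.
by move=> k /=; rewrite rmorph_cross; case: ifP => _; apply: eq_cross; apply: pts_map.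
Qed.

Lemma D_gen_map (p u w : 'M[A]_(9, 3)) :
  f (D_gen p u w) = D_gen (map_mx f p) (map_mx f u) (map_mx f w).
Proof. by rewrite /D_gen -det_map_mx frame_mx_map. Qed.

Lemma adj_col_map (p u w : 'M[A]_(9, 3)) :
  map_mx f (adj_col p u w) = adj_col (map_mx f p) (map_mx f u) (map_mx f w).
Proof. by rewrite /adj_col map_col map_mx_adj frame_mx_map. Qed.

Lemma witness_map (p u w : 'M[A]_(9, 3)) v o :
  f (witness p u w v o) =
  witness (map_mx f p) (map_mx f u) (map_mx f w) (map_mx f v) (map_mx f o).
Proof.
have eh z : f (disc_val ((adj_col p u w)^~ 0) (crd z)) =
    disc_val ((adj_col (map_mx f p) (map_mx f u) (map_mx f w))^~ 0) (crd (map_mx f z)).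
  rewrite rmorph_disc_val; apply: eq_disc_val; last exact: crd_map.
  by move=> j; rewrite -adj_col_map mxE.
rewrite /witness !expr2 !(rmorphM, rmorphB) /= !C_gen_map !eh.
by rewrite !(@map_col_mx _ _ _ 9 1).
Qed.

End GenericMorph2.

Section GenericField.
Variable K : fieldType.

Lemma evalfX (v : 'rV[K]_3) m : evalf v 'X_[m] = monev (crd v) m.
Proof.
rewrite /evalf mevalX; apply: eq_bigr => l _; by rewrite /crd inord_val.
Qed.

Lemma C_genE (q : 'M[K]_(10, 3)) : C_gen q = C_det q.
Proof.
by congr (\det _); apply/matrixP => i k; rewrite !mxE evalfX.
Qed.

Lemma R_genE (p : 'M[K]_(9, 3)) v : R_gen p v = R_det p v.
Proof.
congr (\det (col_mx _ _)); apply/matrixP => r k; last by rewrite !mxE evalfX.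
case/mxvec_indexP: r => i j; rewrite !mxE !mxvecE !mxE mderivX.
by rewrite /evalf mevalZ -/(evalf _ _) evalfX.
Qed.

End GenericField.

(** * Leading coefficients, roots and specialization of polynomials *)

Section Degree.
Variable R : comNzRingType.
Implicit Types (p q : {poly R}) (c : R).

(** Degree at most d, with c as the possibly zero coefficient of degree d. Unlike
    [size], this is additive for products without any assumption on the ring. *)
Definition has_top d c p := (size p <= d.+1)%N /\ p`_d = c.

Lemma top_size d p : (size p <= d.+1)%N -> has_top d p`_d p.
Proof. by []. Qed.

Lemma topC c : has_top 0 c c%:P.
Proof. by split; [rewrite size_polyC; case: (_ == _)|rewrite coefC]. Qed.

Lemma topD d c c' p q : has_top d c p -> has_top d c' q -> has_top d (c + c') (p + q).
Proof.
move=> [sp <-] [sq <-]; split; last by rewrite coefD.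
by rewrite (leq_trans (size_polyD _ _)) // geq_max sp.
Qed.

Lemma topM d e c c' p q : has_top d c p -> has_top e c' q -> has_top (d + e) (c * c') (p * q).
Proof.
move=> [sp <-] [sq <-]; split.
  by rewrite (leq_trans (size_polyMleq _ _)) //; lia.
rewrite coefM (bigD1 (inord d)) //= inordK ?ltnS ?leq_addr //.
rewrite addKn big1 ?addr0 // => i id.
have [ltid|ltdi|ed] := ltngtP i d.
- rewrite [q`__]nth_default ?mulr0 // (leq_trans sq) //.
  by move: (i : nat) ltid => k kd; lia.
- by rewrite [p`__]nth_default ?mul0r // (leq_trans sp).
by move/eqP: id; case; apply: val_inj; rewrite /= inordK ?ed // ltnS leq_addr.
Qed.

Lemma top_prod (I : finType) (d : I -> nat) (c : I -> R) F :
  (forall i, has_top (d i) (c i) (F i)) -> has_top (\sum_i d i) (\prod_i c i) (\prod_i F i).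
Proof.
move=> h; elim: (index_enum I) => [|i s IH]; first by rewrite !big_nil; apply: topC.
by rewrite !big_cons; apply: topM.
Qed.

Lemma topX n d c p : has_top d c p -> has_top (d * n) (c ^+ n) (p ^+ n).
Proof.
move=> h; elim: n => [|n IH]; first by rewrite muln0 !expr0; apply: topC.
by rewrite mulnS !exprS; apply: topM.
Qed.

Lemma top_sum (I : finType) d (c : I -> R) F :
  (forall i, has_top d (c i) (F i)) -> has_top d (\sum_i c i) (\sum_i F i).
Proof.
move=> h; elim/big_rec2: _ => [|i x y _ hxy]; last exact: topD.
by split; rewrite ?size_poly0 ?coef0.
Qed.

(** Every term of the Leibniz formula takes one entry from each row, so the row
    degrees add up. *)
Lemma top_det n (d : 'I_n -> nat) (L : 'M[R]_n) (M : 'M[{poly R}]_n) :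
  (forall i j, has_top (d i) (L i j) (M i j)) -> has_top (\sum_i d i) (\det L) (\det M).
Proof.
move=> h; rewrite /determinant; apply: top_sum => s.
rewrite -[X in has_top X]add0n; apply: topM; last by apply: top_prod.
by rewrite -(rmorph_sign (polyC : {rmorphism R -> {poly R}})); exact: topC.
Qed.

Lemma top_line a b : has_top 1 b (a%:P + 'X * b%:P : {poly R}).
Proof.
split; last by rewrite coefD coefXM coefC /= add0r coefC.
rewrite (leq_trans (size_polyD _ _)) // geq_max.
by rewrite !size_polyC (leq_trans (size_polyMleq _ _)) ?size_polyX ?size_polyC;
  do ?case: (_ == _).
Qed.

End Degree.

Section Polynomials.
Variable K : numClosedFieldType.
Implicit Types (p q D H : {poly K}).

Lemma poly_ext p q : (forall x, p.[x] = q.[x]) -> p = q.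
Proof.
move=> e; apply/eqP; rewrite -subr_eq0; apply/eqP.
have r0 x : root (p - q) x by rewrite rootE hornerD hornerN e subrr.
apply: (@roots_geq_poly_eq0 _ _ [seq i%:R | i <- iota 0 (size (p - q)).+1]).
- by apply/allP => x _; apply: r0.
- rewrite map_inj_uniq ?iota_uniq //; exact: mulrIn (oner_neq0 _).
- by rewrite size_map size_iota.
Qed.

(** The density argument: an identity that holds where some nonzero polynomial does
    not vanish holds everywhere. *)
Lemma poly_cancel p q : p != 0 -> (forall x, p.[x] != 0 -> q.[x] = 0) -> q = 0.
Proof.
move=> p0 h; suff /eqP : p * q = 0 by rewrite mulf_eq0 (negbTE p0) => /eqP.
apply: poly_ext => x; rewrite hornerM horner0.
by have [->|/h ->] := eqVneq p.[x] 0; rewrite ?mul0r ?mulr0.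
Qed.

Lemma dvd_of_roots D q : D != 0 -> separable_poly D ->
  (forall x, root D x -> root q x) -> D %| q.
Proof.
move=> D0 sepD h; have [rs Drs] := closed_field_poly_normal D.
have lD : lead_coef D != 0 by rewrite lead_coef_eq0.
have u : uniq rs.
  rewrite -separable_prod_XsubC -(eqp_separable (eqp_scale _ lD)) -Drs //.
rewrite Drs dvdpZl //; apply: uniq_roots_dvdp; last by rewrite uniq_rootsE.
apply/allP => x xr; apply: h; rewrite Drs rootZ // root_prod_XsubC //.
Qed.

(** Coprimality at the parameter value 0 persists for all but finitely many values,
    since it is the nonvanishing of a resultant. *)
Lemma coprime_specialization (D H : {poly {poly K}}) n :
  let at_ e := map_poly (horner_eval e) in
  (size D <= n.+2)%N -> size (at_ 0 D) = n.+2 -> coprimep (at_ 0 D) (at_ 0 H) ->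
  exists2 b : {poly K}, b.[0] != 0 & forall e, b.[e] != 0 ->
    size (at_ e D) = n.+2 /\ coprimep (at_ e D) (at_ e H).
Proof.
move=> at_ sD s0 cop.
have lc0 : (D`_n.+1).[0] != 0.
  have := s0; have e : (at_ 0 D)`_n.+1 = (D`_n.+1).[0] by rewrite coef_map.
  rewrite -e => s1; have : lead_coef (at_ 0 D) != 0.
    by rewrite lead_coef_eq0 -size_poly_eq0 s1.
  by rewrite lead_coefE s1.
have sD' : size D = n.+2.
  apply/eqP; rewrite eqn_leq sD /= ltnNge; apply/negP => le.
  by move: lc0; rewrite nth_default // horner0 eqxx.
have lcD : lead_coef D = D`_n.+1 by rewrite lead_coefE sD'.
(* Resultants specialize well when both degrees are constant.  Adding a multiple of D
   of large degree to H forces this without changing coprimality with D. *)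
pose H' := H + D * 'X^(size H).
have D0 : D != 0 by rewrite -size_poly_eq0 sD'.
have lH' : lead_coef H' = lead_coef D.
  rewrite /H' addrC lead_coefDl ?lead_coefM ?lead_coefXn ?mulr1 //.
  by rewrite size_Mmonic ?monicXn // size_polyXn sD'; lia.
have atH' e : at_ e H' = at_ e H + at_ e D * 'X^(size H).
  by rewrite /at_ rmorphD rmorphM /= map_polyXn.
have copE e : coprimep (at_ e D) (at_ e H') = coprimep (at_ e D) (at_ e H).
  by rewrite atH' addrC mulrC coprimep_addl_mul.
have res e : (D`_n.+1).[e] != 0 ->
    (resultant D H').[e] = resultant (at_ e D) (at_ e H').
  move=> l0; rewrite -[LHS]/(horner_eval e _) map_resultant ?lH' ?lcD //.
exists (D`_n.+1 * resultant D H').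
  rewrite hornerM mulf_neq0 // res // resultant_eq0 -leqNgt.
  by move: cop; rewrite -copE /coprimep => /eqP ->.
move=> e; rewrite hornerM mulf_eq0 negb_or => /andP[l0].
rewrite res // resultant_eq0 -leqNgt => g1.
have se : size (at_ e D) = n.+2.
  by rewrite size_map_poly_id0 // lcD.
split=> //; rewrite -copE /coprimep eqn_leq g1 lt0n size_poly_eq0 gcdp_eq0.
by rewrite negb_and -size_poly_eq0 se.
Qed.

End Polynomials.

(** * Nine points, the last of which moves along a line *)

Section MoreDegree.
Variable R : comNzRingType.

Lemma sizeM_le (p q : {poly R}) d e : (size p <= d.+1)%N -> (size q <= e.+1)%N ->
  (size (p * q)%R <= (d + e).+1)%N.
Proof. by move=> hp hq; have [] := topM (top_size hp) (top_size hq). Qed.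

Lemma sizeD_le (p q : {poly R}) d : (size p <= d)%N -> (size q <= d)%N ->
  (size (p + q)%R <= d)%N.
Proof. by move=> hp hq; rewrite (leq_trans (size_polyD _ _)) // geq_max hp. Qed.

Lemma size_det_le n (d : 'I_n -> nat) (M : 'M[{poly R}]_n) :
  (forall i j, size (M i j) <= (d i).+1)%N -> (size (\det M) <= (\sum_i d i).+1)%N.
Proof.
move=> h; have [] // := @top_det R n d (\matrix_(i, j) (M i j)`_(d i)) M.
by move=> i j; rewrite mxE; apply: top_size.
Qed.

Lemma size_cross (v u : nat -> {poly R}) d e :
  (forall k, size (v k) <= d.+1)%N -> (forall k, size (u k) <= e.+1)%N ->
  forall k, (size (cross v u k) <= (d + e).+1)%N.
Proof.
move=> hv hu k; have h m n : (size (v m * u n)%R <= (d + e).+1)%N by apply: sizeM_le.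
by case: k => [|[|k]]; rewrite /cross; apply: sizeD_le; rewrite ?size_polyN.
Qed.

Lemma size_mon_val j (v x y : nat -> {poly R}) c d e :
  (forall k, size (v k) <= c.+1)%N -> (forall k, size (x k) <= d.+1)%N ->
  (forall k, size (y k) <= e.+1)%N -> (size (mon_val j v x y) <= (c + c + (d + e)).+1)%N.
Proof.
move=> hv hx hy; rewrite /mon_val; case: (sec_mon j) => [[k l] [m n]].
by apply: sizeM_le; [apply: sizeM_le | apply: sizeD_le; apply: sizeM_le].
Qed.

Lemma top_monev m n (L : 'M[R]_(m, 3)) (M : 'M[{poly R}]_(n, 3)) i j e mm :
  (forall l, has_top e (L i l) (M j l)) ->
  has_top (e * mdeg mm) (monev (crd (row i L)) mm) (monev (crd (row j M)) mm).
Proof.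
move=> h; rewrite mdegE big_distrr /monev; apply: top_prod => l.
by apply: topX; rewrite /crd !mxE inord_val.
Qed.

Lemma size_monev n (M : 'M[{poly R}]_(n, 3)) j e mm :
  (forall l, size (M j l) <= e.+1)%N ->
  (size (monev (crd (row j M)) mm) <= (e * mdeg mm).+1)%N.
Proof.
move=> h; have [] // := @top_monev 1 n (\row_l (M j l)`_e) M 0 j e mm.
by move=> l; rewrite mxE; apply: top_size.
Qed.

End MoreDegree.

Section Line.
Variable A : comNzRingType.
Variables (P U : 'M[A]_(8, 3)) (a b : 'rV[A]_3) (W : 'M[A]_(9, 3)).

Definition at_line (t : A) : 'M[A]_(9, 3) := col_mx P (a + t *: b) : 'M_(8 + 1, 3).

(** The direction b of the line is the first frame vector at the moving point: the
    covector (a + t b) x b = a x b is then constant, which keeps the degree of D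
    down to 9. *)
Definition line_frame : 'M[A]_(9, 3) := col_mx U b : 'M_(8 + 1, 3).

Definition line : 'M[{poly A}]_(9, 3) :=
  col_mx (map_mx polyC P) (map_mx polyC a + 'X *: map_mx polyC b) : 'M_(8 + 1, 3).

Definition D_line := D_gen line (map_mx polyC line_frame) (map_mx polyC W).

Lemma line_at t : map_mx (horner_eval t) line = at_line t.
Proof.
apply: etrans (@map_col_mx _ _ _ 8 1 _ _ _) _.
congr (@col_mx _ 8 1 _ _ _); apply/matrixP => i j.
  by rewrite !mxE /horner_eval hornerC.
by rewrite !mxE /horner_eval hornerD hornerM hornerX !hornerC.
Qed.

Lemma map_polyC_at (t : A) m n (M : 'M[A]_(m, n)) :
  map_mx (horner_eval t) (map_mx polyC M) = M.
Proof. by apply/matrixP => i j; rewrite !mxE /horner_eval hornerC. Qed.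

Lemma top_line_entry (i : 'I_9) l :
  has_top (i == 8 :> nat) ((col_mx P b : 'M_(8 + 1, 3)) i l) (line i l).
Proof.
case: (@split_ordP 8 1 i) => {}i -> /=.
  by rewrite (ltn_eqF (ltn_ord i)) !(@col_mxEu _ 8 1) mxE; apply: topC.
by rewrite !(@col_mxEd _ 8 1) !mxE (ord1 i); apply: top_line.
Qed.

Lemma pts_line_const (i : 'I_8) k :
  pts line (lshift 1 i : 'I_(8 + 1)) k = (P i (inord k))%:P.
Proof. by rewrite /pts /crd mxE (@col_mxEu _ 8 1) mxE. Qed.

Lemma pts_line_move (i : 'I_1) k :
  pts line (rshift 8 i : 'I_(8 + 1)) k = (crd a k)%:P + 'X * (crd b k)%:P.
Proof. by rewrite /pts /crd mxE (@col_mxEd _ 8 1) !mxE (ord1 i). Qed.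

Lemma pts_map_polyC (M : 'M[A]_(9, 3)) i k : pts (map_mx polyC M) i k = (pts M i k)%:P.
Proof. by rewrite /pts /crd !mxE. Qed.

(** The rows of the moving point have degrees 2, 3 and 4 in t: 2 from v, plus the
    number of factors y = p x w. *)
Lemma size_D_line : (size D_line <= 10)%N.
Proof.
pose d (r : 'I_(9 * 3)) : nat :=
  mxvec (\matrix_(i < 9, c < 3) (if i == 8 :> nat then c + 2 else 0)%N) 0 r.
have -> : 10%N = (\sum_r d r).+1.
  rewrite sum_mxvec /d; under eq_bigr do under eq_bigr do rewrite mxvecE mxE.
  by rewrite !big_ord_recr !big_ord0.
apply: size_det_le => r j; case: {r}(mxvec_indexP (r : 'I_(9 * 3))) => i c.
rewrite frame_mxE /d mxvecE mxE /frame_entry.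
have sC (k : A) : (size k%:P <= 1)%N by rewrite size_polyC; case: (_ == _).
have sU l k : (size (pts (map_mx polyC line_frame) l k) <= 1)%N by rewrite pts_map_polyC.
have sW l k : (size (pts (map_mx polyC W) l k) <= 1)%N by rewrite pts_map_polyC.
case: (@split_ordP 8 1 i) => {}i -> /=.
  have hP k : (size (pts line (lshift 1 i : 'I_(8 + 1)) k) <= 1)%N.
    by rewrite pts_line_const.
  rewrite (ltn_eqF (ltn_ord i)); apply: (@size_mon_val _ j _ _ _ 0 0 0) => // k;
    by case: ifP => _; apply: (@size_cross _ _ _ 0 0).
rewrite {i}(ord1 i).
have hP k : (size (pts line (rshift 8 (0%R : 'I_1) : 'I_(8 + 1)) k) <= 2)%N.
  by rewrite pts_line_move; have [] := top_line (crd a k) (crd b k).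
have hxu k : (size (cross (pts line (rshift 8 (0%R : 'I_1) : 'I_(8 + 1)))
    (pts (map_mx polyC line_frame) (rshift 8 (0%R : 'I_1) : 'I_(8 + 1))) k) <= 1)%N.
  have -> : cross (pts line (rshift 8 (0%R : 'I_1) : 'I_(8 + 1)))
    (pts (map_mx polyC line_frame) (rshift 8 (0%R : 'I_1) : 'I_(8 + 1))) k =
    (cross (crd a) (crd b) k)%:P; last exact: sC.
    have e l : pts (map_mx polyC line_frame) (rshift 8 (0%R : 'I_1) : 'I_(8 + 1)) l =
        (crd b l)%:P.
      by rewrite pts_map_polyC /pts /crd mxE (@col_mxEd _ 8 1).
    by case: k => [|[|k]]; rewrite /cross !pts_line_move !e polyCB !polyCM; ring.
have hxw k : (size (cross (pts line (rshift 8 (0%R : 'I_1) : 'I_(8 + 1)))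
    (pts (map_mx polyC W) (rshift 8 (0%R : 'I_1) : 'I_(8 + 1))) k) <= 2)%N.
  exact: (@size_cross _ _ _ 1 0).
rewrite addn0 /=; case: c => [[|[|[|//]]] ?] /=.
- exact: (@size_mon_val _ j _ _ _ 1 0 0).
- exact: (@size_mon_val _ j _ _ _ 1 0 1).
- exact: (@size_mon_val _ j _ _ _ 1 1 1).
Qed.

End Line.

Section LineDegrees.
Variable A : comNzRingType.
Variables (P : 'M[A]_(8, 3)) (a b : 'rV[A]_3).

Definition C_line (v : 'rV[A]_3) : {poly A} :=
  C_gen (col_mx (line P a b) (map_mx polyC v) : 'M_(9 + 1, 3)).

Lemma top_C_line v :
  has_top 3 (C_gen (col_mx (col_mx P b : 'M_(8 + 1, 3)) v : 'M_(9 + 1, 3))) (C_line v).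
Proof.
have e3 : (\sum_(i < 10) (if i == 8 :> nat then 3 else 0))%N = 3%N.
  by rewrite !big_ord_recr big_ord0.
rewrite -[X in has_top X]e3; apply: top_det => i k; rewrite !mxE.
have -> : (if i == 8 :> nat then 3 else 0)%N = ((i == 8 :> nat) * mdeg (monom 3 k))%N.
  by rewrite (@monom_mem 3 10) //; case: (_ == _).
apply: top_monev => l; case: (@split_ordP 9 1 i) => {}i ->.
  by rewrite !(@col_mxEu _ 9 1); apply: top_line_entry.
by rewrite !(@col_mxEd _ 9 1) mxE (ord1 i); apply: topC.
Qed.

(** Only the moving point contributes: three rows of partial derivatives of degree
    5. *)
Lemma size_R_line v : (size (R_gen (line P a b) (map_mx polyC v)) <= 16)%N.
Proof.
pose d (r : 'I_(9 * 3 + 1)) : nat := if split r is inl r' then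
  mxvec (\matrix_(i < 9, c < 3) (if i == 8 :> nat then 5 else 0)%N) 0 r' else 0%N.
have -> : 16%N = (\sum_r d r).+1.
  rewrite big_split_ord /= big_ord1 /d (unsplitK (inr _)) addn0.
  under eq_bigr do rewrite (unsplitK (inl _)).
  rewrite sum_mxvec; under eq_bigr do under eq_bigr do rewrite mxvecE mxE.
  by rewrite !big_ord_recr !big_ord0.
apply: size_det_le => r k; rewrite /d mxE.
case: (split r) => {}r; last first.
  rewrite mxE; have -> : (crd (map_mx polyC v) : nat -> {poly A}) =
     crd (row 0 (map_mx polyC v)) by rewrite row_id.
  apply: (@size_monev _ _ _ _ 0) => l; rewrite mxE size_polyC; by case: (_ == _).
case: {r}(mxvec_indexP (r : 'I_(9 * 3))) => i j; rewrite !mxE !mxvecE !mxE.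
have [m0|m0] := posnP (monom 6 k j); first by rewrite m0 mul0r size_poly0.
have dm : mdeg (monom 6 k - U_(j))%MM = 5%N.
  have := @monom_mem 6 28 erefl k (ltn_ord k).
  rewrite -{1}(@submK _ U_(j)%MM (monom 6 k)); last first.
    by apply/mnm_lepP => l; rewrite mnm1E; case: eqP => [<-|].
  by rewrite mdegD mdeg1 addn1 => -[].
have -> : (if i == 8 :> nat then 5 else 0)%N =
    (0 + (i == 8 :> nat) * mdeg (monom 6 k - U_(j))%MM)%N.
  by rewrite dm; case: (_ == _).
apply: sizeM_le.
  by rewrite -polyC_natr size_polyC; case: (_ == _).
by apply: size_monev => l; have [] := top_line_entry P a b i l.
Qed.

End LineDegrees.

(** Adding t b to the point does not change the volume since b is in the frame. *)
Lemma vol_line (A : comNzRingType) (P U : 'M[A]_(8, 3)) a b W t i :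
  vol (pts (at_line P a b t) i) (pts (line_frame U b) i) (pts W i) =
  vol (pts (at_line P a b 0) i) (pts (line_frame U b) i) (pts W i).
Proof.
case: (@split_ordP 8 1 i) => {}i ->.
  by rewrite /vol /cross /pts /crd !mxE !(unsplitK (inl _)).
by rewrite /vol /cross /pts /crd !mxE !(unsplitK (inr _)) !mxE (ord1 i); ring.
Qed.

Section PolynomialPoints.
Variables (K : fieldType) (N : {mpoly K[9 * 3]}).

Definition N_poly (p : 'M[{poly K}]_(9, 3)) : {poly K} := mmap polyC (fun r => mxvec p 0 r) N.

Lemma horner_N_poly p t : (N_poly p).[t] = eval9 N (map_mx (horner_eval t) p).
Proof.
rewrite /N_poly /eval9 /meval /mmap horner_sum; apply: eq_bigr => m _.
rewrite hornerM hornerC; congr (_ * _); rewrite /mmap1 horner_prod.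
apply: eq_bigr => r _; rewrite horner_exp; congr (_ ^+ _).
by case: {r}(mxvec_indexP (r : 'I_(9 * 3))) => i j; rewrite !mxvecE mxE.
Qed.

End PolynomialPoints.

Section LineN.
Variable K : numClosedFieldType.
Variables (N : {mpoly K[9 * 3]}) (hN : defines_N N).
Variables (P U : 'M[K]_(8, 3)) (a b : 'rV[K]_3) (W : 'M[K]_(9, 3)).

Definition N_line : {poly K} := N_poly N (line P a b).

Lemma horner_N_line t : N_line.[t] = eval9 N (at_line P a b t).
Proof. by rewrite horner_N_poly line_at. Qed.

Lemma horner_C_line v t :
  (C_line P a b v).[t] = C_det (col_mx (at_line P a b t) v : 'M_(9 + 1, 3)).
Proof.
rewrite -[LHS]/(horner_eval t _) /C_line C_gen_map -C_genE; congr C_gen.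
by rewrite (@map_col_mx _ _ _ 9 1) line_at map_polyC_at.
Qed.

Lemma C_line_N v : C_line P a b v ^+ 2 * N_line = R_gen (line P a b) (map_mx polyC v).
Proof.
apply: poly_ext => t; rewrite hornerM horner_exp horner_C_line horner_N_line -hN.
by rewrite -[RHS]/(horner_eval t _) R_gen_map -R_genE line_at map_polyC_at.
Qed.

Variables (v o : 'rV[K]_3).
Hypothesis Cb : C_det (col_mx (col_mx P b : 'M_(8 + 1, 3)) v : 'M_(9 + 1, 3)) != 0.

(** R has degree 15 and C has degree exactly 3 in t, so N has degree at most 15 - 6
    = 9. *)
Lemma size_N_line : (size N_line <= 10)%N.
Proof.
have [->|N0] := eqVneq N_line 0; first by rewrite size_poly0.
have [sC tC] := top_C_line P a b v.
rewrite C_genE in tC.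
have s4 : size (C_line P a b v) = 4%N.
  apply/eqP; rewrite eqn_leq sC /= ltnNge; apply: contra Cb => s3.
  by rewrite -tC nth_default.
have C0 : C_line P a b v != 0 by rewrite -size_poly_eq0 s4.
have := size_R_line P a b v; rewrite -C_line_N expr2.
by rewrite !size_mul ?mulf_neq0 // s4 /=; rewrite -[16%N]/(2 + 4 + 10)%N leq_add2l.
Qed.

Definition witness_line := witness (line P a b) (map_mx polyC (line_frame U b)) (map_mx polyC
  W)
   (map_mx polyC v) (map_mx polyC o).

Hypothesis fr : forall i, vol (pts (at_line P a b 0) i) (pts (line_frame U b) i) (pts W i) !=
  0.
Hypothesis sD : size (D_line P U a b W) = 10%N.
Hypothesis cop : coprimep (D_line P U a b W) (witness_line * (D_line P U a b W)^`()).

Lemma horner_D_line t : (D_line P U a b W).[t] = D_gen (at_line P a b t) (line_frame U b) W.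
Proof.
by rewrite -[LHS]/(horner_eval t _) D_gen_map line_at !map_polyC_at.
Qed.

Lemma frame_mx_adj_col (p u w : 'M[K]_(9, 3)) : D_gen p u w = 0 ->
  frame_mx (pts p) (pts u) (pts w) *m adj_col p u w = 0.
Proof.
move=> D0; rewrite /adj_col colE mulmxA (mul_mx_adj (frame_mx _ _ _ : 'M_27)).
by rewrite -/(D_gen p u w) D0 raddf0 mul0mx.
Qed.

(** Every root of D is a root of N by [N_vanish]. As D has nine distinct roots and N
    has degree at most 9, they are proportional. *)
Lemma N_line_prop : exists k : K, forall t,
  eval9 N (at_line P a b t) = k * D_gen (at_line P a b t) (line_frame U b) W.
Proof.
have D0 : D_line P U a b W != 0 by rewrite -size_poly_eq0 sD.
move: cop; rewrite coprimepMr => /andP[copM sep].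
have : D_line P U a b W %| N_line.
  apply: dvd_of_roots => // [|t rt]; first by rewrite unlock.
  have M0 : witness_line.[t] != 0.
    by apply: contraL copM => Mt; apply/negP => /coprimep_root /(_ rt); rewrite (eqP Mt) eqxx.
  move: M0; rewrite -[_.[t]]/(horner_eval t _) witness_map line_at !map_polyC_at.
  rewrite /witness /= !C_genE mulf_eq0 negb_or => /andP[C0]; rewrite subr_eq0 => ne.
  rewrite rootE horner_N_line; apply/eqP.
  have frt i : vol (pts (at_line P a b t) i) (pts (line_frame U b) i) (pts W i) != 0.
    by rewrite vol_line.
  apply: (N_vanish hN frt _ C0 ne); apply: frame_mx_adj_col.
  by move: rt; rewrite rootE horner_D_line => /eqP.
case/dvdpP => q Nq; exists q`_0 => t.
rewrite -horner_N_line -horner_D_line Nq hornerM; congr (_ * _).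
suff sq : (size q <= 1)%N by rewrite (size1_polyC sq) hornerC coefC.
have [->|q0] := eqVneq q 0; first by rewrite size_poly0.
by have := size_N_line; rewrite Nq size_mul // sD addnS /= -[X in (_ <= X)%N]/(1 + 9)%N
    leq_add2r.
Qed.

(** The cross-multiplied form of N^2 = kappa^2 D^2 = const det A_f, which makes
    sense without genericity and extends to all lines. *)
Lemma N_line_cross x y :
  eval9 N (at_line P a b x) ^+ 2 * \det (canonical_mx (pts (at_line P a b y))) =
  eval9 N (at_line P a b y) ^+ 2 * \det (canonical_mx (pts (at_line P a b x))).
Proof.
have [k ek] := N_line_prop.
pose cc i := vol (pts (at_line P a b 0) i) (pts (line_frame U b) i) (pts W i).
have [k' k'0 ek'] := det_canonical_square (fr : forall i, cc i != 0).
have vE t i : vol (pts (at_line P a b t) i) (pts (line_frame U b) i) (pts W i) = cc i.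
  exact: vol_line.
rewrite !(ek' _ _ _ (vE _)) !ek /D_gen; ring.
Qed.

End LineN.

(** * From one line to all lines *)

Section MapLine.
Variables (A B : comNzRingType) (f : {rmorphism A -> B}).

Lemma map_map_polyC m n (M : 'M[A]_(m, n)) :
  map_mx (map_poly f) (map_mx polyC M) = map_mx polyC (map_mx f M).
Proof. by apply/matrixP => i j; rewrite !mxE map_polyC. Qed.

Lemma map_line P a b : map_mx (map_poly f) (line P a b) =
  line (map_mx f P) (map_mx f a) (map_mx f b).
Proof.
apply: etrans (@map_col_mx _ _ _ 8 1 _ _ _) _.
congr (@col_mx _ 8 1 _ _ _); first exact: map_map_polyC.
by apply/matrixP => i j; rewrite !mxE rmorphD rmorphM /= map_polyX !map_polyC.
Qed.

Lemma map_line_frame U b : map_mx f (line_frame U b) = line_frame (map_mx f U) (map_mx f b).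
Proof. exact: (@map_col_mx _ _ _ 8 1). Qed.

Lemma map_at_line P a b t : map_mx f (at_line P a b t) =
  at_line (map_mx f P) (map_mx f a) (map_mx f b) (f t).
Proof.
apply: etrans (@map_col_mx _ _ _ 8 1 _ _ _) _.
by congr (@col_mx _ 8 1 _ _ _); apply/matrixP => i j; rewrite !mxE rmorphD rmorphM.
Qed.

Lemma map_D_line P U a b W : map_poly f (D_line P U a b W) =
  D_line (map_mx f P) (map_mx f U) (map_mx f a) (map_mx f b) (map_mx f W).
Proof. by rewrite /D_line D_gen_map map_line !map_map_polyC map_line_frame. Qed.

Lemma canonical_mx_map (p : 'M[A]_(9, 3)) :
  map_mx f (canonical_mx (pts p)) = canonical_mx (pts (map_mx f p)).
Proof.
apply/matrixP => k l; rewrite !mxE rmorph_sum; apply: eq_bigr => i _.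
rewrite /mon_pairing; case: (sec_mon l) => [[a b] [m n]]; rewrite !rmorphM rmorph_mon_val.
have e := pts_map f p i; have eo c : f \o std A c =1 std B c by move=> j; rewrite /=
    rmorph_nat.
rewrite -!e; congr (_ * _); apply: eq_mon_val => // j.
  by rewrite /= rmorph_cross; apply: eq_cross.
by rewrite /= rmorph_cross; apply: eq_cross.
Qed.

End MapLine.

Section Path.
Variable K : numClosedFieldType.
Variables (N : {mpoly K[9 * 3]}) (hN : defines_N N).

(** The straight path from M0 to M1, as a matrix over {poly K}; the density
    arguments are along such paths. *)
Definition segment m n (M0 M1 : 'M[K]_(m, n)) : 'M[{poly K}]_(m, n) :=
  map_mx polyC M0 + 'X *: map_mx polyC (M1 - M0).

Lemma segment0 m n (M0 M1 : 'M[K]_(m, n)) : map_mx (horner_eval 0) (segment M0 M1) = M0.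
Proof.
by apply/matrixP => i j; rewrite !mxE /horner_eval hornerD hornerM hornerX !hornerC mul0r
  addr0.
Qed.

Lemma segment1 m n (M0 M1 : 'M[K]_(m, n)) : map_mx (horner_eval 1) (segment M0 M1) = M1.
Proof.
by apply/matrixP => i j; rewrite !mxE /horner_eval hornerD hornerM hornerX !hornerC; ring.
Qed.

Variables (P0 U : 'M[K]_(8, 3)) (a0 b0 : 'rV[K]_3) (W : 'M[K]_(9, 3)) (v o : 'rV[K]_3).
Hypothesis Cb0 : C_det (col_mx (col_mx P0 b0 : 'M_(8 + 1, 3)) v : 'M_(9 + 1, 3)) != 0.
Hypothesis fr0 : forall i, vol (pts (at_line P0 a0 b0 0) i) (pts (line_frame U b0) i)
  (pts W i) != 0.
Hypothesis sD0 : size (D_line P0 U a0 b0 W) = 10%N.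
Hypothesis cop0 : coprimep (D_line P0 U a0 b0 W)
  (witness_line P0 U a0 b0 W v o * (D_line P0 U a0 b0 W)^`()).

(** A straight path joins the good line to the given one. The conditions of
    [N_line_cross] hold at its start, hence at all but finitely many of its points,
    and the identity is polynomial along the path. Thus it holds at the end. *)
Lemma N_cross_last P a b x y :
  eval9 N (at_line P a b x) ^+ 2 * \det (canonical_mx (pts (at_line P a b y))) =
  eval9 N (at_line P a b y) ^+ 2 * \det (canonical_mx (pts (at_line P a b x))).
Proof.
pose Pe := segment P0 P; pose ae := segment a0 a; pose be := segment b0 b.
pose Ue := map_mx polyC U; pose We := map_mx polyC W.
pose D2 := D_line Pe Ue ae be We.
pose M2 := witness (line Pe ae be) (map_mx polyC (line_frame Ue be)) (map_mx polyC We)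
   (map_mx polyC (map_mx polyC v)) (map_mx polyC (map_mx polyC o)).
pose H2 := M2 * D2^`().
pose at_ e := map_poly (horner_eval e) : {poly {poly K}} -> {poly K}.
pose ev e m n (M : 'M[{poly K}]_(m, n)) : 'M[K]_(m, n) := map_mx (horner_eval e) M.
have atD e : at_ e D2 = D_line (ev e _ _ Pe) U (ev e _ _ ae) (ev e _ _ be) W.
  by rewrite /at_ map_D_line !map_polyC_at.
have atM e : at_ e M2 = witness_line (ev e _ _ Pe) U (ev e _ _ ae) (ev e _ _ be) W v o.
  by rewrite /at_ witness_map map_line !map_map_polyC map_line_frame !map_polyC_at.
have atH e : at_ e H2 = at_ e M2 * (at_ e D2)^`() by rewrite /at_ rmorphM deriv_map.
have [|||bad bad0 hbad] := @coprime_specialization K D2 H2 8.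
- exact: size_D_line.
- by rewrite [map_poly _ _]atD /ev !segment0.
- by rewrite [map_poly _ H2]atH [map_poly _ _]atD atM [at_ 0 D2]atD /ev !segment0.
pose CC := C_gen (col_mx (col_mx Pe be : 'M_(8 + 1, 3)) (map_mx polyC v) : 'M_(9 + 1, 3)).
pose VV := \prod_i vol (pts (at_line Pe ae be 0) i) (pts (line_frame Ue be) i) (pts We i).
have evC e : CC.[e] = C_det (col_mx (col_mx (ev e _ _ Pe) (ev e _ _ be) : 'M_(8 + 1, 3)) v :
    'M_(9 + 1, 3)).
  rewrite -[LHS]/(horner_eval e _) C_gen_map C_genE; congr C_det.
  by rewrite (@map_col_mx _ _ _ 9 1) (@map_col_mx _ _ _ 8 1) map_polyC_at.
have evV e : VV.[e] = \prod_i vol (pts (at_line (ev e _ _ Pe) (ev e _ _ ae) (ev e _ _ be) 0)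
    i)
    (pts (line_frame U (ev e _ _ be)) i) (pts W i).
  rewrite -[LHS]/(horner_eval e _) rmorph_prod; apply: eq_bigr => i _.
  rewrite rmorph_vol /vol !(pts_map (horner_eval e)).
  rewrite !(eq_cross (pts_map (horner_eval e) _ _) (pts_map (horner_eval e) _ _)).
  by rewrite map_at_line map_line_frame !map_polyC_at rmorph0.
pose EE t t' := N_poly N (at_line Pe ae be t%:P) ^+ 2 * \det (canonical_mx
  (pts (at_line Pe ae be t'%:P))).
have evE t t' e : (EE t t').[e] =
  eval9 N (at_line (ev e _ _ Pe) (ev e _ _ ae) (ev e _ _ be) t) ^+ 2 *
  \det (canonical_mx (pts (at_line (ev e _ _ Pe) (ev e _ _ ae) (ev e _ _ be) t'))).
  rewrite /EE hornerM horner_exp horner_N_poly map_at_line.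
  rewrite -[(\det _).[e]]/(horner_eval e _) -det_map_mx canonical_mx_map map_at_line.
  have eC z : horner_eval e z%:P = z by rewrite /horner_eval hornerC.
  by rewrite /= !eC.
(* The polynomials are made opaque, since unfolding them would be very slow. *)
move: EE evE CC evC VV evV => EE evE CC evC VV evV.
have : EE x y - EE y x = 0.
  apply: (@poly_cancel K (bad * CC * VV)).
    apply/negP => /eqP /(congr1 (horner^~ 0)); rewrite horner0 !hornerM evC evV /ev !segment0.
    move/eqP; apply/negP; rewrite !mulf_neq0 //.
    by apply/prodf_neq0 => i _; apply: fr0.
  move=> e; rewrite !hornerM !mulf_eq0 !negb_or => /andP[/andP[be0 ce0] ve0].
  rewrite hornerD hornerN !evE; apply/eqP; rewrite subr_eq0; apply/eqP.
  have [sD cD] := hbad e be0.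
  apply: (@N_line_cross K N hN _ U _ _ W v o).
  - by rewrite -evC.
  - by move=> i; move: ve0; rewrite evV => /prodf_neq0 /(_ i); apply.
  - by rewrite -atD.
  - by rewrite -atM -atD -atH.
move/(congr1 (horner^~ 1)); rewrite horner0 hornerD hornerN !evE /ev !segment1.
by move/eqP; rewrite subr_eq0 => /eqP.
Qed.

End Path.

(** * Symmetry in the nine points *)

Section Symmetry.
Variable K : numClosedFieldType.
Implicit Types (p q : 'M[K]_(9, 3)) (v : 'rV[K]_3).

Lemma row_of_perm m n (s : 'S_m) (M : 'M[K]_(m, n)) i :
  row i (row_perm s M) = row (s i) M.
Proof. by apply/rowP => j; rewrite !mxE. Qed.

Lemma det_canonical_perm (s : 'S_9) p :
  \det (canonical_mx (pts (row_perm s p))) = \det (canonical_mx (pts p)).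
Proof.
congr (\det _); apply/matrixP => k l; rewrite !mxE.
rewrite [RHS](reindex_perm s); apply: eq_bigr => i _; congr (mon_pairing l k _).
by rewrite /pts row_of_perm.
Qed.

Lemma sqr_det_col_mx m n (L : 'M[K]_m) (M : 'M[K]_(m, m + n)) (T : 'M[K]_(n, m + n)) :
  (\det L) ^+ 2 = 1 -> \det (col_mx (L *m M) T) ^+ 2 = \det (col_mx M T) ^+ 2.
Proof.
move=> L1; have -> : col_mx (L *m M) T = block_mx L 0 0 1%:M *m col_mx M T.
  by rewrite mul_block_col !mul0mx mul1mx addr0 add0r.
by rewrite det_mulmx det_ublock det1 mulr1 exprMn L1 mul1r.
Qed.

Lemma C_det_perm (s : 'S_9) p v :
  C_det (col_mx (row_perm s p) v : 'M_(9 + 1, 3)) ^+ 2 =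
  C_det (col_mx p v : 'M_(9 + 1, 3)) ^+ 2.
Proof.
have e q : \matrix_(i < 10) evalrow 3 10 (row i (col_mx q v : 'M_(9 + 1, 3))) =
    col_mx (\matrix_(i < 9) evalrow 3 10 (row i q)) (evalrow 3 10 v) :> 'M_(9 + 1, 10).
  apply/row_matrixP => i; rewrite rowK; case: (@split_ordP 9 1 i) => {}i ->.
    by rewrite !(@rowKu _ 9 1) rowK.
  by rewrite !(@rowKd _ 9 1) (ord1 i) !row_id.
rewrite /C_det !e.
have -> : \matrix_(i < 9) evalrow 3 10 (row i (row_perm s p)) =
    perm_mx s *m \matrix_(i < 9) evalrow 3 10 (row i p).
  by rewrite -row_permE; apply/row_matrixP => i; rewrite row_of_perm !rowK row_of_perm.
apply: (@sqr_det_col_mx 9 1); rewrite det_perm; exact: sqrr_sign.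
Qed.

(** An involution of the points is an involution of the blocks of rows, whose
    determinant squares to one. *)
Lemma R_det_perm (s : 'S_9) p v : (s * s = 1)%g ->
  R_det (row_perm s p) v ^+ 2 = R_det p v ^+ 2.
Proof.
move=> s2; rewrite /R_det.
have -> : T_mx (row_perm s p) = (lin_mx (row_perm s : 'M[K]_(9, 3) -> _))^T *m T_mx p.
  apply/matrixP => r k; rewrite (lin_mx_tr_col _
    (fun k => \matrix_(i < 9, j < 3) jacobian (row i p) j k)) mxE.
  congr (mxvec _ _ _); apply/matrixP => i j.
  by rewrite !mxE row_of_perm.
apply: (@sqr_det_col_mx (9 * 3) 1); rewrite det_tr expr2 -det_mulmx lin_mx_cancel ?det1 //.
by move=> M /=; rewrite -row_permM s2 row_perm1.
Qed.

Variables (N : {mpoly K[9 * 3]}) (hN : defines_N N).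
Variables (q0 : 'M[K]_(9, 3)) (v0 : 'rV[K]_3).
Hypothesis C0 : C_det (col_mx q0 v0 : 'M_(9 + 1, 3)) != 0.

(** The symmetry of R^2 and C^2 gives that of N^2 where C is nonzero, hence
    everywhere. *)
Lemma N_perm (s : 'S_9) p : (s * s = 1)%g ->
  eval9 N (row_perm s p) ^+ 2 = eval9 N p ^+ 2.
Proof.
move=> s2; pose pe := segment q0 p.
pose CC := C_gen (col_mx pe (map_mx polyC v0) : 'M_(9 + 1, 3)).
have evC e : CC.[e] = C_det (col_mx (map_mx (horner_eval e) pe) v0 : 'M_(9 + 1, 3)).
  rewrite -[LHS]/(horner_eval e _) C_gen_map C_genE; congr C_det.
  by rewrite (@map_col_mx _ _ _ 9 1) map_polyC_at.
have : N_poly N (row_perm s pe) ^+ 2 - N_poly N pe ^+ 2 = 0.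
  apply: (@poly_cancel K CC).
    apply/negP => /eqP /(congr1 (horner^~ 0)); rewrite horner0 evC segment0.
    by apply/eqP.
  move=> e; rewrite evC hornerD hornerN !horner_exp !horner_N_poly map_row_perm.
  set q := map_mx _ pe => Cq; apply/eqP; rewrite subr_eq0; apply/eqP.
  have := R_det_perm q v0 s2; rewrite !hN !exprMn C_det_perm.
  by apply: mulfI; rewrite mulf_neq0 // expf_neq0.
move/(congr1 (horner^~ 1)); rewrite horner0 hornerD hornerN !horner_exp !horner_N_poly.
by rewrite map_row_perm segment1 => /eqP; rewrite subr_eq0 => /eqP.
Qed.

Hypothesis on_line : forall P a b x y,
  eval9 N (at_line P a b x) ^+ 2 * \det (canonical_mx (pts (at_line P a b y))) =
  eval9 N (at_line P a b y) ^+ 2 * \det (canonical_mx (pts (at_line P a b x))).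

(** A transposition brings the row where p and q differ to the end, and two points
    are always joined by a line. *)
Lemma N_cross i p q : (forall k, k != i -> row k p = row k q) ->
  eval9 N p ^+ 2 * \det (canonical_mx (pts q)) = eval9 N q ^+ 2 * \det (canonical_mx (pts p)).
Proof.
move=> epq; pose s := tperm i (ord_max : 'I_9).
have s2 : (s * s = 1)%g by rewrite tperm2.
rewrite -(N_perm p s2) -(N_perm q s2) -(det_canonical_perm s p) -(det_canonical_perm s q).
set p' := row_perm s p; set q' := row_perm s q.
pose a := row ord_max p'; pose b := row ord_max q' - a.
pose P : 'M[K]_(8, 3) := usubmx (p' : 'M_(8 + 1, 3)).
have eP r : (forall k, k != ord_max -> row k r = row k p') ->
    usubmx (r : 'M_(8 + 1, 3)) = P.
  move=> h; apply/row_matrixP => k; rewrite !row_usubmx h //.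
  by rewrite -val_eqE /= neq_ltn ltn_ord.
have eD (r : 'M[K]_(9, 3)) : dsubmx (r : 'M_(8 + 1, 3)) = row ord_max r.
  by apply/rowP => j; rewrite !mxE; congr (r _ _); apply: val_inj.
have -> : p' = at_line P a b 0.
  by rewrite /at_line scale0r addr0 /a -eD vsubmxK.
have -> : q' = at_line P a b 1; last exact: on_line.
rewrite /at_line scale1r /b addrC subrK -eD -(eP q') ?vsubmxK // => k km.
rewrite !row_of_perm epq //; apply: contra km => /eqP sk.
by rewrite -(tpermK i ord_max k) sk tpermL.
Qed.

Hypothesis D0 : \det (canonical_mx (pts q0)) != 0.

(** The rows of q0 are replaced by those of p one at a time. The steps can be
    chained where the intermediate determinants do not vanish, which is the case at
    the start of the straight path from q0 to p, and density does the rest. *)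
Lemma N_proportional p :
  eval9 N p ^+ 2 * \det (canonical_mx (pts q0)) = eval9 N q0 ^+ 2 * \det (canonical_mx
    (pts p)).
Proof.
pose mix (A : comNzRingType) k (x y : 'M[A]_(9, 3)) : 'M[A]_(9, 3) :=
  \matrix_(i, j) (if (i < k)%N then x i j else y i j).
(* For every r and k, the first k rows of q0 may be replaced by those of r. *)
suff H k r : eval9 N (mix K k r q0) ^+ 2 * \det (canonical_mx (pts q0)) =
   eval9 N q0 ^+ 2 * \det (canonical_mx (pts (mix K k r q0))).
  have := H 9%N p; have -> // : mix K 9%N p q0 = p.
  by apply/matrixP => i j; rewrite mxE ltn_ord.
elim: k r => [|k IH] r.
  have -> : mix K 0%N r q0 = q0 by apply/matrixP => i j; rewrite mxE ltn0.
  by [].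
pose re := segment q0 r; pose qe := map_mx polyC q0.
have evm e m : map_mx (horner_eval e) (mix _ m re qe) = mix K m (map_mx (horner_eval e) re)
    q0.
  by apply/matrixP => i j; rewrite !mxE; case: ifP => _; rewrite /horner_eval ?hornerC.
have evN e m : (N_poly N (mix _ m re qe)).[e] = eval9 N (mix K m (map_mx (horner_eval e) re)
    q0).
  by rewrite horner_N_poly evm.
have evD e m : (\det (canonical_mx (pts (mix _ m re qe)))).[e] =
    \det (canonical_mx (pts (mix K m (map_mx (horner_eval e) re) q0))).
  by rewrite -[LHS]/(horner_eval e _) -det_map_mx canonical_mx_map evm.
have : N_poly N (mix _ k.+1 re qe) ^+ 2 * (\det (canonical_mx (pts q0)))%:P -
   (eval9 N q0 ^+ 2)%:P * \det (canonical_mx (pts (mix _ k.+1 re qe))) = 0.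
  apply: (@poly_cancel K (\det (canonical_mx (pts (mix _ k re qe))))).
    apply/negP => /eqP /(congr1 (horner^~ 0)); rewrite horner0 evD segment0.
    have -> : mix K k q0 q0 = q0 by apply/matrixP => i j; rewrite mxE if_same.
    by apply/eqP.
  move=> e; rewrite evD hornerD hornerN (hornerM (_ ^+ 2)) (hornerM _%:P) !hornerC.
  rewrite horner_exp evN evD.
  set x := map_mx _ re => Dk; apply/eqP; rewrite subr_eq0; apply/eqP.
  apply: (mulIf Dk); rewrite mulrAC.
  have [kn|kn] := ltnP k 9; last first.
    have ek : mix K k.+1 x q0 = mix K k x q0.
      by apply/matrixP => i j; rewrite !mxE !(leq_trans (ltn_ord i)) // ltnW.
    by rewrite ek mulrAC IH.
  rewrite (@N_cross (Ordinal kn) (mix K k.+1 x q0) (mix K k x q0)).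
    by rewrite mulrAC IH mulrAC.
  move=> i ik; apply/rowP => j; rewrite !mxE ltnS leq_eqVlt.
  by rewrite -val_eqE /= in ik; rewrite (negbTE ik).
move/(congr1 (horner^~ 1)); rewrite horner0 hornerD hornerN (hornerM (_ ^+ 2)).
rewrite (hornerM _%:P) !hornerC horner_exp evN evD.
by rewrite segment1 => /eqP; rewrite subr_eq0 => /eqP.
Qed.

(** Evaluation at q0 gives the value of the constant; it is finite and nonzero
    because det A_f does not vanish at q0, and neither does N, or it would vanish
    identically and so would R. *)
Lemma det_A_from_example (s : 'I_27 -> 'Hom(Sym K 2, Sym K 2)) (hs : is_basis_H0E s)
    (t : 'I_27 -> 'Hom(Sym K 2, Form K 4)) (ht : is_basis_H0Edual6 t) p1 v1 :
  R_det p1 v1 != 0 ->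
  exists2 lambda : K, lambda != 0 &
    forall p, \det (A_mx s t (sum_pow6 p)) = lambda * eval9 N p ^+ 2.
Proof.
move=> R1; have [c ec] := det_canonical hs ht.
have c0 : c != 0 by apply: contraNneq D0 => c0; rewrite ec c0 mul0r.
have N0 : eval9 N q0 != 0.
  apply: contraNneq R1 => N0; rewrite hN.
  have /eqP := N_proportional p1; rewrite N0 expr0n mul0r mulf_eq0 (negbTE D0) orbF.
  by rewrite expf_eq0 => /eqP ->; rewrite mulr0.
exists (c^-1 * (\det (canonical_mx (pts q0)) / eval9 N q0 ^+ 2)).
  by rewrite !mulf_neq0 ?invr_eq0 ?expf_neq0.
move=> p; have := N_proportional p; rewrite (ec p) => e.
have -> : c^-1 * (\det (canonical_mx (pts q0)) / eval9 N q0 ^+ 2) * eval9 N p ^+ 2 =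
  c^-1 / eval9 N q0 ^+ 2 * (eval9 N p ^+ 2 * \det (canonical_mx (pts q0))) by ring.
by rewrite e; field; rewrite c0 N0.
Qed.

End Symmetry.

(** * Coefficients of ternary forms *)

Definition mnm3 (i j k : nat) : 'X_{1..3} := [multinom [tuple i; j; k]].

Definition exponents d : seq (nat * nat * nat) :=
  [seq (i, j, d - i - j)%N | i <- iota 0 d.+1, j <- iota 0 (d.+1 - i)].

Definition mnms3 d : seq 'X_{1..3} :=
  [seq mnm3 i j (d - i - j) | i <- iota 0 d.+1, j <- iota 0 (d.+1 - i)].

Lemma mdeg_mnm3 i j k : mdeg (mnm3 i j k) = (i + j + k)%N.
Proof.
by rewrite mdegE !big_ord_recl big_ord0 /= /mnm3 !multinomE /= !(tnth_nth 0%N) /=; lia.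
Qed.

Lemma mnm3E (m : 'X_{1..3}) :
  m = mnm3 (m ord0) (m (inord 1)) (m (inord 2)).
Proof.
apply/mnmP => i; rewrite /mnm3 multinomE (tnth_nth 0%N) /=.
by case: i => [[|[|[|//]]] ?] /=; congr (m _); apply: val_inj; rewrite /= ?inordK.
Qed.

(** Sums over the monomials of degree d do not depend on the order in which [monom]
    lists them. *)
Lemma monom_perm_mnms3 d n : n = 'C(d + 2, d) ->
  perm_eq [seq monom d k | k <- iota 0 n] (mnms3 d).
Proof.
move=> dn; apply: uniq_perm.
- rewrite map_inj_in_uniq ?iota_uniq // => k l; rewrite !mem_iota /= => kn ln /eqP.
  by rewrite (monom_inj dn) // => /eqP.
- apply: allpairs_uniq_dep => [|i _|]; rewrite ?iota_uniq //.
  move=> [i j] [i' j'] _ _ /= /mnmP e.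
  move: (e ord0) (e (inord 1)); rewrite /mnm3 !multinomE !(tnth_nth 0%N) /= inordK //.
  by move=> /= -> ->.
move=> m; apply/mapP/allpairsPdep => [[k]|[i [j []]]].
  rewrite mem_iota /= => kn ->; have := monom_mem dn kn; set q := monom d k => dq.
  exists (q ord0), (q (inord 1)).
  have : (q ord0 + q (inord 1) + q (inord 2) = d)%N by rewrite -mdeg_mnm3 -mnm3E.
  move=> dd; split.
  - by rewrite -[0%N :: _]/(iota 0 d.+1) mem_iota add0n ltnS -dd -addnA leq_addr.
  - by rewrite mem_iota add0n leq0n ltn_subRL ltnS -dd leq_addr.
  by rewrite {1}(mnm3E q) -[in RHS]dd -addnA addKn addKn.
rewrite !mem_iota !add0n !leq0n /= !ltnS => id jd ->.
have dm : mdeg (mnm3 i j (d - i - j)) = d by rewrite mdeg_mnm3; lia.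
have [k kn ek] := monom_surj dn dm.
by exists k; rewrite // mem_iota.
Qed.

Lemma sum_monom (V : nmodType) d n (F : 'X_{1..3} -> V) : n = 'C(d + 2, d) ->
  \sum_(k < n) F (monom d k) = \sum_(m <- exponents d) F (mnm3 m.1.1 m.1.2 m.2).
Proof.
move=> dn; rewrite -(big_mkord xpredT (fun k => F (monom d k))) -(big_map (monom d) xpredT F).
rewrite /index_iota subn0 (perm_big _ (monom_perm_mnms3 dn)) /mnms3 big_allpairs_dep.
by rewrite /exponents big_allpairs_dep.
Qed.

Section Expand.
Variable K : fieldType.
Implicit Types (v : 'rV[K]_3) (g : {mpoly K[3]}) (c : nat -> nat -> nat -> K).

Definition coefs g (i j k : nat) : K := g@_(mnm3 i j k).

(** A sum over an explicit list of exponents: for a numeral d it unfolds into a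
    polynomial expression that [ring] and [field] can handle. *)
Definition form_val d c (v : nat -> K) : K :=
  \sum_(m <- exponents d) c m.1.1 m.1.2 m.2 * (v 0%N ^+ m.1.1 * v 1%N ^+ m.1.2 * v 2%N ^+
    m.2).

Definition mon_deriv (l : nat) (m : nat * nat * nat) (v : nat -> K) : K :=
  match l with
  | 0 => m.1.1%:R * (v 0%N ^+ m.1.1.-1 * v 1%N ^+ m.1.2 * v 2%N ^+ m.2)
  | 1 => m.1.2%:R * (v 0%N ^+ m.1.1 * v 1%N ^+ m.1.2.-1 * v 2%N ^+ m.2)
  | _ => m.2%:R * (v 0%N ^+ m.1.1 * v 1%N ^+ m.1.2 * v 2%N ^+ m.2.-1)
  end.

Definition form_deriv_val d c l (v : nat -> K) : K :=
  \sum_(m <- exponents d) c m.1.1 m.1.2 m.2 * mon_deriv l m v.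

Lemma coefs_eq0 d g : g \is d.-homog ->
  (forall m, m \in exponents d -> coefs g m.1.1 m.1.2 m.2 = 0) -> g = 0.
Proof.
move=> hg h; rewrite (homog_form_of (erefl 'C(d + 2, d)) hg) /form_of.
rewrite (sum_monom (fun m => g@_m *: 'X_[m]) (erefl 'C(d + 2, d))).
by apply: big1_seq => m /andP[_ /h]; rewrite /coefs => ->; rewrite scale0r.
Qed.

Lemma evalf_coefs d g v : g \is d.-homog ->
  evalf v g = form_val d (coefs g) (crd v).
Proof.
move=> hg; rewrite [in LHS](homog_form_of (erefl 'C(d + 2, d)) hg) eval_form.
rewrite (sum_monom (fun m => evalf v 'X_[m] * g@_m) (erefl 'C(d + 2, d))).
apply: eq_bigr => m _; rewrite mulrC evalfX /monev; congr (_ * _).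
by rewrite !big_ord_recl big_ord0 /mnm3 !multinomE !(tnth_nth 0%N) /= mulr1 mulrA.
Qed.

Lemma deriv_coefs d g v (l : 'I_3) : g \is d.-homog ->
  evalf v g^`M(l) = form_deriv_val d (coefs g) l (crd v).
Proof.
move=> hg; rewrite [in LHS](homog_form_of (erefl 'C(d + 2, d)) hg) eval_form_deriv.
rewrite (sum_monom (fun m => evalf v 'X_[m]^`M(l) * g@_m) (erefl 'C(d + 2, d))).
apply: eq_bigr => -[[i j] k] _; rewrite mulrC; congr (_ * _).
rewrite mderivX /evalf mevalZ -/(evalf _ _) evalfX /monev.
rewrite !big_ord_recl big_ord0 /= mulr1 !mulrA !mnmBE !mnm1E.
rewrite /mnm3 !multinomE !(tnth_nth 0%N) /=.
by case: l => [[|[|[|//]]] ?] /=; rewrite /= ?subn0 ?subn1 !mulrA.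
Qed.

Lemma eq_form_val d c (v v' : nat -> K) : (forall k, (k < 3)%N -> v k = v' k) -> form_val d c
  v = form_val d c v'.
Proof. by move=> e; apply: eq_bigr => m _; rewrite !e. Qed.

Lemma eq_form_deriv_val d c l (v v' : nat -> K) : (forall k, (k < 3)%N -> v k = v' k) ->
  form_deriv_val d c l v = form_deriv_val d c l v'.
Proof. by move=> e; apply: eq_bigr => m _; case: l => [|[|l]]; rewrite /= !e. Qed.

End Expand.

(** * The sections vanishing at eight special points *)

Section LinearCombinations.
Variable K : pzRingType.
Implicit Types a b x y : K.

Lemma lincombM k x : x = 0 -> k * x = 0.
Proof. by move->; rewrite mulr0. Qed.

Lemma lincombD x y : x = 0 -> y = 0 -> x + y = 0.
Proof. by move=> -> ->; rewrite addr0. Qed.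

(** The solutions of the linear systems below are certified: an equation is deduced
    from others by giving the coefficients of a linear combination. *)
Lemma eq_lincomb a b x : x = 0 -> a - b = x -> a = b.
Proof. by move=> -> /eqP; rewrite subr_eq0 => /eqP. Qed.

End LinearCombinations.

Notation "k *z e" := (lincombM k e) (at level 40, only parsing).
Notation "e +z f" := (lincombD e f) (at level 50, left associativity, only parsing).

Section BaseSections.
Variable K : numFieldType.
Implicit Types (c : nat -> K) (v x y : nat -> K).

Definition vec (a b c : K) : nat -> K := fun k => nth 0 [:: a; b; c] k.

Lemma sec27 c v x y : sec_val (fun j : 'I_27 => c j) v x y =
  c 0%N * (v 0%N * v 0%N * (x 0%N * y 0%N + x 0%N * y 0%N))
  + c 1%N * (v 0%N * v 0%N * (x 0%N * y 1%N + x 1%N * y 0%N))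
  + c 2%N * (v 0%N * v 0%N * (x 1%N * y 1%N + x 1%N * y 1%N))
  + c 3%N * (v 0%N * v 0%N * (x 0%N * y 2%N + x 2%N * y 0%N))
  + c 4%N * (v 0%N * v 0%N * (x 1%N * y 2%N + x 2%N * y 1%N))
  + c 5%N * (v 0%N * v 0%N * (x 2%N * y 2%N + x 2%N * y 2%N))
  + c 6%N * (v 0%N * v 1%N * (x 0%N * y 0%N + x 0%N * y 0%N))
  + c 7%N * (v 0%N * v 1%N * (x 0%N * y 1%N + x 1%N * y 0%N))
  + c 8%N * (v 0%N * v 1%N * (x 1%N * y 1%N + x 1%N * y 1%N))
  + c 9%N * (v 0%N * v 1%N * (x 0%N * y 2%N + x 2%N * y 0%N))
  + c 10%N * (v 0%N * v 1%N * (x 1%N * y 2%N + x 2%N * y 1%N))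
  + c 11%N * (v 0%N * v 1%N * (x 2%N * y 2%N + x 2%N * y 2%N))
  + c 12%N * (v 1%N * v 1%N * (x 0%N * y 0%N + x 0%N * y 0%N))
  + c 13%N * (v 1%N * v 1%N * (x 0%N * y 1%N + x 1%N * y 0%N))
  + c 14%N * (v 1%N * v 1%N * (x 1%N * y 1%N + x 1%N * y 1%N))
  + c 15%N * (v 1%N * v 1%N * (x 0%N * y 2%N + x 2%N * y 0%N))
  + c 16%N * (v 1%N * v 1%N * (x 1%N * y 2%N + x 2%N * y 1%N))
  + c 17%N * (v 1%N * v 1%N * (x 2%N * y 2%N + x 2%N * y 2%N))
  + c 18%N * (v 0%N * v 2%N * (x 0%N * y 0%N + x 0%N * y 0%N))
  + c 19%N * (v 0%N * v 2%N * (x 0%N * y 1%N + x 1%N * y 0%N))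
  + c 20%N * (v 0%N * v 2%N * (x 1%N * y 1%N + x 1%N * y 1%N))
  + c 21%N * (v 1%N * v 2%N * (x 0%N * y 0%N + x 0%N * y 0%N))
  + c 22%N * (v 1%N * v 2%N * (x 0%N * y 1%N + x 1%N * y 0%N))
  + c 23%N * (v 1%N * v 2%N * (x 1%N * y 1%N + x 1%N * y 1%N))
  + c 24%N * (v 2%N * v 2%N * (x 0%N * y 0%N + x 0%N * y 0%N))
  + c 25%N * (v 2%N * v 2%N * (x 0%N * y 1%N + x 1%N * y 0%N))
  + c 26%N * (v 2%N * v 2%N * (x 1%N * y 1%N + x 1%N * y 1%N)).
Proof. by rewrite /sec_val !big_ord_recr big_ord0 /= add0r. Qed.

Definition base8 (i : nat) : nat -> K := nth (vec 0 0 0)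
  [:: vec 1 0 0; vec 0 1 0; vec 0 0 1;
      vec 1 1 1; vec 1 1 (-1); vec 1 (-1) 1; vec (-1) 1 1; vec 1 2%:R 3%:R] i.

(** Frames that complete each base point to a basis; the default value serves the
    last six points. *)
Definition frame8_u (i : nat) : nat -> K := nth (vec 1 0 0) [:: vec 0 1 0; vec 0 0 1] i.

Definition frame8_w (i : nat) : nat -> K := nth (vec 0 1 0) [:: vec 0 0 1; vec 1 0 0] i.

Definition val8 c (i a : nat) : K :=
  sec_val (fun j : 'I_27 => c j) (base8 i)
      (cross (base8 i) (if a == 2%N then frame8_w i else frame8_u i))
      (cross (base8 i) (if a == 0%N then frame8_u i else frame8_w i)).

(** The coefficients, in the order of [sec_mons], of the general section vanishing
    at the first seven base points; its six parameters can be read off from them as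
    in [val8_sec7]. *)
Definition sec7 (a0 a1 a2 b0 b1 b2 : K) (k : nat) : K := nth 0
  [:: 0; a2 - b2; 0; - a1; 0; 0; - b2; 0; - b2; b0; b1; b2; 0; - a2 - b2; 0; 0; a0; 0; - a1;
    a0 + b0; b1; b0; - a1 + b1; a0; 0; 0; 0] k.

(** The sections that also vanish at the eighth point (1 : 2 : 3), see [val8_sec8]. *)
Definition sec8 (g0 g1 g2 : K) : nat -> K :=
  sec7 (g2 - g1) ((g0 - g2) *+ 2) ((g1 - g0) *+ 3) g0 (g1 *+ 2) (g2 *+ 3).

Lemma sec8_val g0 g1 g2 i a : (i < 8)%N -> (a < 3)%N -> val8 (sec8 g0 g1 g2) i a = 0.
Proof.
case: a => [|[|[|//]]]; case: i => [|[|[|[|[|[|[|[|//]]]]]]]] _ _;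
  rewrite /val8 sec27 /sec8 /sec7 /base8 /frame8_u /frame8_w /vec /=; ring.
Qed.

(** The conditions at the coordinate points make nine coefficients zero; those at
    the four points (1 : +-1 : +-1) are then solved by elimination. *)
Lemma val8_sec7 c :
  (forall i a, (i < 7)%N -> (a < 3)%N -> val8 c i a = 0) ->
  forall k, (k < 27)%N ->
  c k = sec7 (c 16%N) (- c 3%N) (c 1%N - c 6%N) (c 9%N) (c 10%N) (- c 6%N) k.
Proof.
move=> van.
have z2 : c 2%N = 0.
  apply: (eq_lincomb ((1 / 2) *z van 0%N 2%N isT isT)).
  by rewrite /val8 sec27 /base8 /frame8_u /frame8_w /vec /=; field.
have z4 : c 4%N = 0.
  apply: (eq_lincomb ((- 1) *z van 0%N 1%N isT isT)).
  by rewrite /val8 sec27 /base8 /frame8_u /frame8_w /vec /=; field.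
have z5 : c 5%N = 0.
  apply: (eq_lincomb ((1 / 2) *z van 0%N 0%N isT isT)).
  by rewrite /val8 sec27 /base8 /frame8_u /frame8_w /vec /=; field.
have z12 : c 12%N = 0.
  apply: (eq_lincomb ((1 / 2) *z van 1%N 0%N isT isT)).
  by rewrite /val8 sec27 /base8 /frame8_u /frame8_w /vec /=; field.
have z15 : c 15%N = 0.
  apply: (eq_lincomb ((- 1) *z van 1%N 1%N isT isT)).
  by rewrite /val8 sec27 /base8 /frame8_u /frame8_w /vec /=; field.
have z17 : c 17%N = 0.
  apply: (eq_lincomb ((1 / 2) *z van 1%N 2%N isT isT)).
  by rewrite /val8 sec27 /base8 /frame8_u /frame8_w /vec /=; field.
have z24 : c 24%N = 0.
  apply: (eq_lincomb ((1 / 2) *z van 2%N 2%N isT isT)).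
  by rewrite /val8 sec27 /base8 /frame8_u /frame8_w /vec /=; field.
have z25 : c 25%N = 0.
  apply: (eq_lincomb ((- 1) *z van 2%N 1%N isT isT)).
  by rewrite /val8 sec27 /base8 /frame8_u /frame8_w /vec /=; field.
have z26 : c 26%N = 0.
  apply: (eq_lincomb ((1 / 2) *z van 2%N 0%N isT isT)).
  by rewrite /val8 sec27 /base8 /frame8_u /frame8_w /vec /=; field.
have e30 : 2 * c 8%N - 2 * c 10%N + 2 * c 11%N + 2 * c 14%N - 2 * c 16%N + 2 * c 20%N +
    2 * c 23%N = 0.
  by rewrite -(van 3%N 0%N isT isT) /val8 sec27 /base8 /frame8_u /frame8_w /vec /=
      z2 z4 z5 z12 z15 z17 z24 z25 z26; ring.
have e31 : - c 1%N + c 3%N - c 7%N + c 9%N + c 10%N - 2 * c 11%N - c 13%N + c 16%N - c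
    19%N - c 22%N = 0.
  by rewrite -(van 3%N 1%N isT isT) /val8 sec27 /base8 /frame8_u /frame8_w /vec /=
      z2 z4 z5 z12 z15 z17 z24 z25 z26; ring.
have e32 : 2 * c 0%N - 2 * c 3%N + 2 * c 6%N - 2 * c 9%N + 2 * c 11%N + 2 * c 18%N + 2 *
    c 21%N = 0.
  by rewrite -(van 3%N 2%N isT isT) /val8 sec27 /base8 /frame8_u /frame8_w /vec /=
      z2 z4 z5 z12 z15 z17 z24 z25 z26; ring.
have e40 : 2 * c 8%N + 2 * c 10%N + 2 * c 11%N + 2 * c 14%N + 2 * c 16%N - 2 * c 20%N -
    2 * c 23%N = 0.
  by rewrite -(van 4%N 0%N isT isT) /val8 sec27 /base8 /frame8_u /frame8_w /vec /=
      z2 z4 z5 z12 z15 z17 z24 z25 z26; ring.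
have e41 : - c 1%N - c 3%N - c 7%N - c 9%N - c 10%N - 2 * c 11%N - c 13%N - c 16%N + c
    19%N + c 22%N = 0.
  by rewrite -(van 4%N 1%N isT isT) /val8 sec27 /base8 /frame8_u /frame8_w /vec /=
      z2 z4 z5 z12 z15 z17 z24 z25 z26; ring.
have e42 : 2 * c 0%N + 2 * c 3%N + 2 * c 6%N + 2 * c 9%N + 2 * c 11%N - 2 * c 18%N - 2 *
    c 21%N = 0.
  by rewrite -(van 4%N 2%N isT isT) /val8 sec27 /base8 /frame8_u /frame8_w /vec /=
      z2 z4 z5 z12 z15 z17 z24 z25 z26; ring.
have e50 : - 2 * c 8%N - 2 * c 10%N - 2 * c 11%N + 2 * c 14%N + 2 * c 16%N + 2 * c 20%N
    - 2 * c 23%N = 0.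
  by rewrite -(van 5%N 0%N isT isT) /val8 sec27 /base8 /frame8_u /frame8_w /vec /=
      z2 z4 z5 z12 z15 z17 z24 z25 z26; ring.
have e51 : - c 1%N - c 3%N + c 7%N + c 9%N - c 10%N - 2 * c 11%N - c 13%N + c 16%N - c
    19%N + c 22%N = 0.
  by rewrite -(van 5%N 1%N isT isT) /val8 sec27 /base8 /frame8_u /frame8_w /vec /=
      z2 z4 z5 z12 z15 z17 z24 z25 z26; ring.
have e52 : 2 * c 0%N - 2 * c 3%N - 2 * c 6%N + 2 * c 9%N - 2 * c 11%N + 2 * c 18%N - 2 *
    c 21%N = 0.
  by rewrite -(van 5%N 2%N isT isT) /val8 sec27 /base8 /frame8_u /frame8_w /vec /=
      z2 z4 z5 z12 z15 z17 z24 z25 z26; ring.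
have e60 : - 2 * c 8%N + 2 * c 10%N - 2 * c 11%N + 2 * c 14%N - 2 * c 16%N - 2 * c 20%N
    + 2 * c 23%N = 0.
  by rewrite -(van 6%N 0%N isT isT) /val8 sec27 /base8 /frame8_u /frame8_w /vec /=
      z2 z4 z5 z12 z15 z17 z24 z25 z26; ring.
have e61 : - c 1%N + c 3%N + c 7%N - c 9%N + c 10%N - 2 * c 11%N - c 13%N - c 16%N + c
    19%N - c 22%N = 0.
  by rewrite -(van 6%N 1%N isT isT) /val8 sec27 /base8 /frame8_u /frame8_w /vec /=
      z2 z4 z5 z12 z15 z17 z24 z25 z26; ring.
have e62 : 2 * c 0%N + 2 * c 3%N - 2 * c 6%N - 2 * c 9%N - 2 * c 11%N - 2 * c 18%N + 2 *
    c 21%N = 0.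
  by rewrite -(van 6%N 2%N isT isT) /val8 sec27 /base8 /frame8_u /frame8_w /vec /=
      z2 z4 z5 z12 z15 z17 z24 z25 z26; ring.
have z0 : c 0%N = 0.
  by apply: (eq_lincomb ((1 / 8) *z e32 +z (1 / 8) *z e42 +z (1 / 8) *z e52 +z (1 / 8) *z
      e62)); field.
have z7 : c 7%N = 0.
  by apply: (eq_lincomb ((- (1 / 4)) *z e31 +z (- (1 / 4)) *z e41 +z (1 / 4) *z e51 +z (1
      / 4) *z e61)); field.
have z8 : c 8%N = c 6%N.
  by apply: (eq_lincomb ((1 / 8) *z e30 +z (- (1 / 8)) *z e32 +z (1 / 8) *z e40 +z (- (1 /
      8)) *z e42 +z (- (1 / 8)) *z e50 +z (1 / 8) *z e52 +z (- (1 / 8)) *z e60 +z (1 / 8)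
      *z e62)); field.
have z11 : c 11%N = - c 6%N.
  by apply: (eq_lincomb ((1 / 8) *z e32 +z (1 / 8) *z e42 +z (- (1 / 8)) *z e52 +z (- (1 /
      8)) *z e62)); field.
have z13 : c 13%N = - c 1%N + 2 * c 6%N.
  by apply: (eq_lincomb ((- (1 / 4)) *z e31 +z (- (1 / 4)) *z e32 +z (- (1 / 4)) *z e41 +z
      (- (1 / 4)) *z e42 +z (- (1 / 4)) *z e51 +z (1 / 4) *z e52 +z (- (1 / 4)) *z e61 +z
      (1 / 4) *z e62)); field.
have z14 : c 14%N = 0.
  by apply: (eq_lincomb ((1 / 8) *z e30 +z (1 / 8) *z e40 +z (1 / 8) *z e50 +z (1 / 8) *z
      e60)); field.
have z18 : c 18%N = c 3%N.
  by apply: (eq_lincomb ((1 / 8) *z e32 +z (- (1 / 8)) *z e42 +z (1 / 8) *z e52 +z (- (1 /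
      8)) *z e62)); field.
have z19 : c 19%N = c 9%N + c 16%N.
  by apply: (eq_lincomb ((- (1 / 4)) *z e31 +z (1 / 4) *z e41 +z (- (1 / 4)) *z e51 +z (1
      / 4) *z e61)); field.
have z20 : c 20%N = c 10%N.
  by apply: (eq_lincomb ((1 / 8) *z e30 +z (- (1 / 8)) *z e40 +z (1 / 8) *z e50 +z (- (1 /
      8)) *z e60)); field.
have z21 : c 21%N = c 9%N.
  by apply: (eq_lincomb ((1 / 8) *z e32 +z (- (1 / 8)) *z e42 +z (- (1 / 8)) *z e52 +z (1
      / 8) *z e62)); field.
have z22 : c 22%N = c 3%N + c 10%N.
  by apply: (eq_lincomb ((- (1 / 4)) *z e31 +z (1 / 4) *z e41 +z (1 / 4) *z e51 +z (- (1 /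
      4)) *z e61)); field.
have z23 : c 23%N = c 16%N.
  by apply: (eq_lincomb ((1 / 8) *z e30 +z (- (1 / 8)) *z e40 +z (- (1 / 8)) *z e50 +z (1
      / 8) *z e60)); field.
case=> [|[|[|[|[|[|[|[|[|[|[|[|[|[|[|[|[|[|[|[|[|[|[|[|[|[|[|k //]]]]]]]]]]]]]]]]]]]]]]]]]]]
  _; rewrite /sec7 /= ?z0 ?z2 ?z4 ?z5 ?z7 ?z8 ?z11 ?z12 ?z13 ?z14 ?z15 ?z17 ?z18 ?z19 ?z20
  ?z21 ?z22 ?z23 ?z24 ?z25 ?z26; ring.
Qed.

End BaseSections.

(** * The ninth point of the example *)

Section MovingPoint.
Variable K : numFieldType.
Implicit Types (c : nat -> K) (t : K).

(** The three conditions at the eighth point cut the six parameters down to three. *)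
Lemma val8_sec8 c : (forall i a, (i < 8)%N -> (a < 3)%N -> val8 c i a = 0) ->
  exists g0 g1 g2, forall k, (k < 27)%N -> c k = sec8 g0 g1 g2 k.
Proof.
move=> van; have /val8_sec7 : forall i a, (i < 7)%N -> (a < 3)%N -> val8 c i a = 0.
  by move=> i a i7; apply: van; apply: ltnW.
move: (c 16%N) (- c 3%N) (- c 6%N) (c 9%N) (c 10%N) (c 1%N - c 6%N) => a0 a1 b2 b0 b1 a2 e.
have e7 a : val8 c 7 a = val8 (sec7 a0 a1 a2 b0 b1 b2) 7 a.
  by apply: eq_bigr => j _; rewrite e ?ltn_ord.
have h0 : 60 * a0 + 30 * b1 - 20 * b2 = 0.
  rewrite -(van 7%N 0%N) // e7 /val8 sec27 /sec7 /base8 /frame8_u /frame8_w /vec /=; ring.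
have h1 : - 15 * a0 + 48 * a1 + 27 * a2 - 15 * b0 - 48 * b1 + 37 * b2 = 0.
  rewrite -(van 7%N 1%N) // e7 /val8 sec27 /sec7 /base8 /frame8_u /frame8_w /vec /=; ring.
have h2 : - 48 * a1 + 96 * b0 - 32 * b2 = 0.
  rewrite -(van 7%N 2%N) // e7 /val8 sec27 /sec7 /base8 /frame8_u /frame8_w /vec /=; ring.
exists b0, (b1 / 2), (b2 / 3) => k /e ->; rewrite /sec8.
have -> : a0 = b2 / 3 - b1 / 2.
  apply/eqP; rewrite -subr_eq0; apply/eqP; transitivity (1 / 60 * (60 * a0 + 30 * b1 - 20 *
    b2)); first by field.
  by rewrite h0; ring.
have -> : a1 = (b0 - b2 / 3) *+ 2.
  apply/eqP; rewrite -subr_eq0; apply/eqP; transitivity (- (1 / 48) * (- 48 * a1 + 96 * b0 -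
    32 * b2)); first by field.
  by rewrite h2; ring.
have -> : a2 = (b1 / 2 - b0) *+ 3.
  apply/eqP; rewrite -subr_eq0; apply/eqP; transitivity (1 / 27 * (- 15 * a0 + 48 * a1 + 27 *
    a2 - 15 * b0 - 48 * b1 + 37 * b2 + 1 / 4 * (60 * a0 + 30 * b1 - 20 * b2) + (- 48 * a1 + 96
    * b0 - 32 * b2))); first by field.
  by rewrite h0 h1 h2; ring.
have e1 : (b1 / 2) *+ 2 = b1 by field.
have e2 : (b2 / 3) *+ 3 = b2 by field.
by rewrite e1 e2.
Qed.

Definition p9 t := vec 1 (2 * t) (1 - t).
Definition u9 := vec (0 : K) 2 (-1).
Definition w9 := vec (0 : K) 0 1.

(** Up to the constants of [sec8_p9], the values on the frame at the ninth point of
    the section with parameters g0, g1, g2. *)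
Definition rho (a : nat) t g0 g1 g2 : K := nth 0
  [:: (2 + 9 * t - 20 * t ^+ 2) * g0 + (- 1 - 3 * t + 13 * t ^+ 2) * g1
       + (2 - 9 * t + 19 * t ^+ 2) * g2;
     (- 2 - 3 * t - t ^+ 2 + 24 * t ^+ 3) * g0
       + (7 * t - 9 * t ^+ 2 - 16 * t ^+ 3) * g1
       + (- 2 + t + 17 * t ^+ 2 - 16 * t ^+ 3) * g2;
     (2 * t + t ^+ 2 - 8 * t ^+ 3 - 4 * t ^+ 4) * g0
       + (1 - 4 * t - 4 * t ^+ 2 + 16 * t ^+ 3) * g1] a.

Lemma sec8_p9 g0 g1 g2 t a : (a < 3)%N ->
  sec_val (fun j : 'I_27 => sec8 g0 g1 g2 j) (p9 t)
      (cross (p9 t) (if a == 2%N then w9 else u9))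
      (cross (p9 t) (if a == 0%N then u9 else w9)) =
  (if a == 1%N then 2 else 4) * rho a t g0 g1 g2.
Proof.
by case: a => [|[|[|//]]] _; rewrite sec27 /sec8 /sec7 /p9 /u9 /w9 /rho /vec /=; ring.
Qed.

(** The net of cubics through the first seven points is invariant, up to a common
    factor, under v |-> (1 / v_0 : 1 / v_1 : 1 / v_2), so the cubics of the net
    through (1 : 2 : 3) also contain (6 : 3 : 2). *)
Definition base9 := vec (6 : K) 3 2.

Definition quad (g0 g1 g2 : K) : K := 8 * g0 * g2 - 3 * g0 * g1 - 5 * g1 * g2.

Lemma disc_base9 g0 g1 g2 :
  disc_val (fun j : 'I_27 => sec8 g0 g1 g2 j) base9 =
  120 * 144 * quad g0 g1 g2.
Proof.
rewrite /disc_val /quad !sec27 /sec8 /sec7 /base9 /vec /std /=; ring.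
Qed.

(** Up to scalars, the equations of the nine lines v_i = v_j, v_i = - v_j, v_i / v_j
    = a_i / a_j with a = (1, 2, 3), taken at [p9 t]. They are the lines joining a
    coordinate point to one of the five points (1 : +-1 : +-1), (1 : 2 : 3). *)
Definition lines9 t : K := t * (1 - 2 * t) * (1 + 2 * t) * (3 * t - 1) * (t + 1) *
  (2 - t) * (1 - t) * (4 * t - 1) * (t + 2).

(** The determinant of the 3 x 3 system [rho] is a multiple of [lines9]: the
    combinations are the rows of its adjugate. *)
Lemma rho_det t g0 g1 g2 : lines9 t != 0 ->
  rho 0 t g0 g1 g2 = 0 -> rho 1 t g0 g1 g2 = 0 -> rho 2 t g0 g1 g2 = 0 ->
  [/\ g0 = 0, g1 = 0 & g2 = 0].
Proof.
move=> l0 h0 h1 h2.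
have d0 : 8 * lines9 t != 0 by rewrite mulf_neq0 ?pnatr_eq0.
split; apply: (mulfI d0); rewrite mulr0.
- transitivity ((2 - 9 * t - 21 * t ^+ 2 + 120 * t ^+ 3 - 12 * t ^+ 4 - 336 * t ^+ 5 + 256 * t
    ^+ 6) * rho 0 t g0 g1 g2
    + (2 - 17 * t + 47 * t ^+ 2 - 8 * t ^+ 3 - 220 * t ^+ 4 + 304 * t ^+ 5) * rho 1 t g0 g1 g2
    + (2 - 9 * t + 35 * t ^+ 2 - 204 * t ^+ 3 + 296 * t ^+ 4 + 96 * t ^+ 5) * rho 2 t g0 g1
      g2).
    by rewrite /lines9 /rho /=; ring.
  by rewrite h0 h1 h2 !mulr0 !addr0.
- transitivity ((- 4 * t + 51 * t ^+ 3 - 15 * t ^+ 4 - 156 * t ^+ 5 + 60 * t ^+ 6 + 64 * t ^+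
    7) * rho 0 t g0 g1 g2
    + (- 4 * t + 16 * t ^+ 2 - 13 * t ^+ 3 - 83 * t ^+ 4 + 116 * t ^+ 5 + 76 * t ^+ 6) * rho 1
      t g0 g1 g2
    + (28 * t - 96 * t ^+ 2 - 101 * t ^+ 3 + 249 * t ^+ 4 + 136 * t ^+ 5) * rho 2 t g0 g1 g2).
    by rewrite /lines9 /rho /=; ring.
  by rewrite h0 h1 h2 !mulr0 !addr0.
- transitivity ((- 2 + 5 * t + 5 * t ^+ 2 + 19 * t ^+ 3 - 43 * t ^+ 4 - 140 * t ^+ 5 + 220 * t
    ^+ 6 - 64 * t ^+ 7) * rho 0 t g0 g1 g2
    + (- 2 - 3 * t + 57 * t ^+ 2 - 45 * t ^+ 3 - 183 * t ^+ 4 + 228 * t ^+ 5 - 52 * t ^+ 6) *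
      rho 1 t g0 g1 g2
    + (- 2 + 5 * t + 61 * t ^+ 2 - 193 * t ^+ 3 + 121 * t ^+ 4 + 8 * t ^+ 5) * rho 2 t g0 g1
      g2).
    by rewrite /lines9 /rho /=; ring.
  by rewrite h0 h1 h2 !mulr0 !addr0.
Qed.

(** The cross product of the first two rows of [rho], up to a scalar. *)
Definition ker9 t (i : nat) : K := nth 0
  [:: 2 - 9 * t + 35 * t ^+ 2 - 204 * t ^+ 3 + 296 * t ^+ 4 + 96 * t ^+ 5;
      28 * t - 96 * t ^+ 2 - 101 * t ^+ 3 + 249 * t ^+ 4 + 136 * t ^+ 5;
      - 2 + 5 * t + 61 * t ^+ 2 - 193 * t ^+ 3 + 121 * t ^+ 4 + 8 * t ^+ 5] i.

Lemma rho_ker t a : (a < 3)%N ->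
  rho a t (ker9 t 0) (ker9 t 1) (ker9 t 2) = if a == 2%N then 8 * lines9 t else 0.
Proof. by case: a => [|[|[|//]]] _; rewrite /rho /ker9 /lines9 /=; ring. Qed.

Lemma rho01_ker t g0 g1 g2 : rho 0 t g0 g1 g2 = 0 -> rho 1 t g0 g1 g2 = 0 ->
  [/\ g0 * ker9 t 1 = g1 * ker9 t 0, g0 * ker9 t 2 = g2 * ker9 t 0
    & g1 * ker9 t 2 = g2 * ker9 t 1].
Proof.
move=> h0 h1; split; apply/eqP; rewrite -subr_eq0; apply/eqP.
- transitivity ((2 - 9 * t + 19 * t ^+ 2) * rho 1 t g0 g1 g2 + (2 - t - 17 * t ^+ 2 + 16 * t
    ^+ 3) * rho 0 t g0 g1 g2).
    by rewrite /rho /ker9 /=; ring.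
  by rewrite h0 h1 !mulr0 addr0.
- transitivity ((1 + 3 * t - 13 * t ^+ 2) * rho 1 t g0 g1 g2 + (7 * t - 9 * t ^+ 2 - 16 * t ^+
    3) * rho 0 t g0 g1 g2).
    by rewrite /rho /ker9 /=; ring.
  by rewrite h0 h1 !mulr0 addr0.
- transitivity ((2 + 9 * t - 20 * t ^+ 2) * rho 1 t g0 g1 g2 + (2 + 3 * t + t ^+ 2 - 24 * t ^+
    3) * rho 0 t g0 g1 g2).
    by rewrite /rho /ker9 /=; ring.
  by rewrite h0 h1 !mulr0 addr0.
Qed.

Definition cubx (v : nat -> K) : K :=
  v 0%N * (v 2%N ^+ 2 - v 1%N ^+ 2) + 2 * v 1%N * (v 0%N ^+ 2 - v 2%N ^+ 2)
  + 3 * v 2%N * (v 1%N ^+ 2 - v 0%N ^+ 2).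

Definition cuby (v : nat -> K) : K :=
  6 * v 0%N * (v 2%N ^+ 2 - v 1%N ^+ 2) + 3 * v 1%N * (v 0%N ^+ 2 - v 2%N ^+ 2)
  + 2 * v 2%N * (v 1%N ^+ 2 - v 0%N ^+ 2).

Definition roots9 : seq K :=
  [:: - (1 / 2); 1 / 2; - 1; 1 / 3; 2; 0; 1; 1 / 4; - 2].

Lemma roots9_uniq : uniq roots9.
Proof.
have -> : roots9 = [seq z%:~R / 12 | z <- [:: - 6; 6; - 12; 4; 24; 0; 12; 3; - 24] : seq int].
  by rewrite /roots9 /=; do ![congr cons]; field.
rewrite map_inj_uniq // => z z' /(mulIf _) e; apply: (intr_inj (R := K)); apply: e.
by rewrite invr_eq0 pnatr_eq0.
Qed.

(** The three facts used at each root: [ker9] spans the kernel of [rho], the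
    discriminant of the corresponding section does not vanish at the ninth base
    point, and [p9 t] is not on the cubic of the pencil that contains the auxiliary
    point (2 : 1 : 0). *)
Lemma roots9P t : t \in roots9 ->
  [/\ lines9 t = 0, quad (ker9 t 0) (ker9 t 1) (ker9 t 2) != 0 & cuby (p9 t) != 0].
Proof.
rewrite /roots9 !inE.
do 8?[case/orP]; move/eqP ->.
- split; first by rewrite /lines9; field.
    have -> : quad (ker9 (- (1 / 2)) 0) (ker9 (- (1 / 2)) 1) (ker9 (- (1 / 2)) 2) =
        (81 * 75 * 25 * 41) / (128 * 2) by rewrite /quad /ker9 /=; field.
    by rewrite !(oppr_eq0, mulf_eq0, invr_eq0, pnatr_eq0, oner_eq0).
  have -> : cuby (p9 (- (1 / 2))) = (45) / (4) by rewrite /cuby /p9 /vec /=; field.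
  by rewrite !(oppr_eq0, mulf_eq0, invr_eq0, pnatr_eq0, oner_eq0).
- split; first by rewrite /lines9; field.
    have -> : quad (ker9 (1 / 2) 0) (ker9 (1 / 2) 1) (ker9 (1 / 2) 2) = (81 * 3) / (128 * 2)
        by rewrite /quad /ker9 /=; field.
    by rewrite !(oppr_eq0, mulf_eq0, invr_eq0, pnatr_eq0, oner_eq0).
  have -> : cuby (p9 (1 / 2)) = - ((9) / (4)) by rewrite /cuby /p9 /vec /=; field.
  by rewrite !(oppr_eq0, mulf_eq0, invr_eq0, pnatr_eq0, oner_eq0).
- split; first by rewrite /lines9; field.
    have -> : quad (ker9 (- 1) 0) (ker9 (- 1) 1) (ker9 (- 1) 2) = (108 * 75 * 125) / (1) by
        rewrite /quad /ker9 /=; field.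
    by rewrite !(oppr_eq0, mulf_eq0, invr_eq0, pnatr_eq0, oner_eq0).
  have -> : cuby (p9 (- 1)) = (30) / (1) by rewrite /cuby /p9 /vec /=; field.
  by rewrite !(oppr_eq0, mulf_eq0, invr_eq0, pnatr_eq0, oner_eq0).
- split; first by rewrite /lines9; field.
    have -> : quad (ker9 (1 / 3) 0) (ker9 (1 / 3) 1) (ker9 (1 / 3) 2) =
        - ((100 * 25 * 19) / (81 * 81 * 9)) by rewrite /quad /ker9 /=; field.
    by rewrite !(oppr_eq0, mulf_eq0, invr_eq0, pnatr_eq0, oner_eq0).
  have -> : cuby (p9 (1 / 3)) = (10) / (27) by rewrite /cuby /p9 /vec /=; field.
  by rewrite !(oppr_eq0, mulf_eq0, invr_eq0, pnatr_eq0, oner_eq0).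
- split; first by rewrite /lines9; field.
    have -> : quad (ker9 2 0) (ker9 2 1) (ker9 2 2) = - ((128 * 81 * 125 * 95) / (1)) by
        rewrite /quad /ker9 /=; field.
    by rewrite !(oppr_eq0, mulf_eq0, invr_eq0, pnatr_eq0, oner_eq0).
  have -> : cuby (p9 2) = - ((120) / (1)) by rewrite /cuby /p9 /vec /=; field.
  by rewrite !(oppr_eq0, mulf_eq0, invr_eq0, pnatr_eq0, oner_eq0).
- split; first by rewrite /lines9; field.
    have -> : quad (ker9 0 0) (ker9 0 1) (ker9 0 2) = - ((32) / (1)) by rewrite /quad /ker9
        /=; field.
    by rewrite !(oppr_eq0, mulf_eq0, invr_eq0, pnatr_eq0, oner_eq0).
  have -> : cuby (p9 0) = (4) / (1) by rewrite /cuby /p9 /vec /=; field.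
  by rewrite !(oppr_eq0, mulf_eq0, invr_eq0, pnatr_eq0, oner_eq0).
- split; first by rewrite /lines9; field.
    have -> : quad (ker9 1 0) (ker9 1 1) (ker9 1 2) = - ((192 * 81 * 9) / (1)) by rewrite
        /quad /ker9 /=; field.
    by rewrite !(oppr_eq0, mulf_eq0, invr_eq0, pnatr_eq0, oner_eq0).
  have -> : cuby (p9 1) = - ((18) / (1)) by rewrite /cuby /p9 /vec /=; field.
  by rewrite !(oppr_eq0, mulf_eq0, invr_eq0, pnatr_eq0, oner_eq0).
- split; first by rewrite /lines9; field.
    have -> : quad (ker9 (1 / 4) 0) (ker9 (1 / 4) 1) (ker9 (1 / 4) 2) =
        - ((81 * 45 * 25) / (128 * 128 * 4)) by rewrite /quad /ker9 /=; field.
    by rewrite !(oppr_eq0, mulf_eq0, invr_eq0, pnatr_eq0, oner_eq0).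
  have -> : cuby (p9 (1 / 4)) = (45) / (32) by rewrite /cuby /p9 /vec /=; field.
  by rewrite !(oppr_eq0, mulf_eq0, invr_eq0, pnatr_eq0, oner_eq0).
- split; first by rewrite /lines9; field.
    have -> : quad (ker9 (- 2) 0) (ker9 (- 2) 1) (ker9 (- 2) 2) = (128 * 128 * 72 * 81) / (1)
        by rewrite /quad /ker9 /=; field.
    by rewrite !(oppr_eq0, mulf_eq0, invr_eq0, pnatr_eq0, oner_eq0).
  have -> : cuby (p9 (- 2)) = (144) / (1) by rewrite /cuby /p9 /vec /=; field.
  by rewrite !(oppr_eq0, mulf_eq0, invr_eq0, pnatr_eq0, oner_eq0).
Qed.

End MovingPoint.

(** * Cubics through the eight special points *)

Section Cubics.
Variable K : numFieldType.
Implicit Types (c : nat -> nat -> nat -> K) (v : nat -> K).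

Lemma exponents3 : exponents 3 =
  [:: (0, 0, 3); (0, 1, 2); (0, 2, 1); (0, 3, 0); (1, 0, 2); (1, 1, 1); (1, 2, 0);
      (2, 0, 1); (2, 1, 0); (3, 0, 0)]%N.
Proof. by []. Qed.

(** Eight linear conditions on ten coefficients leave the pencil spanned by [cubx]
    and [cuby]. *)
Lemma cubics_through_base8 c : (forall i, (i < 8)%N -> form_val 3 c (base8 K i) = 0) ->
  exists a b, (forall v, form_val 3 c v = a * cubx v + b * cuby v) /\
    (a = 0 -> b = 0 -> forall m, m \in exponents 3 -> c m.1.1 m.1.2 m.2 = 0).
Proof.
rewrite /form_val exponents3 => h.
have [[e0 e1] [e2 e7]] := ((h 0%N isT, h 1%N isT), (h 2%N isT, h 7%N isT)).
have [[e3 e4] [e5 e6]] := ((h 3%N isT, h 4%N isT), (h 5%N isT, h 6%N isT)).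
rewrite !big_cons !big_nil /base8 /vec /= in e0 e1 e2 e3 e4 e5 e6 e7.
have z300 : c 3%N 0%N 0%N = 0.
  by apply: (eq_lincomb (1 *z e0)); field.
have z030 : c 0%N 3%N 0%N = 0.
  by apply: (eq_lincomb (1 *z e1)); field.
have z003 : c 0%N 0%N 3%N = 0.
  by apply: (eq_lincomb (1 *z e2)); field.
rewrite z300 z030 z003 in e3 e4 e5 e6 e7.
have z012 : c 0%N 1%N 2%N = - c 2%N 1%N 0%N.
  by apply: (eq_lincomb ((1 / 4) *z e3 +z (1 / 4) *z e4 +z (- (1 / 4)) *z e5 +z (1 / 4) *z
      e6)); field.
have z111 : c 1%N 1%N 1%N = 0.
  by apply: (eq_lincomb ((1 / 4) *z e3 +z (- (1 / 4)) *z e4 +z (- (1 / 4)) *z e5 +z (- (1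
      / 4)) *z e6)); field.
have z120 : c 1%N 2%N 0%N = - c 1%N 0%N 2%N.
  by apply: (eq_lincomb ((1 / 4) *z e3 +z (1 / 4) *z e4 +z (1 / 4) *z e5 +z (- (1 / 4)) *z
      e6)); field.
have z201 : c 2%N 0%N 1%N = - c 0%N 2%N 1%N.
  by apply: (eq_lincomb ((1 / 4) *z e3 +z (- (1 / 4)) *z e4 +z (1 / 4) *z e5 +z (1 / 4) *z
      e6)); field.
rewrite z012 z111 z120 z201 in e7.
have zc : c 0%N 2%N 1%N = (16 * c 2%N 1%N 0%N - 5 * c 1%N 0%N 2%N) / 9.
  by apply: (eq_lincomb ((1 / 9) *z e7)); field.
exists ((2 * c 2%N 1%N 0%N - c 1%N 0%N 2%N) / 3), ((2 * c 1%N 0%N 2%N - c 2%N 1%N 0%N) / 9).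
split=> [v|a0 b0].
  by rewrite !big_cons big_nil /= z003 z012 z030 z111 z120 z201 z300 zc /cubx /cuby; field.
have za : c 1%N 0%N 2%N = 0 by apply: (eq_lincomb (1 *z a0 +z 6 *z b0)); field.
have zb : c 2%N 1%N 0%N = 0 by apply: (eq_lincomb (2 *z a0 +z 3 *z b0)); field.
suff /allP h0 : all (fun m => c m.1.1 m.1.2 m.2 == 0) (exponents 3).
  by move=> m; rewrite -exponents3 => /h0 /eqP.
by rewrite exponents3 /= z003 z012 z030 z111 z120 z201 z300 zc za zb !(mulr0, subr0, mul0r,
    oppr0) eqxx.
Qed.

End Cubics.

(** * Nine points for which R does not vanish *)

Section Sextics.
Variable K : numFieldType.
Implicit Types (c : nat -> nat -> nat -> K).

Lemma exponents6 : exponents 6 =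
  [:: (0, 0, 6); (0, 1, 5); (0, 2, 4); (0, 3, 3); (0, 4, 2); (0, 5, 1); (0, 6, 0); (1, 0, 5);
    (1, 1, 4); (1, 2, 3); (1, 3, 2); (1, 4, 1); (1, 5, 0); (2, 0, 4); (2, 1, 3); (2, 2, 2);
    (2, 3, 1); (2, 4, 0); (3, 0, 3); (3, 1, 2); (3, 2, 1); (3, 3, 0); (4, 0, 2); (4, 1, 1);
    (4, 2, 0); (5, 0, 1); (5, 1, 0); (6, 0, 0)]%N.
Proof. by []. Qed.

Definition double_pts (i : nat) : nat -> K := nth (vec 0 0 0)
  [:: vec 1 0 0; vec 0 1 0; vec 0 0 1;
      vec 1 1 1; vec 1 1 (-1); vec 1 (-1) 1; vec (-1) 1 1; vec 0 2 1; vec 1 2 0] i.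

(** Solving the 28 equations for the 28 coefficients: the first seven points leave a
    space of dimension 7, on which the last two points and the value at (1 : 1 : 0)
    are independent. *)
Lemma sextic_double_pts_eq0 c :
  (forall i l, (i < 9)%N -> (l < 3)%N -> form_deriv_val 6 c l (double_pts i) = 0) ->
  form_val 6 c (vec 1 1 0) = 0 -> forall m, m \in exponents 6 -> c m.1.1 m.1.2 m.2 = 0.
Proof.
move=> h h9.
have z600 : c 6%N 0%N 0%N = 0.
  apply: (eq_lincomb ((1 / 6) *z h 0%N 0%N isT isT)).
  by rewrite /form_deriv_val exponents6 !big_cons !big_nil /double_pts /vec /=; field.
have z510 : c 5%N 1%N 0%N = 0.
  apply: (eq_lincomb (1 *z h 0%N 1%N isT isT)).
  by rewrite /form_deriv_val exponents6 !big_cons !big_nil /double_pts /vec /=; field.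
have z501 : c 5%N 0%N 1%N = 0.
  apply: (eq_lincomb (1 *z h 0%N 2%N isT isT)).
  by rewrite /form_deriv_val exponents6 !big_cons !big_nil /double_pts /vec /=; field.
have z150 : c 1%N 5%N 0%N = 0.
  apply: (eq_lincomb (1 *z h 1%N 0%N isT isT)).
  by rewrite /form_deriv_val exponents6 !big_cons !big_nil /double_pts /vec /=; field.
have z060 : c 0%N 6%N 0%N = 0.
  apply: (eq_lincomb ((1 / 6) *z h 1%N 1%N isT isT)).
  by rewrite /form_deriv_val exponents6 !big_cons !big_nil /double_pts /vec /=; field.
have z051 : c 0%N 5%N 1%N = 0.
  apply: (eq_lincomb (1 *z h 1%N 2%N isT isT)).
  by rewrite /form_deriv_val exponents6 !big_cons !big_nil /double_pts /vec /=; field.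
have z105 : c 1%N 0%N 5%N = 0.
  apply: (eq_lincomb (1 *z h 2%N 0%N isT isT)).
  by rewrite /form_deriv_val exponents6 !big_cons !big_nil /double_pts /vec /=; field.
have z015 : c 0%N 1%N 5%N = 0.
  apply: (eq_lincomb (1 *z h 2%N 1%N isT isT)).
  by rewrite /form_deriv_val exponents6 !big_cons !big_nil /double_pts /vec /=; field.
have z006 : c 0%N 0%N 6%N = 0.
  apply: (eq_lincomb ((1 / 6) *z h 2%N 2%N isT isT)).
  by rewrite /form_deriv_val exponents6 !big_cons !big_nil /double_pts /vec /=; field.
have e30 : c 1%N 1%N 4%N + c 1%N 2%N 3%N + c 1%N 3%N 2%N + c 1%N 4%N 1%N + 2 * c 2%N 0%N
    4%N + 2 * c 2%N 1%N 3%N + 2 * c 2%N 2%N 2%N + 2 * c 2%N 3%N 1%N + 2 * c 2%N 4%N 0%N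
    + 3 * c 3%N 0%N 3%N + 3 * c 3%N 1%N 2%N + 3 * c 3%N 2%N 1%N + 3 * c 3%N 3%N 0%N + 4
    * c 4%N 0%N 2%N + 4 * c 4%N 1%N 1%N + 4 * c 4%N 2%N 0%N = 0.
  by rewrite -(h 3%N 0%N isT isT) /form_deriv_val exponents6 !big_cons !big_nil /double_pts
      /vec /=
    z600 z510 z501 z150 z060 z051 z105 z015 z006; ring.
have e31 : 2 * c 0%N 2%N 4%N + 3 * c 0%N 3%N 3%N + 4 * c 0%N 4%N 2%N + c 1%N 1%N 4%N + 2
    * c 1%N 2%N 3%N + 3 * c 1%N 3%N 2%N + 4 * c 1%N 4%N 1%N + c 2%N 1%N 3%N + 2 * c 2%N
    2%N 2%N + 3 * c 2%N 3%N 1%N + 4 * c 2%N 4%N 0%N + c 3%N 1%N 2%N + 2 * c 3%N 2%N 1%N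
    + 3 * c 3%N 3%N 0%N + c 4%N 1%N 1%N + 2 * c 4%N 2%N 0%N = 0.
  by rewrite -(h 3%N 1%N isT isT) /form_deriv_val exponents6 !big_cons !big_nil /double_pts
      /vec /=
    z600 z510 z501 z150 z060 z051 z105 z015 z006; ring.
have e32 : 4 * c 0%N 2%N 4%N + 3 * c 0%N 3%N 3%N + 2 * c 0%N 4%N 2%N + 4 * c 1%N 1%N 4%N
    + 3 * c 1%N 2%N 3%N + 2 * c 1%N 3%N 2%N + c 1%N 4%N 1%N + 4 * c 2%N 0%N 4%N + 3 * c
    2%N 1%N 3%N + 2 * c 2%N 2%N 2%N + c 2%N 3%N 1%N + 3 * c 3%N 0%N 3%N + 2 * c 3%N 1%N
    2%N + c 3%N 2%N 1%N + 2 * c 4%N 0%N 2%N + c 4%N 1%N 1%N = 0.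
  by rewrite -(h 3%N 2%N isT isT) /form_deriv_val exponents6 !big_cons !big_nil /double_pts
      /vec /=
    z600 z510 z501 z150 z060 z051 z105 z015 z006; ring.
have e40 : c 1%N 1%N 4%N - c 1%N 2%N 3%N + c 1%N 3%N 2%N - c 1%N 4%N 1%N + 2 * c 2%N 0%N
    4%N - 2 * c 2%N 1%N 3%N + 2 * c 2%N 2%N 2%N - 2 * c 2%N 3%N 1%N + 2 * c 2%N 4%N 0%N
    - 3 * c 3%N 0%N 3%N + 3 * c 3%N 1%N 2%N - 3 * c 3%N 2%N 1%N + 3 * c 3%N 3%N 0%N + 4
    * c 4%N 0%N 2%N - 4 * c 4%N 1%N 1%N + 4 * c 4%N 2%N 0%N = 0.
  by rewrite -(h 4%N 0%N isT isT) /form_deriv_val exponents6 !big_cons !big_nil /double_pts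
      /vec /=
    z600 z510 z501 z150 z060 z051 z105 z015 z006; ring.
have e41 : 2 * c 0%N 2%N 4%N - 3 * c 0%N 3%N 3%N + 4 * c 0%N 4%N 2%N + c 1%N 1%N 4%N - 2
    * c 1%N 2%N 3%N + 3 * c 1%N 3%N 2%N - 4 * c 1%N 4%N 1%N - c 2%N 1%N 3%N + 2 * c 2%N
    2%N 2%N - 3 * c 2%N 3%N 1%N + 4 * c 2%N 4%N 0%N + c 3%N 1%N 2%N - 2 * c 3%N 2%N 1%N
    + 3 * c 3%N 3%N 0%N - c 4%N 1%N 1%N + 2 * c 4%N 2%N 0%N = 0.
  by rewrite -(h 4%N 1%N isT isT) /form_deriv_val exponents6 !big_cons !big_nil /double_pts
      /vec /=
    z600 z510 z501 z150 z060 z051 z105 z015 z006; ring.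
have e42 : - 4 * c 0%N 2%N 4%N + 3 * c 0%N 3%N 3%N - 2 * c 0%N 4%N 2%N - 4 * c 1%N 1%N
    4%N + 3 * c 1%N 2%N 3%N - 2 * c 1%N 3%N 2%N + c 1%N 4%N 1%N - 4 * c 2%N 0%N 4%N + 3
    * c 2%N 1%N 3%N - 2 * c 2%N 2%N 2%N + c 2%N 3%N 1%N + 3 * c 3%N 0%N 3%N - 2 * c 3%N
    1%N 2%N + c 3%N 2%N 1%N - 2 * c 4%N 0%N 2%N + c 4%N 1%N 1%N = 0.
  by rewrite -(h 4%N 2%N isT isT) /form_deriv_val exponents6 !big_cons !big_nil /double_pts
      /vec /=
    z600 z510 z501 z150 z060 z051 z105 z015 z006; ring.
have e50 : - c 1%N 1%N 4%N + c 1%N 2%N 3%N - c 1%N 3%N 2%N + c 1%N 4%N 1%N + 2 * c 2%N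
    0%N 4%N - 2 * c 2%N 1%N 3%N + 2 * c 2%N 2%N 2%N - 2 * c 2%N 3%N 1%N + 2 * c 2%N 4%N
    0%N + 3 * c 3%N 0%N 3%N - 3 * c 3%N 1%N 2%N + 3 * c 3%N 2%N 1%N - 3 * c 3%N 3%N 0%N
    + 4 * c 4%N 0%N 2%N - 4 * c 4%N 1%N 1%N + 4 * c 4%N 2%N 0%N = 0.
  by rewrite -(h 5%N 0%N isT isT) /form_deriv_val exponents6 !big_cons !big_nil /double_pts
      /vec /=
    z600 z510 z501 z150 z060 z051 z105 z015 z006; ring.
have e51 : - 2 * c 0%N 2%N 4%N + 3 * c 0%N 3%N 3%N - 4 * c 0%N 4%N 2%N + c 1%N 1%N 4%N -
    2 * c 1%N 2%N 3%N + 3 * c 1%N 3%N 2%N - 4 * c 1%N 4%N 1%N + c 2%N 1%N 3%N - 2 * c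
    2%N 2%N 2%N + 3 * c 2%N 3%N 1%N - 4 * c 2%N 4%N 0%N + c 3%N 1%N 2%N - 2 * c 3%N 2%N
    1%N + 3 * c 3%N 3%N 0%N + c 4%N 1%N 1%N - 2 * c 4%N 2%N 0%N = 0.
  by rewrite -(h 5%N 1%N isT isT) /form_deriv_val exponents6 !big_cons !big_nil /double_pts
      /vec /=
    z600 z510 z501 z150 z060 z051 z105 z015 z006; ring.
have e52 : 4 * c 0%N 2%N 4%N - 3 * c 0%N 3%N 3%N + 2 * c 0%N 4%N 2%N - 4 * c 1%N 1%N 4%N
    + 3 * c 1%N 2%N 3%N - 2 * c 1%N 3%N 2%N + c 1%N 4%N 1%N + 4 * c 2%N 0%N 4%N - 3 * c
    2%N 1%N 3%N + 2 * c 2%N 2%N 2%N - c 2%N 3%N 1%N + 3 * c 3%N 0%N 3%N - 2 * c 3%N 1%N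
    2%N + c 3%N 2%N 1%N + 2 * c 4%N 0%N 2%N - c 4%N 1%N 1%N = 0.
  by rewrite -(h 5%N 2%N isT isT) /form_deriv_val exponents6 !big_cons !big_nil /double_pts
      /vec /=
    z600 z510 z501 z150 z060 z051 z105 z015 z006; ring.
have e60 : c 1%N 1%N 4%N + c 1%N 2%N 3%N + c 1%N 3%N 2%N + c 1%N 4%N 1%N - 2 * c 2%N 0%N
    4%N - 2 * c 2%N 1%N 3%N - 2 * c 2%N 2%N 2%N - 2 * c 2%N 3%N 1%N - 2 * c 2%N 4%N 0%N
    + 3 * c 3%N 0%N 3%N + 3 * c 3%N 1%N 2%N + 3 * c 3%N 2%N 1%N + 3 * c 3%N 3%N 0%N - 4
    * c 4%N 0%N 2%N - 4 * c 4%N 1%N 1%N - 4 * c 4%N 2%N 0%N = 0.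
  by rewrite -(h 6%N 0%N isT isT) /form_deriv_val exponents6 !big_cons !big_nil /double_pts
      /vec /=
    z600 z510 z501 z150 z060 z051 z105 z015 z006; ring.
have e61 : 2 * c 0%N 2%N 4%N + 3 * c 0%N 3%N 3%N + 4 * c 0%N 4%N 2%N - c 1%N 1%N 4%N - 2
    * c 1%N 2%N 3%N - 3 * c 1%N 3%N 2%N - 4 * c 1%N 4%N 1%N + c 2%N 1%N 3%N + 2 * c 2%N
    2%N 2%N + 3 * c 2%N 3%N 1%N + 4 * c 2%N 4%N 0%N - c 3%N 1%N 2%N - 2 * c 3%N 2%N 1%N
    - 3 * c 3%N 3%N 0%N + c 4%N 1%N 1%N + 2 * c 4%N 2%N 0%N = 0.
  by rewrite -(h 6%N 1%N isT isT) /form_deriv_val exponents6 !big_cons !big_nil /double_pts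
      /vec /=
    z600 z510 z501 z150 z060 z051 z105 z015 z006; ring.
have e62 : 4 * c 0%N 2%N 4%N + 3 * c 0%N 3%N 3%N + 2 * c 0%N 4%N 2%N - 4 * c 1%N 1%N 4%N
    - 3 * c 1%N 2%N 3%N - 2 * c 1%N 3%N 2%N - c 1%N 4%N 1%N + 4 * c 2%N 0%N 4%N + 3 * c
    2%N 1%N 3%N + 2 * c 2%N 2%N 2%N + c 2%N 3%N 1%N - 3 * c 3%N 0%N 3%N - 2 * c 3%N 1%N
    2%N - c 3%N 2%N 1%N + 2 * c 4%N 0%N 2%N + c 4%N 1%N 1%N = 0.
  by rewrite -(h 6%N 2%N isT isT) /form_deriv_val exponents6 !big_cons !big_nil /double_pts
      /vec /=
    z600 z510 z501 z150 z060 z051 z105 z015 z006; ring.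
have z132 : c 1%N 3%N 2%N = - c 1%N 1%N 4%N.
  by apply: (eq_lincomb ((- (1 / 16)) *z e30 +z (1 / 16) *z e31 +z (1 / 16) *z e32 +z (-
      (1 / 16)) *z e40 +z (1 / 16) *z e41 +z (- (1 / 16)) *z e42 +z (1 / 16) *z e50 +z (1
      / 16) *z e51 +z (- (1 / 16)) *z e52 +z (- (1 / 16)) *z e60 +z (- (1 / 16)) *z e61 +z
      (- (1 / 16)) *z e62)); field.
have z141 : c 1%N 4%N 1%N = - c 1%N 2%N 3%N.
  by apply: (eq_lincomb ((- (1 / 16)) *z e30 +z (1 / 16) *z e31 +z (1 / 16) *z e32 +z (1 /
      16) *z e40 +z (- (1 / 16)) *z e41 +z (1 / 16) *z e42 +z (- (1 / 16)) *z e50 +z (- (1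
      / 16)) *z e51 +z (1 / 16) *z e52 +z (- (1 / 16)) *z e60 +z (- (1 / 16)) *z e61 +z (-
      (1 / 16)) *z e62)); field.
have z213 : c 2%N 1%N 3%N = - c 0%N 3%N 3%N.
  by apply: (eq_lincomb ((- (1 / 48)) *z e30 +z (- (1 / 48)) *z e31 +z (5 / 48) *z e32 +z
      (1 / 48) *z e40 +z (1 / 48) *z e41 +z (5 / 48) *z e42 +z (1 / 48) *z e50 +z (- (1 /
      48)) *z e51 +z (- (5 / 48)) *z e52 +z (1 / 48) *z e60 +z (- (1 / 48)) *z e61 +z (5 /
      48) *z e62)); field.
have z222 : c 2%N 2%N 2%N = - 2 * c 0%N 2%N 4%N - 2 * c 0%N 4%N 2%N - c 2%N 0%N 4%N - c
    2%N 4%N 0%N.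
by apply: (eq_lincomb ((- (1 / 24)) *z e30 +z (1 / 12) *z e31 +z (1 / 12) *z e32 +z (-
    (1 / 24)) *z e40 +z (1 / 12) *z e41 +z (- (1 / 12)) *z e42 +z (- (1 / 24)) *z e50 +z
    (- (1 / 12)) *z e51 +z (1 / 12) *z e52 +z (1 / 24) *z e60 +z (1 / 12) *z e61 +z (1 /
    12) *z e62)); field.
have z231 : c 2%N 3%N 1%N = - c 0%N 3%N 3%N.
  by apply: (eq_lincomb ((- (1 / 48)) *z e30 +z (5 / 48) *z e31 +z (- (1 / 48)) *z e32 +z
      (1 / 48) *z e40 +z (- (5 / 48)) *z e41 +z (- (1 / 48)) *z e42 +z (1 / 48) *z e50 +z
      (5 / 48) *z e51 +z (1 / 48) *z e52 +z (1 / 48) *z e60 +z (5 / 48) *z e61 +z (- (1 /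
      48)) *z e62)); field.
have z303 : c 3%N 0%N 3%N = - c 1%N 2%N 3%N.
  by apply: (eq_lincomb ((- (1 / 48)) *z e30 +z (- (1 / 48)) *z e31 +z (5 / 48) *z e32 +z
      (1 / 48) *z e40 +z (1 / 48) *z e41 +z (5 / 48) *z e42 +z (- (1 / 48)) *z e50 +z (1 /
      48) *z e51 +z (5 / 48) *z e52 +z (- (1 / 48)) *z e60 +z (1 / 48) *z e61 +z (- (5 /
      48)) *z e62)); field.
have z312 : c 3%N 1%N 2%N = - c 1%N 1%N 4%N.
  by apply: (eq_lincomb ((1 / 16) *z e30 +z (- (1 / 16)) *z e31 +z (1 / 16) *z e32 +z (1 /
      16) *z e40 +z (- (1 / 16)) *z e41 +z (- (1 / 16)) *z e42 +z (- (1 / 16)) *z e50 +z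
      (- (1 / 16)) *z e51 +z (- (1 / 16)) *z e52 +z (1 / 16) *z e60 +z (1 / 16) *z e61 +z
      (- (1 / 16)) *z e62)); field.
have z321 : c 3%N 2%N 1%N = c 1%N 2%N 3%N.
  by apply: (eq_lincomb ((1 / 8) *z e30 +z (- (1 / 8)) *z e32 +z (- (1 / 8)) *z e40 +z (-
      (1 / 8)) *z e42 +z (1 / 8) *z e50 +z (- (1 / 8)) *z e52 +z (1 / 8) *z e60 +z (1 / 8)
      *z e62)); field.
have z330 : c 3%N 3%N 0%N = c 1%N 1%N 4%N.
  by apply: (eq_lincomb ((1 / 24) *z e30 +z (1 / 24) *z e31 +z (- (1 / 12)) *z e32 +z (1 /
      24) *z e40 +z (1 / 24) *z e41 +z (1 / 12) *z e42 +z (- (1 / 24)) *z e50 +z (1 / 24)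
      *z e51 +z (1 / 12) *z e52 +z (1 / 24) *z e60 +z (- (1 / 24)) *z e61 +z (1 / 12) *z
      e62)); field.
have z402 : c 4%N 0%N 2%N = c 0%N 4%N 2%N - c 2%N 0%N 4%N + c 2%N 4%N 0%N.
  by apply: (eq_lincomb ((1 / 24) *z e30 +z (- (1 / 12)) *z e31 +z (1 / 24) *z e32 +z (1 /
      24) *z e40 +z (- (1 / 12)) *z e41 +z (- (1 / 24)) *z e42 +z (1 / 24) *z e50 +z (1 /
      12) *z e51 +z (1 / 24) *z e52 +z (- (1 / 24)) *z e60 +z (- (1 / 12)) *z e61 +z (1 /
      24) *z e62)); field.
have z411 : c 4%N 1%N 1%N = c 0%N 3%N 3%N.
  by apply: (eq_lincomb ((1 / 12) *z e30 +z (- (1 / 24)) *z e31 +z (- (1 / 24)) *z e32 +z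
      (- (1 / 12)) *z e40 +z (1 / 24) *z e41 +z (- (1 / 24)) *z e42 +z (- (1 / 12)) *z e50
      +z (- (1 / 24)) *z e51 +z (1 / 24) *z e52 +z (- (1 / 12)) *z e60 +z (- (1 / 24)) *z
      e61 +z (- (1 / 24)) *z e62)); field.
have z420 : c 4%N 2%N 0%N = c 0%N 2%N 4%N + c 2%N 0%N 4%N - c 2%N 4%N 0%N.
  by apply: (eq_lincomb ((1 / 24) *z e30 +z (1 / 24) *z e31 +z (- (1 / 12)) *z e32 +z (1 /
      24) *z e40 +z (1 / 24) *z e41 +z (1 / 12) *z e42 +z (1 / 24) *z e50 +z (- (1 / 24))
      *z e51 +z (- (1 / 12)) *z e52 +z (- (1 / 24)) *z e60 +z (1 / 24) *z e61 +z (- (1 /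
      12)) *z e62)); field.
have e70 : - 6 * c 1%N 1%N 4%N - 12 * c 1%N 2%N 3%N = 0.
  by rewrite -(h 7%N 0%N isT isT) /form_deriv_val exponents6 !big_cons !big_nil /double_pts
      /vec /=
      z006 z015 z051 z060 z105 z132 z141 z150 z213 z222 z231 z303 z312 z321 z330 z402 z411
      z420 z501 z510 z600; field.
have e71 : 4 * c 0%N 2%N 4%N + 32 * c 0%N 4%N 2%N + 12 * c 0%N 3%N 3%N = 0.
  by rewrite -(h 7%N 1%N isT isT) /form_deriv_val exponents6 !big_cons !big_nil /double_pts
      /vec /=
      z006 z015 z051 z060 z105 z132 z141 z150 z213 z222 z231 z303 z312 z321 z330 z402 z411
      z420 z501 z510 z600; field.
have e72 : 16 * c 0%N 2%N 4%N + 32 * c 0%N 4%N 2%N + 24 * c 0%N 3%N 3%N = 0.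
  by rewrite -(h 7%N 2%N isT isT) /form_deriv_val exponents6 !big_cons !big_nil /double_pts
      /vec /=
      z006 z015 z051 z060 z105 z132 z141 z150 z213 z222 z231 z303 z312 z321 z330 z402 z411
      z420 z501 z510 z600; field.
have e80 : 16 * c 0%N 2%N 4%N + 16 * c 2%N 0%N 4%N + 16 * c 2%N 4%N 0%N + 24 * c 1%N 1%N
    4%N = 0.
  by rewrite -(h 8%N 0%N isT isT) /form_deriv_val exponents6 !big_cons !big_nil /double_pts
      /vec /=
      z006 z015 z051 z060 z105 z132 z141 z150 z213 z222 z231 z303 z312 z321 z330 z402 z411
      z420 z501 z510 z600; field.
have e81 : 4 * c 0%N 2%N 4%N + 4 * c 2%N 0%N 4%N + 28 * c 2%N 4%N 0%N + 12 * c 1%N 1%N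
    4%N = 0.
  by rewrite -(h 8%N 1%N isT isT) /form_deriv_val exponents6 !big_cons !big_nil /double_pts
      /vec /=
      z006 z015 z051 z060 z105 z132 z141 z150 z213 z222 z231 z303 z312 z321 z330 z402 z411
      z420 z501 z510 z600; field.
have e82 : - 6 * c 0%N 3%N 3%N - 12 * c 1%N 2%N 3%N = 0.
  by rewrite -(h 8%N 2%N isT isT) /form_deriv_val exponents6 !big_cons !big_nil /double_pts
      /vec /=
      z006 z015 z051 z060 z105 z132 z141 z150 z213 z222 z231 z303 z312 z321 z330 z402 z411
      z420 z501 z510 z600; field.
have e9 : c 0%N 2%N 4%N + c 2%N 0%N 4%N + c 1%N 1%N 4%N = 0.
  by rewrite -h9 /form_val exponents6 !big_cons big_nil /vec /= z006 z015 z051 z060 z105 z132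
      z141
      z150 z213 z222 z231 z303 z312 z321 z330 z402 z411 z420 z501 z510 z600; field.
have z024 : c 0%N 2%N 4%N = 0.
  by apply: (eq_lincomb ((- (1 / 6)) *z e70 +z (- (1 / 12)) *z e71 +z (1 / 12) *z e72 +z
      (- (7 / 24)) *z e80 +z (1 / 6) *z e81 +z (1 / 6) *z e82 +z 4 *z e9)); field.
have z042 : c 0%N 4%N 2%N = 0.
  by apply: (eq_lincomb ((- (1 / 24)) *z e70 +z (1 / 24) *z e71 +z (- (1 / 96)) *z e72 +z
      (- (7 / 96)) *z e80 +z (1 / 24) *z e81 +z (1 / 24) *z e82 +z 1 *z e9)); field.
have z204 : c 2%N 0%N 4%N = 0.
  by apply: (eq_lincomb ((1 / 6) *z e70 +z (1 / 12) *z e71 +z (- (1 / 12)) *z e72 +z (- (1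
      / 6)) *z e82 +z 1 *z e9)); field.
have z240 : c 2%N 4%N 0%N = 0.
  by apply: (eq_lincomb ((- (1 / 12)) *z e80 +z (1 / 12) *z e81 +z 1 *z e9)); field.
have z033 : c 0%N 3%N 3%N = 0.
  by apply: (eq_lincomb ((1 / 6) *z e70 +z (7 / 24) *z e80 +z (- (1 / 6)) *z e81 +z (- (1
      / 6)) *z e82 +z (- 4) *z e9)); field.
have z114 : c 1%N 1%N 4%N = 0.
  by apply: (eq_lincomb ((7 / 24) *z e80 +z (- (1 / 6)) *z e81 +z (- 4) *z e9)); field.
have z123 : c 1%N 2%N 3%N = 0.
  by apply: (eq_lincomb ((- (1 / 12)) *z e70 +z (- (7 / 48)) *z e80 +z (1 / 12) *z e81 +z
      2 *z e9)); field.
suff /allP h0 : all (fun m => c m.1.1 m.1.2 m.2 == 0) (exponents 6).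
  by move=> m /h0 /eqP.
by rewrite exponents6 /= z006 z015 z051 z060 z105 z132 z141 z150 z213 z222 z231 z303 z312 z321
    z330 z402 z411 z420 z501 z510 z600 z024 z042 z204 z240 z033 z114 z123 !(mulr0, addr0,
    subr0, mul0r, oppr0) eqxx.
Qed.

End Sextics.

(** * The determinant along the example line *)

Notation last9 := (ord_max : 'I_9).

Section Agree.
Variable A : comNzRingType.
Implicit Types (v u w x y : nat -> A).

(** Only the first three entries of a vector indexed by [nat] matter. *)
Definition agree v v' := forall k, (k < 3)%N -> v k = v' k.

Lemma agree_cross v v' u u' : agree v v' -> agree u u' -> cross v u =1 cross v' u'.
Proof. by move=> e1 e2 [|[|k]]; rewrite /cross !e1 ?e2. Qed.

Lemma agree_vol v v' u u' w w' : agree v v' -> agree u u' -> agree w w' ->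
  vol v u w = vol v' u' w'.
Proof. by move=> e1 e2 e3; rewrite /vol !(agree_cross e2 e3) !e1. Qed.

Lemma agree_mon_val j v v' x x' y y' : agree v v' -> x =1 x' -> y =1 y' ->
  mon_val j v x y = mon_val j v' x' y'.
Proof.
move=> e1 e2 e3; move: (sec_monP j); rewrite /mon_val; case: (sec_mon j) => [[k l] [m n]].
by case/and4P=> k3 l3 _ _; rewrite !e1 // !e2 !e3.
Qed.

Lemma agree_sec_val s v v' x x' y y' : agree v v' -> x =1 x' -> y =1 y' ->
  sec_val s v x y = sec_val s v' x' y'.
Proof. by move=> e1 e2 e3; apply: eq_bigr => j _; rewrite (agree_mon_val j e1 e2 e3). Qed.

Lemma agree_disc_val s v v' : agree v v' -> disc_val s v = disc_val s v'.
Proof.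
move=> e; have es a b := agree_sec_val s e (frefl (std A a)) (frefl (std A b)).
by rewrite /disc_val !es !e.
Qed.

End Agree.

Section ExampleMatrices.
Variable K : numClosedFieldType.
Implicit Types (t : K) (c : nat -> K).

Definition exP : 'M[K]_(8, 3) := \matrix_(i, j) base8 K i j.
Definition exU : 'M[K]_(8, 3) := \matrix_(i, j) frame8_u K i j.
Definition exW : 'M[K]_(9, 3) := \matrix_(i, j) (if (i < 8)%N then frame8_w K i else w9 K) j.
Definition exa : 'rV[K]_3 := \row_j vec 1 0 1 j.
Definition exb : 'rV[K]_3 := \row_j u9 K j.
Definition ex_pts t : 'M[K]_(9, 3) := at_line exP exa exb t.
Definition ex_u : 'M[K]_(9, 3) := line_frame exU exb.

Definition row8 (i : 'I_8) : 'I_9 := (lshift 1 i : 'I_(8 + 1)).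

Lemma ord9_ind (Q : 'I_9 -> Prop) : (forall i, Q (row8 i)) -> Q ord_max -> forall i, Q i.
Proof.
move=> h m i; case: (@split_ordP 8 1 i) => {}i ->; first exact: h.
by have <- : ord_max = rshift 8 i :> 'I_9 by apply: val_inj; rewrite /= (ord1 i).
Qed.

Lemma ex_pts_row8 t i : agree (pts (ex_pts t) (row8 i)) (base8 K i).
Proof. by move=> k k3; rewrite /pts /crd mxE (@col_mxEu _ 8 1) mxE inordK. Qed.

Lemma ord_max9 : ord_max = rshift 8 (0 : 'I_1) :> 'I_9.
Proof. exact: val_inj. Qed.

Lemma ex_pts_last t : agree (pts (ex_pts t) ord_max) (p9 t).
Proof.
move=> k k3; rewrite /pts /crd mxE ord_max9 (@col_mxEd _ 8 1) !mxE !inordK //.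
by case: k k3 => [|[|[|//]]] _; rewrite /p9 /u9 /vec /=; ring.
Qed.

Lemma ex_u_row8 i : agree (pts ex_u (row8 i)) (frame8_u K i).
Proof. by move=> k k3; rewrite /pts /crd mxE (@col_mxEu _ 8 1) mxE inordK. Qed.

Lemma ex_u_last : agree (pts ex_u ord_max) (u9 K).
Proof. by move=> k k3; rewrite /pts /crd mxE ord_max9 (@col_mxEd _ 8 1) !mxE !inordK. Qed.

Lemma exW_row8 i : agree (pts exW (row8 i)) (frame8_w K i).
Proof. by move=> k k3; rewrite /pts /crd !mxE /= ltn_ord inordK. Qed.

Lemma exW_last : agree (pts exW ord_max) (w9 K).
Proof. by move=> k k3; rewrite /pts /crd !mxE /= inordK. Qed.

Lemma example_frame i : vol (pts (ex_pts 0) i) (pts ex_u i) (pts exW i) != 0.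
Proof.
move: i; apply: ord9_ind => [i|].
  rewrite (agree_vol (ex_pts_row8 0 i) (ex_u_row8 i) (exW_row8 i)).
  by case: i => [[|[|[|[|[|[|[|[|//]]]]]]]] ?];
    rewrite /vol /cross /base8 /frame8_u /frame8_w /vec /=
      !(mul0r, mulr0, mul1r, mulr1, subr0, sub0r, add0r, addr0, oppr0, mulrN, mulNr, opprK)
      ?oppr_eq0 ?oner_eq0 ?pnatr_eq0.
rewrite (agree_vol (ex_pts_last 0) ex_u_last exW_last).
have -> : vol (p9 (0 : K)) (u9 K) (w9 K) = 2 by rewrite /vol /cross /p9 /u9 /w9 /vec /=; ring.
by rewrite pnatr_eq0.
Qed.

Definition ex_mx t : 'M[K]_27 := frame_mx (pts (ex_pts t)) (pts ex_u) (pts exW).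

Definition sec8_col g0 g1 g2 : 'cV[K]_27 := \col_j sec8 g0 g1 g2 j.

Lemma ex_mx_row8 t (s : 'cV[K]_27) (i : 'I_8) (a : 'I_3) :
  (ex_mx t *m s) (mxvec_index (row8 i) a) 0 = val8 (fun j => s (inord j) 0) i a.
Proof.
rewrite /ex_mx frame_mx_mulE /val8.
transitivity (sec_val (s^~ 0) (base8 K i)
   (cross (base8 K i) (if a == 2%N :> nat then frame8_w K i else frame8_u K i))
   (cross (base8 K i) (if a == 0%N :> nat then frame8_u K i else frame8_w K i))); last first.
  by apply: eq_bigr => j _; rewrite inord_val.
apply: agree_sec_val; first exact: ex_pts_row8.
  by case: ifP => _; apply: agree_cross; auto using ex_pts_row8, ex_u_row8, exW_row8.
by case: ifP => _; apply: agree_cross; auto using ex_pts_row8, ex_u_row8, exW_row8.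
Qed.

Lemma ex_mx_last t (s : 'cV[K]_27) (a : 'I_3) :
  (ex_mx t *m s) (mxvec_index last9 a) 0 =
  sec_val (s^~ 0) (p9 t) (cross (p9 t) (if a == 2%N :> nat then w9 K else u9 K))
      (cross (p9 t) (if a == 0%N :> nat then u9 K else w9 K)).
Proof.
rewrite /ex_mx frame_mx_mulE.
apply: agree_sec_val; first exact: ex_pts_last.
  by case: ifP => _; apply: agree_cross; auto using ex_pts_last, ex_u_last, exW_last.
by case: ifP => _; apply: agree_cross; auto using ex_pts_last, ex_u_last, exW_last.
Qed.

Lemma ex_mx_sec8_row8 t g0 g1 g2 i (a : 'I_3) :
  (ex_mx t *m sec8_col g0 g1 g2) (mxvec_index (row8 i) a) 0 = 0.
Proof.
rewrite ex_mx_row8 -[RHS](@sec8_val K g0 g1 g2 i a) //.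
by apply: eq_bigr => j _; rewrite mxE inord_val.
Qed.

Lemma ex_mx_sec8_last t g0 g1 g2 (a : 'I_3) :
  (ex_mx t *m sec8_col g0 g1 g2) (mxvec_index last9 a) 0 =
  (if a == 1%N :> nat then 2 else 4) * rho a t g0 g1 g2.
Proof.
by rewrite ex_mx_last -sec8_p9 //; apply: eq_bigr => j _; rewrite mxE.
Qed.

Lemma ex_mx_base t (s : 'cV[K]_27) :
  (forall i (a : 'I_3), (ex_mx t *m s) (mxvec_index (row8 i) a) 0 = 0) ->
  exists g0 g1 g2, s = sec8_col g0 g1 g2.
Proof.
move=> h; have [i a i8 a3|g0 [g1 [g2 e]]] := @val8_sec8 K (fun j => s (inord j) 0).
  by have := h (Ordinal i8) (Ordinal a3); rewrite ex_mx_row8.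
exists g0, g1, g2; apply/colP => j; rewrite mxE -e ?ltn_ord ?inord_val //.
Qed.

Lemma rho_eq0 t g0 g1 g2 (a : 'I_3) :
  (ex_mx t *m sec8_col g0 g1 g2) (mxvec_index last9 a) 0 = 0 -> rho a t g0 g1 g2 = 0.
Proof.
rewrite ex_mx_sec8_last => /eqP; rewrite mulf_eq0 => /orP[|/eqP //].
by case: ifP => _; rewrite pnatr_eq0.
Qed.

(** A kernel vector vanishes at the eight points, hence is one of the [sec8], and
    the conditions at the ninth point leave only zero away from the nine lines. *)
Lemma ex_D_neq0 t : lines9 t != 0 -> D_gen (ex_pts t) ex_u exW != 0.
Proof.
move=> l0; apply/negP => /eqP /det_eq0P[s s0 Xs].
have h (i : 'I_9) (a : 'I_3) : (ex_mx t *m s) (mxvec_index i a) 0 = 0 by rewrite /ex_mx Xs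
    mxE.
have [g0 [g1 [g2 es]]] := ex_mx_base (fun i => h (row8 i)).
have r a : (a < 3)%N -> rho a t g0 g1 g2 = 0.
  by move=> a3; have := h ord_max (Ordinal a3); rewrite es => /rho_eq0.
have [e0 e1 e2] := rho_det l0 (r 0%N isT) (r 1%N isT) (r 2%N isT).
case/eqP: s0; rewrite es e0 e1 e2; apply/colP => j; rewrite !mxE /sec8 /sec7.
rewrite !subr0 !mul0rn !(oppr0, subr0, addr0).
by case: (j : nat) => [|k]; do 27?[case: k => [//|k]]; rewrite //= nth_nil.
Qed.

End ExampleMatrices.

Section Roots.
Variable K : numClosedFieldType.
Implicit Types (t : K).

Lemma sec8_col0 : sec8_col (0 : K) 0 0 = 0.
Proof.
apply/colP => j; rewrite !mxE /sec8 /sec7 !subr0 !mul0rn !(oppr0, subr0, addr0).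
by case: (j : nat) => [|k]; do 27?[case: k => [//|k]]; rewrite //= nth_nil.
Qed.

Lemma sec8_col_coord (g0 g1 g2 : K) :
  [/\ sec8_col g0 g1 g2 (inord 21) 0 = g0, sec8_col g0 g1 g2 (inord 20) 0 = g1 *+ 2
    & sec8_col g0 g1 g2 (inord 11) 0 = g2 *+ 3].
Proof. by rewrite !mxE !inordK. Qed.

Lemma sec8_col_eq0 (g0 g1 g2 : K) : sec8_col g0 g1 g2 = 0 -> [/\ g0 = 0, g1 = 0 & g2 = 0].
Proof.
move=> e; have [] := sec8_col_coord g0 g1 g2; rewrite e !mxE => <- /esym/eqP e1 /esym/eqP e2.
by move: e1 e2; rewrite !mulrn_eq0 => /eqP -> /eqP ->.
Qed.

Lemma proportional_ker t (g0 g1 g2 : K) : t \in roots9 K ->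
  rho 0 t g0 g1 g2 = 0 -> rho 1 t g0 g1 g2 = 0 ->
  exists m, [/\ g0 = m * ker9 t 0, g1 = m * ker9 t 1 & g2 = m * ker9 t 2].
Proof.
move=> /roots9P[_ q _] h0 h1; have [e01 e02 e12] := rho01_ker h0 h1.
have [z0|z0] := eqVneq (ker9 t 0) 0; last first.
  exists (g0 / ker9 t 0); rewrite divfK //; split=> //; apply: (mulIf z0).
    by rewrite -e01; field.
  by rewrite -e02; field.
have z1 : ker9 t 1 != 0.
  by apply: contraNneq q => z1; rewrite /quad z0 z1; apply/eqP; ring.
exists (g1 / ker9 t 1); rewrite divfK // z0 mulr0; split=> //; apply: (mulIf z1).
  by rewrite e01 z0 mulr0 mul0r.
by rewrite -e12; field.
Qed.

Lemma ex_D_root t : t \in roots9 K -> D_gen (ex_pts t) (ex_u K) (exW K) = 0.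
Proof.
move=> /roots9P[l0 q _]; apply/det_eq0P; exists (sec8_col (ker9 t 0) (ker9 t 1) (ker9 t 2)).
  apply: contraNneq q => /sec8_col_eq0[-> -> ->].
  by rewrite /quad; apply/eqP; ring.
apply/colP => r; rewrite [RHS]mxE; case: {r}(mxvec_indexP (r : 'I_(9 * 3))) => i a.
rewrite -/(ex_mx t); move: i; apply: ord9_ind => [i|]; first exact: ex_mx_sec8_row8.
by rewrite ex_mx_sec8_last rho_ker // l0 mulr0; case: (a == 2%N :> nat); rewrite mulr0.
Qed.

(** At a root the section [adj_col] lies in the one-dimensional kernel. It is
    nonzero because replacing the row [adj_row] by a suitable coordinate form makes
    the matrix invertible, and the determinant of the new matrix is a coordinate of
    [adj_col]. *)
Lemma ex_adj_col_root t : t \in roots9 K -> exists2 m, m != 0 &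
  adj_col (ex_pts t) (ex_u K) (exW K) = sec8_col (m * ker9 t 0) (m * ker9 t 1) (m * ker9 t 2).
Proof.
move=> tr; have Xs := frame_mx_adj_col (ex_D_root tr); set s := adj_col _ _ _ in Xs *.
have h (i : 'I_9) (a : 'I_3) : (ex_mx t *m s) (mxvec_index i a) 0 = 0 by rewrite /ex_mx Xs
    mxE.
have [g0 [g1 [g2 es]]] := ex_mx_base (fun i => h (row8 i)).
have r a : (a < 3)%N -> rho a t g0 g1 g2 = 0.
  by move=> a3; have := h last9 (Ordinal a3); rewrite es => /rho_eq0.
have [m [e0 e1 e2]] := proportional_ker tr (r 0%N isT) (r 1%N isT).
exists m; last by rewrite es e0 e1 e2.
have s0 : s != 0; last first.
  apply: contraNneq s0 => m0; rewrite es e0 e1 e2 m0 !mul0r.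
  by rewrite sec8_col0.
have [_ q _] := roots9P tr.
have [j hj] : exists j : 'I_27, forall m', sec8_col (m' * ker9 t 0) (m' * ker9 t 1)
    (m' * ker9 t 2) j 0 = 0 -> m' = 0.
  have [z0|z0] := eqVneq (ker9 t 0) 0.
    have z1 : ker9 t 1 != 0.
      by apply: contraNneq q => z1; rewrite /quad z0 z1; apply/eqP; ring.
    exists (inord 20) => m'; have [_ -> _] := sec8_col_coord (m' * ker9 t 0) (m' * ker9 t 1)
      (m' * ker9 t 2).
    by move/eqP; rewrite mulrn_eq0 /= mulf_eq0 (negbTE z1) orbF => /eqP.
  exists (inord 21) => m'; have [-> _ _] := sec8_col_coord (m' * ker9 t 0) (m' * ker9 t 1)
    (m' * ker9 t 2).
  by move/eqP; rewrite mulf_eq0 (negbTE z0) orbF => /eqP.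
apply/negP => /eqP s0.
(* The coordinate j detects the multiples of the kernel vector. *)
pose Y : 'M[K]_27 := \matrix_(r, l) (if r == adj_row then (l == j)%:R else ex_mx t r l).
have : \det Y = 0.
  rewrite (expand_det_row _ (adj_row : 'I_27)) big1 // => l _.
  have -> : cofactor Y adj_row l = s l 0; last first.
    have -> : s l 0 = 0 by rewrite s0 mxE.
    by rewrite mulr0.
  rewrite /s /adj_col !mxE /cofactor; congr (_ * \det _); apply/matrixP => r1 c1.
  by rewrite !mxE eq_sym (negbTE (neq_lift _ _)).
case/det_eq0P => y y0 Yy.
have hy (i : 'I_9) (a : 'I_3) : mxvec_index i a != adj_row -> (ex_mx t *m y) (mxvec_index i a)
    0 = 0.
  move=> ne; have -> : (ex_mx t *m y) (mxvec_index i a) 0 = (Y *m y) (mxvec_index i a) 0.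
    rewrite [LHS]mxE [RHS]mxE; apply: eq_bigr => l _.
    by rewrite [Y _ _]mxE (negbTE ne).
  by rewrite Yy mxE.
have mi (i i' : 'I_9) (a a' : 'I_3) : mxvec_index i a = mxvec_index i' a' -> (i, a) =
    (i', a').
  by move=> e; apply: enum_rank_inj (cast_ord_inj e).
have [h0 [h1 [h2 ey]]] : exists g0 g1 g2, y = sec8_col g0 g1 g2.
  apply: ex_mx_base => i a; apply: hy; apply/negP => /eqP /mi [] e _.
  by have := ltn_ord i; rewrite e.
have ry a : (a < 2)%N -> rho a t h0 h1 h2 = 0.
  move=> a2; have a3 : (a < 3)%N by apply: ltnW.
  apply: (@rho_eq0 K t h0 h1 h2 (Ordinal a3)); rewrite -ey; apply: hy.
  by apply/negP => /eqP /mi [] e; move: a2; rewrite e.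
have [m' [e0' e1' e2']] := proportional_ker tr (ry 0%N isT) (ry 1%N isT).
have m0 : m' = 0.
  apply: hj; rewrite -e0' -e1' -e2' -ey; have -> : y j 0 = (Y *m y) adj_row 0; last by rewrite
    Yy mxE.
  rewrite mxE (bigD1 j) //= big1 ?addr0.
    by rewrite [Y _ _]mxE !eqxx mul1r.
  by move=> l lj; rewrite [Y _ _]mxE eqxx (negbTE lj) mul0r.
by case/eqP: y0; rewrite ey e0' e1' e2' m0 !mul0r sec8_col0.
Qed.

End Roots.

(** * The example line satisfies the conditions of genericity *)

Section Example.
Variable K : numClosedFieldType.
Implicit Types (t : K).

Definition probe : 'rV[K]_3 := \row_j vec 2 1 0 j.
Definition base9_row : 'rV[K]_3 := \row_j base9 K j.

Lemma agree_row (x : nat -> K) : agree (crd (\row_(j < 3) x j)) x.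
Proof. by move=> k k3; rewrite /crd mxE inordK. Qed.

(** A cubic through the eight points and the probe is a multiple of [cuby], as
    [cubx] does not vanish at the probe but [cuby] does. *)
Lemma C_det_probe_neq0 (p : 'M[K]_(9, 3)) :
  (forall i, agree (pts p (row8 i)) (base8 K i)) -> cuby (pts p ord_max) != 0 ->
  C_det (col_mx p probe : 'M_(9 + 1, 3)) != 0.
Proof.
move=> hp y9; apply/negP => /eqP /C_det_eq0[g [g0 hg e]].
have ep i : form_val 3 (coefs g) (pts p i) = 0.
  have := e (lshift 1 i : 'I_(9 + 1)); rewrite (evalf_coefs _ hg).
  by rewrite (@rowKu _ 9 1).
have ev : form_val 3 (coefs g) (crd probe) = 0.
  have := e (rshift 9 0 : 'I_(9 + 1)); rewrite (evalf_coefs _ hg).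
  by rewrite (@rowKd _ 9 1) row_id.
have [i i8|a [b [eab h0]]] := @cubics_through_base8 K (coefs g).
  by rewrite -(eq_form_val _ _ (hp (Ordinal i8))).
have az : a = 0.
  move: ev; rewrite (eq_form_val _ _ (@agree_row _)) eab /cubx /cuby /vec /= => /eqP.
  have -> : a * (2 * (0 ^+ 2 - 1 ^+ 2) + 2 * 1 * (2 ^+ 2 - 0 ^+ 2) + 3 * 0 * (1 ^+ 2 - 2 ^+
      2)) +
    b * (6 * 2 * (0 ^+ 2 - 1 ^+ 2) + 3 * 1 * (2 ^+ 2 - 0 ^+ 2) + 2 * 0 * (1 ^+ 2 - 2 ^+ 2)) =
      a * 6 by ring.
  by rewrite mulf_eq0 pnatr_eq0 orbF => /eqP.
have bz : b = 0.
  move: (ep ord_max); rewrite eab az mul0r add0r => /eqP.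
  by rewrite mulf_eq0 (negbTE y9) orbF => /eqP.
by case/eqP: g0; apply: (coefs_eq0 hg); apply: h0.
Qed.

Lemma C_det_base9_eq0 (p : 'M[K]_(9, 3)) :
  (forall i, agree (pts p (row8 i)) (base8 K i)) -> C_det (col_mx p base9_row : 'M_(9 + 1, 3))
    = 0.
Proof.
move=> hp; have [G hG eG] := C_det_form p; rewrite -eG (evalf_coefs _ hG).
have [i i8|a [b [eab _]]] := @cubics_through_base8 K (coefs G).
  rewrite -(eq_form_val _ _ (hp (Ordinal i8))) -(evalf_coefs _ hG) eG.
  apply: (determinant_alternate (i1 := lshift 1 (row8 (Ordinal i8)) : 'I_(9 + 1)) (i2 :=
    rshift 9 0)).
    by rewrite -val_eqE /= ltn_eqF // (leq_trans i8).
  by move=> k; rewrite [LHS]mxE [RHS]mxE (@rowKu _ 9 1) (@rowKd _ 9 1) row_id.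
rewrite (eq_form_val _ _ (@agree_row _)) eab /cubx /cuby /base9 /vec /=; ring.
Qed.

Lemma cuby_agree (v v' : nat -> K) : agree v v' -> cuby v = cuby v'.
Proof. by move=> e; rewrite /cuby !e. Qed.

(** The cubic G vanishes at the ninth base point while the discriminant does not,
    and G does not vanish at the probe. *)
Lemma ex_witness_neq0 t : t \in roots9 K -> witness (ex_pts t) (ex_u K) (exW K) probe
  base9_row != 0.
Proof.
move=> tr; have [_ q y] := roots9P tr.
have Cv : C_det (col_mx (ex_pts t) probe : 'M_(9 + 1, 3)) != 0.
  by apply: C_det_probe_neq0; [exact: ex_pts_row8|rewrite (cuby_agree (ex_pts_last t))].
have Co : C_det (col_mx (ex_pts t) base9_row : 'M_(9 + 1, 3)) = 0 by apply: C_det_base9_eq0;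
    exact: ex_pts_row8.
have [m m0 es] := ex_adj_col_root tr.
rewrite /witness !C_genE Co expr0n mulr0 subr0 !mulf_neq0 ?expf_neq0 //.
rewrite es (agree_disc_val _ (@agree_row _)).
have -> : disc_val ((sec8_col (m * ker9 t 0) (m * ker9 t 1) (m * ker9 t 2))^~ 0) (base9 K) =
   disc_val (fun j : 'I_27 => sec8 (m * ker9 t 0) (m * ker9 t 1) (m * ker9 t 2) j) (base9 K).
  by apply: eq_disc_val => // j; rewrite mxE.
rewrite disc_base9.
(* The discriminant is quadratic in the section, hence the factor m ^+ 2. *)
have -> : quad (m * ker9 t 0) (m * ker9 t 1) (m * ker9 t 2) =
   m ^+ 2 * quad (ker9 t 0) (ker9 t 1) (ker9 t 2).
  by rewrite /quad; ring.
by rewrite !mulf_neq0 ?pnatr_eq0 ?expf_neq0.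
Qed.

Let ex_D := D_line (exP K) (exU K) (exa K) (exb K) (exW K).

Lemma horner_ex_D t : ex_D.[t] = D_gen (ex_pts t) (ex_u K) (exW K).
Proof. exact: horner_D_line. Qed.

Lemma lines9_3 : lines9 (3 : K) != 0.
Proof.
have -> : lines9 (3 : K) = - (3 * 5 * 7 * 8 * 4 * 2 * 11 * 5) by rewrite /lines9; ring.
by rewrite oppr_eq0 !mulf_neq0 ?pnatr_eq0.
Qed.

(** Nine distinct roots and degree at most 9. *)
Lemma ex_D_eqp : ex_D %= \prod_(z <- roots9 K) ('X - z%:P).
Proof.
have D0 : ex_D != 0.
  apply: contraNneq (ex_D_neq0 lines9_3) => D0.
  by rewrite -horner_ex_D D0 horner0.
have dv : \prod_(z <- roots9 K) ('X - z%:P) %| ex_D.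
  apply: uniq_roots_dvdp; last by rewrite uniq_rootsE roots9_uniq.
  by apply/allP => z zr; rewrite rootE horner_ex_D ex_D_root.
rewrite eqp_sym -dvdp_size_eqp // eqn_leq dvdp_leq //=.
by rewrite size_prod_XsubC; exact: size_D_line.
Qed.

Lemma size_ex_D : size ex_D = 10%N.
Proof. by rewrite (eqp_size ex_D_eqp) size_prod_XsubC. Qed.

Lemma ex_coprime : coprimep ex_D (witness_line (exP K) (exU K) (exa K) (exb K) (exW K) probe
  base9_row * ex_D^`()).
Proof.
have sep : separable_poly ex_D by rewrite (eqp_separable ex_D_eqp) separable_prod_XsubC
    roots9_uniq.
rewrite coprimepMr; apply/andP; split; last by move: sep; rewrite unlock.
apply/Pdiv.ClosedField.coprimepP => t; rewrite (eqp_root ex_D_eqp) root_prod_XsubC =>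
  /ex_witness_neq0.
rewrite -[_.[t]]/(horner_eval t _) witness_map line_at !map_polyC_at; exact.
Qed.

Lemma ex_C_lead_neq0 :
  C_det (col_mx (col_mx (exP K) (exb K) : 'M_(8 + 1, 3)) probe : 'M_(9 + 1, 3)) != 0.
Proof.
apply: C_det_probe_neq0 => [i k k3|].
  by rewrite /pts /crd mxE (@col_mxEu _ 8 1) mxE inordK.
have -> : cuby (pts (col_mx (exP K) (exb K) : 'M_(8 + 1, 3)) ord_max) = cuby (u9 K).
  by apply: cuby_agree => k k3; rewrite /pts /crd mxE ord_max9 (@col_mxEd _ 8 1) !mxE !inordK.
have -> : cuby (u9 K) = - 14 by rewrite /cuby /u9 /vec /=; ring.
by rewrite oppr_eq0 pnatr_eq0.
Qed.

Lemma R_det_neq0 : R_det (\matrix_(i < 9, j < 3) double_pts K i j) (\row_j vec 1 1 0 j) != 0.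
Proof.
apply/negP => /eqP /R_det_eq0[g [g0 hg dg eg]].
case/eqP: g0; apply: (coefs_eq0 hg); apply: sextic_double_pts_eq0 => [i l i9 l3|].
  rewrite -(dg (Ordinal i9) (Ordinal l3)) (deriv_coefs _ _ hg); apply: eq_form_deriv_val => k
    k3.
  by rewrite /crd !mxE inordK.
by rewrite -[RHS]eg (evalf_coefs _ hg); apply: eq_form_val => k k3; rewrite /crd mxE inordK.
Qed.

(** * The theorem *)

Theorem det_A_square (s : 'I_27 -> 'Hom(Sym K 2, Sym K 2)) (hs : is_basis_H0E s)
  (t : 'I_27 -> 'Hom(Sym K 2, Form K 4)) (ht : is_basis_H0Edual6 t)
  (N : {mpoly K[9 * 3]}) (hN : defines_N N) :
  exists2 lambda : K, lambda != 0 &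
    forall p : 'M[K]_(9, 3),
      \det (A_mx s t (sum_pow6 p)) = lambda * eval9 N p ^+ 2.
Proof.
have fr := @example_frame K.
have cr P a b x y := N_cross_last hN ex_C_lead_neq0 fr size_ex_D ex_coprime P a b x y.
have C0 : C_det (col_mx (ex_pts (3 : K)) probe : 'M_(9 + 1, 3)) != 0.
  apply: C_det_probe_neq0; first exact: ex_pts_row8.
  rewrite (cuby_agree (ex_pts_last 3)).
  have -> : cuby (p9 (3 : K)) = - (386) by rewrite /cuby /p9 /vec /=; ring.
  by rewrite oppr_eq0 pnatr_eq0.
have D0 : \det (canonical_mx (pts (ex_pts (3 : K)))) != 0.
  have [k kn0 ek] := det_canonical_square (fr : forall i, (fun i => vol (pts (ex_pts 0) i)
      (pts (ex_u K) i) (pts (exW K) i)) i != 0).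
  rewrite (ek _ (pts (ex_u K)) (pts (exW K))).
    by rewrite mulf_neq0 ?expf_neq0 ?ex_D_neq0 ?lines9_3.
  exact: vol_line.
exact: (det_A_from_example hN C0 cr D0 hs ht R_det_neq0).
Qed.

End Example.

Theorem theorem4p4 (R : realType)
  (s : 'I_27 -> 'Hom(Sym R[i] 2, Sym R[i] 2)) (hs : is_basis_H0E s)
  (t : 'I_27 -> 'Hom(Sym R[i] 2, Form R[i] 4)) (ht : is_basis_H0Edual6 t)
  (N : {mpoly R[i][9 * 3]}) (hN : defines_N N) :
  exists2 lambda : R[i], lambda != 0 &
    forall p : 'M[R[i]]_(9, 3),
      \det (A_mx s t (sum_pow6 p)) = lambda * eval9 N p ^+ 2.
Proof. exact: det_A_square. Qed.
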